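(* In the case $m=2$ (i.e. $K(2)=-1$) the modified characters of the N=3 modules are given by the following formulas, as identities of meromorphic functions of $(\tau,z)\in\mathbb{C}_+\times\mathbb{C}$ (for the module $H(\Lambda^{[-1,1]})$ the modified characters $\widetilde{\rm ch}$ coincide with the honest characters ${\rm ch}$): 1) $\widetilde{\rm ch}^{(+)}_{H(\Lambda^{[-1,0]})}(\tau,z)=-\frac12\,\frac{\eta(\frac{\tau}{2})}{\eta(2\tau)\eta(\tau)}\,\vartheta_{01}(\tau,z)$; 2) $\widetilde{\rm ch}^{(+)}_{H(\Lambda^{[-1,1]})}(\tau,z)={\rm ch}^{(+)}_{H(\Lambda^{[-1,1]})}(\tau,z)=i\,\frac{\eta(2\tau)}{\eta(\frac{\tau}{2})\eta(\tau)}\,\vartheta_{10}(\tau,z)$; 3) $\widetilde{\rm ch}^{(-)}_{H(\Lambda^{[-1,0]})}(\tau,z)=-\frac{i}{2}\,\frac{\eta(\tau)^2}{\eta(\frac{\tau}{2})\eta(2\tau)^2}\,\vartheta_{00}(\tau,z)$; 4) $\widetilde{\rm ch}^{(-)}_{H(\Lambda^{[-1,1]})}(\tau,z)={\rm ch}^{(-)}_{H(\Lambda^{[-1,1]})}(\tau,z)=-i\,\frac{\eta(\frac{\tau}{2})\eta(2\tau)^2}{\eta(\tau)^4}\,\vartheta_{10}(\tau,z)$; 5) $\widetilde{\rm ch}^{(+){\rm tw}(\sigma_-)}_{H(\Lambda^{[-1,1]})}(\tau,z)={\rm ch}^{(+){\rm tw}(\sigma_-)}_{H(\Lambda^{[-1,1]})}(\tau,z)=\frac{i}{\sqrt2}\Big\{\frac{\eta(\tau)^2}{\eta(\frac{\tau}{2})^2\eta(2\tau)}\vartheta_{00}(\tau,z)+\frac{\eta(\frac{\tau}{2})^2\eta(2\tau)}{\eta(\tau)^4}\vartheta_{01}(\tau,z)\Big\}$;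 6) $\widetilde{\rm ch}^{(+){\rm tw}(\sigma_+)}_{H(\Lambda^{[-1,1]})}(\tau,z)={\rm ch}^{(+){\rm tw}(\sigma_+)}_{H(\Lambda^{[-1,1]})}(\tau,z)=\frac{i}{\sqrt2}\Big\{\frac{\eta(\tau)^2}{\eta(\frac{\tau}{2})^2\eta(2\tau)}\vartheta_{00}(\tau,z)-\frac{\eta(\frac{\tau}{2})^2\eta(2\tau)}{\eta(\tau)^4}\vartheta_{01}(\tau,z)\Big\}$.
   Context: Notation: $\mathbb{C}_+$ is the upper half-plane, $q^a:=e^{2\pi i a\tau}$, $\eta(\tau)=q^{1/24}\prod_{n\ge1}(1-q^n)$, and for $a,b\in\{0,1\}$ the Mumford theta functions are $\vartheta_{ab}(\tau,z)=\sum_{n\in\mathbb{Z}}e^{\pi i\tau(n+\frac a2)^2+2\pi i(n+\frac a2)(z+\frac b2)}$. For $m\in\frac12\mathbb{N}$ ($\mathbb{N}$ = positive integers), $s\in\frac12\mathbb{Z}$ put $\Phi_1^{[m,s]}(\tau,z_1,z_2,t)=e^{-2\pi imt}\sum_{j\in\mathbb{Z}}\frac{e^{2\pi imj(z_1+z_2)+2\pi isz_1}e^{2\pi i\tau(mj^2+sj)}}{1-e^{2\pi iz_1}e^{2\pi ij\tau}}$, $\Phi_2^{[m,s]}(\tau,z_1,z_2,t)=e^{-2\pi imt}\sum_{j\in\mathbb{Z}}\frac{e^{-2\pi imj(z_1+z_2)-2\pi isz_2}e^{2\pi i\tau(mj^2+sj)}}{1-e^{-2\pi iz_2}e^{2\pi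 ij\tau}}$, $\Phi^{[m,s]}=\Phi_1^{[m,s]}-\Phi_2^{[m,s]}$. Let $\theta_{k,m}(\tau,z)=\sum_{j\in\mathbb{Z}}e^{2\pi im(j+\frac{k}{2m})z}e^{2\pi i\tau m(j+\frac{k}{2m})^2}$, $E(x)=2\int_0^xe^{-\pi t^2}dt$, and $R_{j;m}(\tau,w)=\sum_{n\in j+2m\mathbb{Z}}\big\{{\rm sgn}(n-\frac12-j+2m)-E\big((n-2m\frac{{\rm Im}\,w}{{\rm Im}\,\tau})\sqrt{{\rm Im}(\tau)/m}\big)\big\}e^{-\frac{\pi in^2\tau}{2m}+2\pi inw}$. The correction term is $\Phi^{[m,s]}_{\rm add}(\tau,z_1,z_2,t)=-\frac12e^{-2\pi imt}\sum_{k\in s+\mathbb{Z},\,s\le k<s+2m}R_{k;m}(\tau,\frac{z_1-z_2}{2})[\theta_{k,m}-\theta_{-k,m}](\tau,z_1+z_2)$, and the modification is $\widetilde\Phi^{[m,s]}=\Phi^{[m,s]}+\Phi^{[m,s]}_{\rm add}$. N=3 denominators: $R^{(+)}(\tau,z)=\eta(\frac\tau2)\eta(2\tau)\frac{\vartheta_{11}(\tau,z)}{\vartheta_{00}(\tau,z)}$, $R^{(-)}(\tau,z)=\frac{\eta(\tau)^3}{\eta(\frac\tau2)}\frac{\vartheta_{11}(\tau,z)}{\vartheta_{01}(\tau,z)}$, $R^{(+){\rm tw}}(\tau,z)=\frac1{\sqrt2}\frac{\eta(\tau)^3}{\eta(2\tau)}\frac{\vartheta_{11}(\tau,z)}{\vartheta_{10}(\tau,z)}$.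 For a positive integer $m$ and an integer $0\le m_2\le m$, put $K(m)=-\frac{m+2}{4}$ (so $K(2)=-1$), and let $H(\Lambda^{[K(m),m_2]})$ be the N=3 superconformal module obtained by quantum Hamiltonian reduction of the $\widehat{osp}(3|2)$-module of highest weight $\Lambda^{[K(m),m_2]}$. Its honest character, supercharacter and twisted characters (functions of $(\tau,z)$), with $s=\frac{m_2+1}2$, are given by $R^{(+)}{\rm ch}^{(+)}=\Phi^{[\frac m2,s]}(2\tau,z+\frac\tau2-\frac12,z-\frac\tau2+\frac12,\frac\tau8)$, $R^{(-)}{\rm ch}^{(-)}=\Phi^{[\frac m2,s]}(2\tau,z+\frac\tau2,z-\frac\tau2,\frac\tau8)$, $R^{(+){\rm tw}}{\rm ch}^{(+){\rm tw}(\sigma_+)}=\Phi^{[\frac m2,s]}(2\tau,z+\tau-\frac12,z-\tau+\frac12,\frac\tau2)$, $R^{(+){\rm tw}}{\rm ch}^{(+){\rm tw}(\sigma_-)}=\Phi^{[\frac m2,s]}(2\tau,z-\frac12,z+\frac12,0)$. The modified characters $\widetilde{\rm ch}$ are defined by the same four formulas with $\Phi$ replaced by $\widetilde\Phi$. *)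

(* Defs.v *)
From Stdlib Require Export Reals ZArith.
From Coquelicot Require Export Coquelicot.

Open Scope R_scope.
Open Scope C_scope.

Definition Cexp (z : C) : C :=
  ((exp (Re z) * cos (Im z))%R, (exp (Re z) * sin (Im z))%R).

Definition e2pi (x : C) : C := Cexp (2 * PI * Ci * x).

Definition CLim_seq (u : nat -> C) : C :=
  (real (Lim_seq (fun n => Re (u n))), real (Lim_seq (fun n => Im (u n)))).

Definition CSeries (a : nat -> C) : C :=
  (Series (fun n => Re (a n)), Series (fun n => Im (a n))).

(* Sum over all integers: the terms n = 0, 1, 2, ... and n = -1, -2, ...
   are two separate series. *)
Definition sumZ (f : Z -> C) : C :=
  CSeries (fun n => f (Z.of_nat n)) + CSeries (fun n => f (- Z.of_nat (S n))%Z).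

(* prodC a N = a 1 * ... * a N *)
Fixpoint prodC (a : nat -> C) (N : nat) : C :=
  match N with
  | O => 1
  | S N' => prodC a N' * a N
  end.

Definition eta (tau : C) : C :=
  e2pi (tau / 24) * CLim_seq (prodC (fun n => 1 - e2pi (INR n * tau))).

(* Mumford's theta functions; used for a, b in {0, 1}. *)
Definition vartheta (a b : nat) (tau z : C) : C :=
  sumZ (fun n =>
    Cexp (PI * Ci * tau * (IZR n + INR a / 2) ^ 2
          + 2 * PI * Ci * (IZR n + INR a / 2) * (z + INR b / 2))).

(* The half-integral parameters m and s are encoded by the integers
   dm = 2m and ds = 2s, so that [Phi dm ds] is Phi^{[dm/2, ds/2]};
   dm is meant to be positive. *)
Definition Phi1 (dm : nat) (ds : Z) (tau z1 z2 t : C) : C :=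
  let m : C := INR dm / 2 in
  let s : C := IZR ds / 2 in
  e2pi (- (m * t)) *
  sumZ (fun n => let j : C := IZR n in
    e2pi (m * j * (z1 + z2) + s * z1) * e2pi (tau * (m * j ^ 2 + s * j))
    / (1 - e2pi z1 * e2pi (j * tau))).

Definition Phi2 (dm : nat) (ds : Z) (tau z1 z2 t : C) : C :=
  let m : C := INR dm / 2 in
  let s : C := IZR ds / 2 in
  e2pi (- (m * t)) *
  sumZ (fun n => let j : C := IZR n in
    e2pi (- (m * j * (z1 + z2)) - s * z2) * e2pi (tau * (m * j ^ 2 + s * j))
    / (1 - e2pi (- z2) * e2pi (j * tau))).

Definition Phi (dm : nat) (ds : Z) (tau z1 z2 t : C) : C :=
  Phi1 dm ds tau z1 z2 t - Phi2 dm ds tau z1 z2 t.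

(* theta_{k,m} with m = dm/2 *)
Definition theta (k : R) (dm : nat) (tau z : C) : C :=
  let m : C := INR dm / 2 in
  sumZ (fun n => let x : C := IZR n + k / (2 * m) in
    e2pi (m * x * z) * e2pi (tau * m * x ^ 2)).

Definition Efun (x : R) : R :=
  (2 * RInt (fun t => exp (- (PI * t ^ 2))) 0 x)%R.

(* R_{j;m} with m = dm/2; the summation index is n = j + 2m l, l in Z. *)
Definition Rcorr (j : R) (dm : nat) (tau w : C) : C :=
  let m : R := (INR dm / 2)%R in
  sumZ (fun l => let n : R := (j + 2 * m * IZR l)%R in
    RtoC (sign (n - 1 / 2 - j + 2 * m)
          - Efun ((n - 2 * m * (Im w / Im tau)) * sqrt (Im tau / m)))%R
    * Cexp (- (PI * Ci * n ^ 2 * tau / (2 * m)) + 2 * PI * Ci * n * w)).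

(* The index k runs over s, s + 1, ..., s + 2m - 1. *)
Definition Phi_add (dm : nat) (ds : Z) (tau z1 z2 t : C) : C :=
  let m : C := INR dm / 2 in
  let s : R := (IZR ds / 2)%R in
  - (1 / 2) * e2pi (- (m * t)) *
  sum_n_m (fun l : nat => let k : R := (s + INR l)%R in
    Rcorr k dm tau ((z1 - z2) / 2)
    * (theta k dm tau (z1 + z2) - theta (- k)%R dm tau (z1 + z2)))
    0 (pred dm).

Definition Phi_mod (dm : nat) (ds : Z) (tau z1 z2 t : C) : C :=
  Phi dm ds tau z1 z2 t + Phi_add dm ds tau z1 z2 t.

(* Denominators of the N = 3 superconformal algebra *)
Definition Rden_p (tau z : C) : C :=
  eta (tau / 2) * eta (2 * tau) * (vartheta 1 1 tau z / vartheta 0 0 tau z).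

Definition Rden_m (tau z : C) : C :=
  eta tau ^ 3 / eta (tau / 2) * (vartheta 1 1 tau z / vartheta 0 1 tau z).

Definition Rden_tw (tau z : C) : C :=
  1 / sqrt 2 * (eta tau ^ 3 / eta (2 * tau))
  * (vartheta 1 1 tau z / vartheta 1 0 tau z).

Definition Klevel (m : nat) : R := (- ((INR m + 2) / 4))%R.

(* The (super/twisted) characters of H(Lambda^{[K(m), m2]}) are quotients of
   F^{[m/2, (m2+1)/2]}, at special arguments, by the denominators above, with
   F = Phi (honest) or F = Phi_mod (modified).  The quotients are meaningful
   where the two theta functions in the denominator do not vanish: the
   functions eta have no zeros on the upper half-plane, and a summand of Phi
   at these arguments can only have a pole at a zero of vartheta 0 0,
   vartheta 0 1, vartheta 1 0 for Rden_p, Rden_m, Rden_tw respectively. *)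
Definition char_p (F : nat -> Z -> C -> C -> C -> C -> C)
  (m m2 : nat) (tau z : C) : C :=
  F m (Z.of_nat m2 + 1)%Z (2 * tau)
    (z + tau / 2 - 1 / 2) (z - tau / 2 + 1 / 2) (tau / 8)
  / Rden_p tau z.

Definition char_m (F : nat -> Z -> C -> C -> C -> C -> C)
  (m m2 : nat) (tau z : C) : C :=
  F m (Z.of_nat m2 + 1)%Z (2 * tau)
    (z + tau / 2) (z - tau / 2) (tau / 8)
  / Rden_m tau z.

Definition char_tw_sp (F : nat -> Z -> C -> C -> C -> C -> C)
  (m m2 : nat) (tau z : C) : C :=
  F m (Z.of_nat m2 + 1)%Z (2 * tau)
    (z + tau - 1 / 2) (z - tau + 1 / 2) (tau / 2)
  / Rden_tw tau z.

Definition char_tw_sm (F : nat -> Z -> C -> C -> C -> C -> C)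
  (m m2 : nat) (tau z : C) : C :=
  F m (Z.of_nat m2 + 1)%Z (2 * tau)
    (z - 1 / 2) (z + 1 / 2) 0
  / Rden_tw tau z.

(* Honest characters: ch^{(+)}, ch^{(-)}, and the twisted ch^{(+)tw} for
   sigma_+ (sp) and sigma_- (sm). *)
Definition ch_p := char_p Phi.
Definition ch_m := char_m Phi.
Definition ch_tw_sp := char_tw_sp Phi.
Definition ch_tw_sm := char_tw_sm Phi.

Definition mch_p := char_p Phi_mod.
Definition mch_m := char_m Phi_mod.
Definition mch_tw_sp := char_tw_sp Phi_mod.
Definition mch_tw_sm := char_tw_sm Phi_mod.

(* Main.v *)
(* Write q = e(tau), y = e(u).  With m = 1, the two halves of Phi combine into one bilateral sum:
   for s = 1 into A(u) = sum_n y^n q^(n(n+1)/2) / (1 - y q^n), and for the twisted characters and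
   for s = 1/2 with its correction term (where the nonholomorphic parts of R cancel in pairs) into
   T(u) = sum_n (-+1)^n y^n q^(n^2/2) (1 + y q^n) / (1 - y q^n), the sign being the choice of a
   square root of q.

   Let th be the theta function vanishing at y = 1.  As th(y q^n) is an elementary multiple of
   th(y), multiplying the n-th term by th(y) gives a monomial times G(y q^n), where
   G = th / (1 - y) or G = (1 + y) th / (1 - y) has an explicit, rapidly convergent Laurent
   expansion.  Interchanging the sums, th A and th T become Laurent series in y whose coefficients
   satisfy a two-step recurrence; the symmetry of G under y -> 1/y leaves one free constant, so
   th A and th T are constant multiples of theta functions of modulus 2 tau and tau/2.  The
   constant is found by letting y tend to 1, where only the n = 0 term survives.  Jacobi's triple
   product (the limit of its finite form) turns everything into eta quotients. *)
Require Import Defs.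
From Stdlib Require Import Lra Lia Psatz.

(** No complex analysis enters: absolutely convergent bilateral series, dominated convergence and
    the interchange of two sums suffice. The delicate point is y = 1, where the constants are
    determined although th vanishes and the quotients have a pole. It is handled by giving G through
    its Laurent coefficients (partial theta sums) instead of as a quotient, so that G makes sense at
    y = 1.

    Honest and modified characters agree for s = 1 because the correction contains the differences
    theta_{k,1} - theta_{-k,1} with integral k; then k and -k agree modulo 2m = 2 and every
    difference vanishes, whatever R is. For s = 1/2 the honest Phi holds only half of T: of the
    numerator 1 + y q^n, the part 1 for odd n and the part y q^n for even n. The theta functions in
    the correction are the differences of the two parts over odd and over even n, and adding them
    with weight one half turns the incomplete sum into T / 2, up to an elementary factor. *)

(** * Limits of complex sequences *)

Definition limC (u : nat -> C) (l : C) : Prop :=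
  is_lim_seq (fun n => Cmod (u n - l)) 0.

Lemma limC_squeeze (u : nat -> C) (l : C) (v : nat -> R) :
  (forall n, Cmod (u n - l) <= v n)%R -> is_lim_seq v 0 -> limC u l.
Proof.
  intros H Hv. apply (is_lim_seq_le_le (fun _ => 0%R) _ v); auto.
  - intros n; split; [apply Cmod_ge_0 | apply H].
  - apply is_lim_seq_const.
Qed.

Lemma limC_ext (u v : nat -> C) (l : C) :
  (forall n, u n = v n) -> limC u l -> limC v l.
Proof.
  intros H; apply is_lim_seq_ext; intros n; now rewrite H.
Qed.

Lemma limC_const (l : C) : limC (fun _ => l) l.
Proof.
  apply (limC_squeeze _ _ (fun _ => 0%R)); [| apply is_lim_seq_const].
  intros _; replace (l - l) with (RtoC 0) by ring. rewrite Cmod_0; lra.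
Qed.

Lemma limC_plus (u v : nat -> C) (l k : C) :
  limC u l -> limC v k -> limC (fun n => u n + v n) (l + k).
Proof.
  intros Hu Hv.
  apply (limC_squeeze _ _ (fun n => Cmod (u n - l) + Cmod (v n - k))%R).
  - intros n. replace (u n + v n - (l + k)) with ((u n - l) + (v n - k)) by ring.
    apply Cmod_triangle.
  - replace (Finite 0) with (Rbar_plus 0 0) by (simpl; f_equal; ring).
    now apply is_lim_seq_plus'.
Qed.

Lemma limC_mult (u v : nat -> C) (l k : C) :
  limC u l -> limC v k -> limC (fun n => u n * v n) (l * k).
Proof.
  intros Hu Hv.
  apply (limC_squeeze _ _ (fun n => Cmod (u n - l) * Cmod (v n - k)
    + (Cmod l * Cmod (v n - k) + Cmod k * Cmod (u n - l)))%R).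
  - intros n.
    replace (u n * v n - l * k) with
      ((u n - l) * (v n - k) + (l * (v n - k) + k * (u n - l))) by ring.
    eapply Rle_trans; [apply Cmod_triangle|]. rewrite Cmod_mult.
    apply Rplus_le_compat_l.
    eapply Rle_trans; [apply Cmod_triangle|]. rewrite !Cmod_mult. lra.
  - replace 0%R with (0 * 0 + (Cmod l * 0 + Cmod k * 0))%R by ring.
    apply is_lim_seq_plus'; [now apply is_lim_seq_mult'|].
    apply is_lim_seq_plus'; apply is_lim_seq_mult'; auto; apply is_lim_seq_const.
Qed.

Lemma limC_scal (c : C) (u : nat -> C) (l : C) :
  limC u l -> limC (fun n => c * u n) (c * l).
Proof. intros H; apply limC_mult; auto using limC_const. Qed.

Lemma limC_unique (u : nat -> C) (l k : C) : limC u l -> limC u k -> l = k.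
Proof.
  intros Hl Hk.
  assert (H : limC (fun n => u n + (-1) * u n) (l + (-1) * k))
    by (apply limC_plus; auto using limC_scal).
  assert (H0 : is_lim_seq (fun _ => Cmod (l + -1 * k)) 0).
  { eapply is_lim_seq_ext; [| exact H]. intros n; simpl.
    replace (u n + -1 * u n - (l + -1 * k)) with (- (l + -1 * k)) by ring.
    apply Cmod_opp. }
  apply is_lim_seq_unique in H0. rewrite Lim_seq_const in H0.
  injection H0 as H0. apply Cmod_eq_0 in H0.
  replace l with (l + -1 * k + k) by ring. rewrite H0. ring.
Qed.

Lemma limC_incr_1 (u : nat -> C) (l : C) :
  limC (fun n => u (S n)) l <-> limC u l.
Proof.
  symmetry. apply (is_lim_seq_incr_1 (fun n => Cmod (u n - l))).
Qed.

Lemma limC_subseq (u : nat -> C) (l : C) (s : nat -> nat) :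
  (forall n, (n <= s n)%nat) -> limC u l -> limC (fun n => u (s n)) l.
Proof.
  intros Hs Hu. apply (is_lim_seq_subseq (fun n => Cmod (u n - l)) _ s); auto.
  intros P [N HN]; exists N; intros n Hn; apply HN. specialize (Hs n); lia.
Qed.

Lemma limC_pair (u : nat -> C) (a b : R) :
  is_lim_seq (fun n => Re (u n)) a -> is_lim_seq (fun n => Im (u n)) b ->
  limC u (a, b).
Proof.
  intros Ha Hb.
  apply (limC_squeeze _ _ (fun n => Rabs (Re (u n) - a) + Rabs (Im (u n) - b))%R).
  - intros n.
    replace (u n - (a, b)) with
      (RtoC (Re (u n) - a) + Ci * RtoC (Im (u n) - b)).
    2:{ destruct (u n); apply injective_projections; simpl; ring. }
    eapply Rle_trans; [apply Cmod_triangle|].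
    rewrite Cmod_mult, !Cmod_R.
    replace (Cmod Ci) with 1%R; [lra|].
    unfold Cmod, Ci; simpl. replace (0 * (0 * 1) + 1 * (1 * 1))%R with 1%R by ring.
    now rewrite sqrt_1.
  - assert (K : forall (v : nat -> R) (c : R), is_lim_seq v c ->
       is_lim_seq (fun n => Rabs (v n - c)) 0).
    { intros v c Hv. replace (Finite 0) with (Rbar_abs (c - c)%R).
      2:{ simpl; rewrite Rminus_diag, Rabs_R0; reflexivity. }
      apply is_lim_seq_abs. apply is_lim_seq_minus'; auto; apply is_lim_seq_const. }
    replace 0%R with (0 + 0)%R by ring.
    apply is_lim_seq_plus'; apply K; auto.
Qed.

Lemma limC_Re (u : nat -> C) (l : C) :
  limC u l -> is_lim_seq (fun n => Re (u n)) (Re l).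
Proof.
  intros H.
  apply (is_lim_seq_le_le (fun n => Re l - Cmod (u n - l))%R _
    (fun n => Re l + Cmod (u n - l))%R).
  - intros n. assert (K := Rmax_Cmod (u n - l)).
    assert (K1 := Rmax_l (Rabs (fst (u n - l))) (Rabs (snd (u n - l)))).
    assert (K2 : (Rabs (Re (u n) - Re l) <= Cmod (u n - l))%R).
    { change (fst (u n - l)) with (Re (u n) - Re l)%R in K1, K. eapply Rle_trans; eassumption. }
    apply Rabs_le_between in K2. lra.
  - replace (Finite (Re l)) with (Finite (Re l - 0)%R) by (f_equal; ring).
    apply is_lim_seq_minus'; auto; apply is_lim_seq_const.
  - replace (Finite (Re l)) with (Finite (Re l + 0)%R) by (f_equal; ring).
    apply is_lim_seq_plus'; auto; apply is_lim_seq_const.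
Qed.

Lemma limC_Im (u : nat -> C) (l : C) :
  limC u l -> is_lim_seq (fun n => Im (u n)) (Im l).
Proof.
  intros H.
  assert (K : forall c : C, Re (- Ci * c) = Im c).
  { intros [a b]; unfold Re, Im; simpl; ring. }
  rewrite <- K. apply (is_lim_seq_ext (fun n => Re (- Ci * u n))).
  - intros n; apply K.
  - apply (limC_Re _ _ (limC_scal (- Ci) _ _ H)).
Qed.

Lemma CLim_seq_unique (u : nat -> C) (l : C) : limC u l -> CLim_seq u = l.
Proof.
  intros H. unfold CLim_seq.
  rewrite (is_lim_seq_unique _ _ (limC_Re _ _ H)), (is_lim_seq_unique _ _ (limC_Im _ _ H)).
  now destruct l.
Qed.

(** * Absolutely convergent series over the integers *)

(* Partial sums over the integers -N, ..., N-1. *)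
Fixpoint psum (f : Z -> C) (N : nat) : C :=
  match N with
  | O => 0
  | S n => psum f n + (f (Z.of_nat n) + f (- Z.of_nat (S n))%Z)
  end.

Fixpoint rpsum (f : Z -> R) (N : nat) : R :=
  match N with
  | O => 0
  | S n => rpsum f n + (f (Z.of_nat n) + f (- Z.of_nat (S n))%Z)
  end%R.

Definition summable (D : Z -> R) : Prop :=
  (forall n, 0 <= D n)%R /\ exists M : R, forall N, (rpsum D N <= M)%R.

Definition abs_summable (f : Z -> C) : Prop := summable (fun n => Cmod (f n)).

Definition rsum (D : Z -> R) : R := real (Lim_seq (rpsum D)).

Lemma rpsum_le (f g : Z -> R) N :
  (forall n, f n <= g n)%R -> (rpsum f N <= rpsum g N)%R.
Proof.
  intros H; induction N as [|N IH]; simpl; [lra|].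
  assert (H1 := H (Z.of_nat N)). assert (H2 := H (- Z.of_nat (S N))%Z).
  simpl in H2. lra.
Qed.

Lemma summable_le (f g : Z -> R) :
  (forall n, 0 <= f n <= g n)%R -> summable g -> summable f.
Proof.
  intros H [_ [M HM]]. split; [intros n; apply H|]. exists M; intros N.
  eapply Rle_trans; [| apply HM]. apply rpsum_le, H.
Qed.

Lemma abs_summable_le (f : Z -> C) (D : Z -> R) :
  (forall n, Cmod (f n) <= D n)%R -> summable D -> abs_summable f.
Proof.
  intros H; apply summable_le. intros n; split; [apply Cmod_ge_0 | apply H].
Qed.

Lemma rpsum_incr (D : Z -> R) : (forall n, 0 <= D n)%R ->
  forall N, (rpsum D N <= rpsum D (S N))%R.
Proof.
  intros H N. cbn [rpsum]. assert (H1 := H (Z.of_nat N)).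
  assert (H2 := H (- Z.of_nat (S N))%Z). lra.
Qed.

Lemma rsum_correct (D : Z -> R) : summable D -> is_lim_seq (rpsum D) (rsum D).
Proof.
  intros [H [M HM]]. apply Lim_seq_correct'.
  apply (ex_finite_lim_seq_incr _ M); auto using rpsum_incr.
Qed.

Lemma rpsum_le_rsum (D : Z -> R) N : summable D -> (rpsum D N <= rsum D)%R.
Proof.
  intros H. apply (is_lim_seq_incr_compare (rpsum D)); [now apply rsum_correct|].
  apply rpsum_incr, H.
Qed.

Lemma summable_term (D : Z -> R) n : summable D -> (D n <= rsum D)%R.
Proof.
  intros H.
  assert (K : exists N, (D n <= rpsum D N)%R).
  { assert (K0 : forall N, (0 <= rpsum D N)%R).
    { induction N as [|N IH]; [simpl; lra|].
      eapply Rle_trans; [exact IH | apply rpsum_incr, H]. }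
    destruct H as [H _].
    destruct (Z_le_gt_dec 0 n) as [h|h].
    - exists (S (Z.to_nat n)). cbn [rpsum].
      rewrite Z2Nat.id by lia. specialize (K0 (Z.to_nat n)).
      assert (K2 := H (- Z.of_nat (S (Z.to_nat n)))%Z). lra.
    - exists (S (Z.to_nat (- n - 1))). cbn [rpsum].
      replace (- Z.of_nat (S (Z.to_nat (- n - 1))))%Z with n by lia.
      specialize (K0 (Z.to_nat (- n - 1))).
      assert (K2 := H (Z.of_nat (Z.to_nat (- n - 1)))%Z). lra. }
  destruct K as [N K]. eapply Rle_trans; [exact K | now apply rpsum_le_rsum].
Qed.

Lemma summable_plus (D F : Z -> R) :
  summable D -> summable F -> summable (fun n => D n + F n)%R.
Proof.
  intros [H1 [M1 K1]] [H2 [M2 K2]]. split.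
  - intros n; specialize (H1 n); specialize (H2 n); lra.
  - exists (M1 + M2)%R. intros N.
    replace (rpsum (fun n => D n + F n)%R N) with (rpsum D N + rpsum F N)%R.
    + specialize (K1 N); specialize (K2 N); lra.
    + clear; induction N; simpl; [ring | rewrite <- IHN; ring].
Qed.

Lemma summable_scal (c : R) (D : Z -> R) :
  (0 <= c)%R -> summable D -> summable (fun n => c * D n)%R.
Proof.
  intros Hc [H1 [M1 K1]]. split.
  - intros n; apply Rmult_le_pos; auto.
  - exists (c * M1)%R. intros N.
    replace (rpsum (fun n => c * D n)%R N) with (c * rpsum D N)%R.
    + apply Rmult_le_compat_l; auto.
    + clear; induction N; simpl; [ring | rewrite <- IHN; ring].
Qed.

Lemma abs_summable_plus (f g : Z -> C) :
  abs_summable f -> abs_summable g -> abs_summable (fun n => f n + g n).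
Proof.
  intros Hf Hg. eapply abs_summable_le; [| exact (summable_plus _ _ Hf Hg)].
  intros n; apply Cmod_triangle.
Qed.

Lemma abs_summable_scal (c : C) (f : Z -> C) :
  abs_summable f -> abs_summable (fun n => c * f n).
Proof.
  intros Hf. eapply abs_summable_le;
    [| exact (summable_scal _ _ (Cmod_ge_0 c) Hf)].
  intros n; simpl. rewrite Cmod_mult; lra.
Qed.

Lemma abs_summable_ext (f g : Z -> C) :
  (forall n, f n = g n) -> abs_summable f -> abs_summable g.
Proof.
  intros H Hf. eapply abs_summable_le; [| exact Hf]. intros n; simpl; rewrite H; lra.
Qed.

(** [Series] has a default value on divergent input, so [sumZ] carries no information until the four
    real series behind it are known to converge. Absolute summability provides this, and then the
    windows of [psum] are the sums of their partial sums. *)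
Lemma sumZ_correct (f : Z -> C) : abs_summable f -> limC (psum f) (sumZ f).
Proof.
  intros [_ [M HM]].
  assert (HP : forall N, (0 <= rpsum (fun n => Cmod (f n)) N)%R).
  { induction N; simpl; [lra|].
    assert (H1 := Cmod_ge_0 (f (Z.of_nat N))).
    assert (H2 := Cmod_ge_0 (f (- Z.of_nat (S N))%Z)). simpl in H2. lra. }
  (* Here [p] stands for the real or the imaginary part and [s] enumerates one of the two
     half-lines. *)
  assert (K : forall (p : C -> R) (s : nat -> Z),
    (forall c, Rabs (p c) <= Cmod c)%R ->
    (forall N, (sum_n (fun n => Cmod (f (s n))) N <=
       rpsum (fun n => Cmod (f n)) (S N)))%R ->
    is_lim_seq (sum_n (fun n => p (f (s n)))) (Series (fun n => p (f (s n))))).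
  { intros p s Hp Hs. apply Series_correct. apply ex_series_Rabs.
    apply (@ex_series_le R_AbsRing R_CompleteNormedModule _ (fun n => Cmod (f (s n)))).
    { intros n. unfold norm; simpl. unfold abs; simpl. rewrite Rabs_Rabsolu. apply Hp. }
    destruct (ex_finite_lim_seq_incr (sum_n (fun n => Cmod (f (s n)))) M) as [l Hl].
    - intros n. rewrite sum_Sn. unfold plus; simpl.
      assert (H1 := Cmod_ge_0 (f (s (S n)))). lra.
    - intros n. eapply Rle_trans; [apply Hs | apply HM].
    - exists l. exact Hl. }
  assert (Hs1 : forall N, (sum_n (fun n => Cmod (f (Z.of_nat n))) N <=
       rpsum (fun n => Cmod (f n)) (S N))%R).
  { induction N.
    - rewrite sum_O. cbn [rpsum]. assert (H2 := Cmod_ge_0 (f (- Z.of_nat (S 0))%Z)). lra.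
    - rewrite sum_Sn. unfold plus; simpl plus. cbn [rpsum] in *.
      assert (H2 := Cmod_ge_0 (f (- Z.of_nat (S (S N)))%Z)). simpl. simpl in *. lra. }
  assert (Hs2 : forall N, (sum_n (fun n => Cmod (f (- Z.of_nat (S n))%Z)) N <=
       rpsum (fun n => Cmod (f n)) (S N))%R).
  { induction N.
    - rewrite sum_O. cbn [rpsum]. assert (H2 := Cmod_ge_0 (f (Z.of_nat 0)%Z)). lra.
    - rewrite sum_Sn. unfold plus; simpl plus. cbn [rpsum] in *.
      assert (H2 := Cmod_ge_0 (f (Z.of_nat (S N))%Z)). simpl. simpl in *. lra. }
  assert (KR : forall c : C, (Rabs (Re c) <= Cmod c)%R).
  { intros c. eapply Rle_trans; [| apply Rmax_Cmod]. apply Rmax_l. }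
  assert (KI : forall c : C, (Rabs (Im c) <= Cmod c)%R).
  { intros c. eapply Rle_trans; [| apply Rmax_Cmod]. apply Rmax_r. }
  apply limC_incr_1.
  unfold sumZ, CSeries. unfold Cplus; simpl fst; simpl snd.
  apply limC_pair.
  - eapply is_lim_seq_ext.
    2:{ apply is_lim_seq_plus'; [apply (K Re Z.of_nat) | apply (K Re (fun n => - Z.of_nat (S n))%Z)]; auto. }
    intros N. induction N as [|N IHN].
    + rewrite !sum_O. cbn [psum]. unfold Re, Im; simpl. ring.
    + rewrite !sum_Sn. unfold plus; simpl AbelianMonoid.plus. cbn [psum] in *.
      unfold Re, Im in *. simpl fst in *. simpl snd in *. rewrite <- IHN. simpl. ring.
  - eapply is_lim_seq_ext.
    2:{ apply is_lim_seq_plus'; [apply (K Im Z.of_nat) | apply (K Im (fun n => - Z.of_nat (S n))%Z)]; auto. }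
    intros N. induction N as [|N IHN].
    + rewrite !sum_O. cbn [psum]. unfold Re, Im; simpl. ring.
    + rewrite !sum_Sn. unfold plus; simpl AbelianMonoid.plus. cbn [psum] in *.
      unfold Re, Im in *. simpl fst in *. simpl snd in *. rewrite <- IHN. simpl. ring.
Qed.

Lemma sumZ_unique (f : Z -> C) (l : C) :
  abs_summable f -> limC (psum f) l -> sumZ f = l.
Proof. intros H K. eapply limC_unique; [now apply sumZ_correct | exact K]. Qed.

Lemma sumZ_ext (f g : Z -> C) : (forall n, f n = g n) -> sumZ f = sumZ g.
Proof.
  intros H. unfold sumZ, CSeries. f_equal; f_equal; apply Series_ext; intros n; now rewrite H.
Qed.

Lemma sumZ_plus (f g : Z -> C) : abs_summable f -> abs_summable g ->
  sumZ (fun n => f n + g n) = sumZ f + sumZ g.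
Proof.
  intros Hf Hg. apply sumZ_unique; [now apply abs_summable_plus|].
  eapply limC_ext; [| apply limC_plus; apply sumZ_correct; eassumption].
  intros N; simpl. induction N; simpl; [ring | rewrite <- IHN; ring].
Qed.

Lemma sumZ_scal (c : C) (f : Z -> C) : abs_summable f ->
  sumZ (fun n => c * f n) = c * sumZ f.
Proof.
  intros Hf. apply sumZ_unique; [now apply abs_summable_scal|].
  eapply limC_ext; [| apply limC_scal; apply sumZ_correct; eassumption].
  intros N; simpl. induction N; simpl; [ring | rewrite <- IHN; ring].
Qed.

Lemma abs_summable_0 : abs_summable (fun _ => 0).
Proof.
  split; [intros; apply Cmod_ge_0|]. exists 0%R. intros N.
  induction N; cbn [rpsum]; [apply Rle_refl|]. rewrite Cmod_0 in *. lra.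
Qed.

Lemma sumZ_0 : sumZ (fun _ => 0) = 0.
Proof.
  apply sumZ_unique; [apply abs_summable_0|].
  apply (limC_ext (fun _ => RtoC 0)); [| apply limC_const].
  induction n; simpl; [reflexivity | rewrite <- IHn; ring].
Qed.

Lemma psum_tail (f : Z -> C) (D : Z -> R) N k :
  (forall n, Cmod (f n) <= D n)%R ->
  (Cmod (psum f (k + N) - psum f N) <= rpsum D (k + N) - rpsum D N)%R.
Proof.
  intros H. induction k as [|k IH].
  - simpl. replace (psum f N - psum f N) with (RtoC 0) by ring. rewrite Cmod_0; lra.
  - cbn [Nat.add psum rpsum].
    replace (psum f (k + N) + (f (Z.of_nat (k + N)) + f (- Z.of_nat (S (k + N)))%Z) - psum f N)
      with ((psum f (k + N) - psum f N) + (f (Z.of_nat (k + N)) + f (- Z.of_nat (S (k + N)))%Z)) by ring.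
    eapply Rle_trans; [apply Cmod_triangle|].
    assert (H3 := Cmod_triangle (f (Z.of_nat (k + N))) (f (- Z.of_nat (S (k + N)))%Z)).
    assert (H1 := H (Z.of_nat (k + N))). assert (H2 := H (- Z.of_nat (S (k + N)))%Z).
    lra.
Qed.

Lemma limC_dist_le (u : nat -> C) (l a : C) (v : nat -> R) (b : R) N0 :
  limC u l -> is_lim_seq v b -> (forall n, (N0 <= n)%nat -> Cmod (u n - a) <= v n)%R ->
  (Cmod (l - a) <= b)%R.
Proof.
  intros Hu Hv H.
  assert (K : is_lim_seq (fun n => v n + Cmod (u n - l))%R (b + 0)%R)
    by now apply is_lim_seq_plus'.
  assert (K2 : is_lim_seq (fun _ => Cmod (l - a)) (Cmod (l - a))) by apply is_lim_seq_const.
  rewrite Rplus_0_r in K.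
  refine (is_lim_seq_le_loc _ _ (Cmod (l - a)) b _ K2 K).
  exists N0. intros n Hn. specialize (H n Hn).
  replace (l - a) with ((u n - a) + - (u n - l)) by ring.
  eapply Rle_trans; [apply Cmod_triangle|]. rewrite Cmod_opp. lra.
Qed.

Lemma sumZ_tail (f : Z -> C) (D : Z -> R) N :
  (forall n, Cmod (f n) <= D n)%R -> summable D ->
  (Cmod (sumZ f - psum f N) <= rsum D - rpsum D N)%R.
Proof.
  intros H HD.
  apply (limC_dist_le (psum f) (sumZ f) _ (fun k => rpsum D k - rpsum D N)%R _ N).
  - apply sumZ_correct. eapply abs_summable_le; eassumption.
  - apply is_lim_seq_minus'; [now apply rsum_correct | apply is_lim_seq_const].
  - intros n Hn. replace n with ((n - N) + N)%nat by lia. now apply psum_tail.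
Qed.

Lemma sumZ_norm_le (f : Z -> C) (D : Z -> R) :
  (forall n, Cmod (f n) <= D n)%R -> summable D -> (Cmod (sumZ f) <= rsum D)%R.
Proof.
  intros H HD. assert (K := sumZ_tail f D 0 H HD). simpl in K.
  replace (sumZ f) with (sumZ f - 0) by ring. lra.
Qed.

(** Dominated convergence: a window is fixed outside which the tail of [D], and with it the tails of
    all [F j] and of [f], is below eps/3; on the window the finite sums converge termwise. *)
Lemma tannery (F : nat -> Z -> C) (f : Z -> C) (D : Z -> R) :
  (forall j n, Cmod (F j n) <= D n)%R -> summable D ->
  (forall n, limC (fun j => F j n) (f n)) ->
  limC (fun j => sumZ (F j)) (sumZ f).
Proof.
  intros HF HD Hl.
  assert (Hf : forall n, (Cmod (f n) <= D n)%R).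
  { intros n. replace (f n) with (f n - 0) by ring.
    apply (limC_dist_le (fun j => F j n) (f n) 0 (fun _ => D n) (D n) 0); auto.
    - apply is_lim_seq_const.
    - intros j _. replace (F j n - 0) with (F j n) by ring. apply HF. }
  assert (HP : forall N, limC (fun j => psum (F j) N) (psum f N)).
  { induction N; simpl; [apply limC_const|].
    repeat apply limC_plus; auto. }
  apply is_lim_seq_spec. intros eps.
  assert (e3 : (0 < eps / 3)%R) by (destruct eps; simpl; lra).
  assert (HT := rsum_correct D HD). apply is_lim_seq_spec in HT.
  destruct (HT (mkposreal _ e3)) as [N HN]. specialize (HN N (Nat.le_refl N)). simpl in HN.
  assert (H2 := HP N). apply is_lim_seq_spec in H2.
  destruct (H2 (mkposreal _ e3)) as [J HJ]. exists J. intros j Hj.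
  specialize (HJ j Hj). simpl in HJ.
  rewrite Rminus_0_r in *. rewrite Rabs_pos_eq in * by apply Cmod_ge_0.
  assert (T1 := sumZ_tail (F j) D N (HF j) HD).
  assert (T2 := sumZ_tail f D N Hf HD).
  apply Rabs_lt_between in HN.
  replace (sumZ (F j) - sumZ f) with
    ((sumZ (F j) - psum (F j) N) + ((psum (F j) N - psum f N) + - (sumZ f - psum f N))) by ring.
  eapply Rle_lt_trans; [apply Cmod_triangle|].
  assert (T3 := Cmod_triangle (psum (F j) N - psum f N) (- (sumZ f - psum f N))).
  rewrite Cmod_opp in T3. lra.
Qed.

Lemma rsum_scal (c : R) (D : Z -> R) : summable D ->
  rsum (fun n => c * D n)%R = (c * rsum D)%R.
Proof.
  intros HD. apply (f_equal real (y := Finite (c * rsum D))).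
  apply is_lim_seq_unique.
  apply (is_lim_seq_ext (fun N => c * rpsum D N)%R).
  - intros N. induction N; simpl; [ring | rewrite <- IHN; ring].
  - apply is_lim_seq_mult'; [apply is_lim_seq_const | now apply rsum_correct].
Qed.

Lemma rsum_nonneg (D : Z -> R) : summable D -> (0 <= rsum D)%R.
Proof. intros H. apply (rpsum_le_rsum D 0 H). Qed.

Lemma abs_summable_sumZ (a : Z -> Z -> C) (D H : Z -> R) :
  summable D -> summable H ->
  (forall n m, Cmod (a n m) <= D n * H m)%R ->
  abs_summable (fun n => sumZ (fun m => a n m)).
Proof.
  intros HD HH Ha.
  apply (abs_summable_le _ (fun n => rsum H * D n)%R).
  2:{ apply summable_scal; auto using rsum_nonneg. }
  intros n.
  assert (K : summable (fun m => D n * H m)%R) by (apply summable_scal; [apply HD | exact HH]).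
  eapply Rle_trans; [apply (sumZ_norm_le _ _ (Ha n) K)|].
  rewrite rsum_scal by exact HH. lra.
Qed.

(** For a finite inner window the interchange is linearity. The window then grows under the outer
    sum, by [tannery] with the majorant rsum H * D n. *)
Lemma fubini (a : Z -> Z -> C) (D H : Z -> R) :
  summable D -> summable H ->
  (forall n m, Cmod (a n m) <= D n * H m)%R ->
  sumZ (fun n => sumZ (fun m => a n m)) = sumZ (fun m => sumZ (fun n => a n m)).
Proof.
  intros HD HH Ha.
  assert (Hrow : forall n, abs_summable (fun m => a n m)).
  { intros n. eapply abs_summable_le; [apply Ha|]. apply summable_scal; [apply HD | exact HH]. }
  assert (Hcol : forall m, abs_summable (fun n => a n m)).
  { intros m. apply (abs_summable_le _ (fun n => H m * D n)%R).
    - intros n. rewrite Rmult_comm. apply Ha.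
    - apply summable_scal; [apply HH | exact HD]. }
  assert (HR := rsum_nonneg H HH).
  assert (HB : forall M n, (Cmod (psum (fun m => a n m) M) <= rsum H * D n)%R).
  { intros M n. apply Rle_trans with (rpsum (fun m => D n * H m)%R M).
    - assert (K := psum_tail (fun m => a n m) (fun m => D n * H m)%R 0 M (Ha n)).
      simpl in K. rewrite Nat.add_0_r in K.
      replace (psum (fun m => a n m) M) with (psum (fun m => a n m) M - 0) by ring. lra.
    - replace (rpsum (fun m => D n * H m)%R M) with (rpsum H M * D n)%R.
      + apply Rmult_le_compat_r; [apply HD | now apply rpsum_le_rsum].
      + clear; induction M; simpl; [ring | rewrite <- IHM; ring]. }
  assert (L1 : limC (fun M => sumZ (fun n => psum (fun m => a n m) M))
                    (sumZ (fun n => sumZ (fun m => a n m)))).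
  { apply (tannery _ _ (fun n => rsum H * D n)%R); auto.
    - now apply summable_scal.
    - intros n. now apply sumZ_correct. }
  assert (Hps : forall M, abs_summable (fun n => psum (fun m => a n m) M)).
  { intros M; eapply abs_summable_le; [apply (HB M)|]. now apply summable_scal. }
  assert (L2 : forall M, sumZ (fun n => psum (fun m => a n m) M)
                 = psum (fun m => sumZ (fun n => a n m)) M).
  { induction M; simpl.
    - apply sumZ_0.
    - rewrite (sumZ_plus (fun n => psum (fun m => a n m) M)
        (fun n => a n (Z.of_nat M) + a n (Z.neg (Pos.of_succ_nat M)))); auto.
      + rewrite IHM. f_equal. apply sumZ_plus; auto.
      + apply abs_summable_plus; auto. }
  eapply limC_unique; [exact L1|].
  apply (limC_ext (psum (fun m => sumZ (fun n => a n m)))).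
  { intros M; now rewrite L2. }
  apply sumZ_correct. apply (abs_summable_sumZ (fun m n => a n m) H D); auto.
  intros m n. rewrite Rmult_comm. apply Ha.
Qed.

Lemma summable_lim0 (D : Z -> R) : summable D ->
  is_lim_seq (fun n => D (Z.of_nat n)) 0 /\ is_lim_seq (fun n => D (- Z.of_nat n)%Z) 0.
Proof.
  intros H.
  assert (K : is_lim_seq (fun n => rpsum D (S n) - rpsum D n)%R 0).
  { replace 0%R with (rsum D - rsum D)%R by ring. apply is_lim_seq_minus'.
    - apply (is_lim_seq_incr_1 (rpsum D)). now apply rsum_correct.
    - now apply rsum_correct. }
  destruct H as [H _].
  split.
  - apply (is_lim_seq_le_le (fun _ => 0%R) _ _ 0 (fun n =>
      conj (H (Z.of_nat n)) (ltac:(cbn [rpsum]; assert (H2 := H (- Z.of_nat (S n))%Z); lra)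
        : (D (Z.of_nat n) <= rpsum D (S n) - rpsum D n)%R))); auto.
    apply is_lim_seq_const.
  - apply (is_lim_seq_incr_1 (fun n => D (- Z.of_nat n)%Z)).
    apply (is_lim_seq_le_le (fun _ => 0%R) _ _ 0 (fun n =>
      conj (H (- Z.of_nat (S n))%Z) (ltac:(cbn [rpsum]; assert (H2 := H (Z.of_nat n)%Z); lra)
        : (D (- Z.of_nat (S n))%Z <= rpsum D (S n) - rpsum D n)%R))); auto.
    apply is_lim_seq_const.
Qed.

Lemma abs_summable_lim0 (f : Z -> C) : abs_summable f ->
  limC (fun n => f (Z.of_nat n)) 0 /\ limC (fun n => f (- Z.of_nat n)%Z) 0.
Proof.
  intros H. destruct (summable_lim0 _ H) as [H1 H2]. split.
  - eapply is_lim_seq_ext; [| exact H1]. intros n; simpl. f_equal; ring.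
  - eapply is_lim_seq_ext; [| exact H2]. intros n; simpl. f_equal; ring.
Qed.

Lemma rpsum_S1 (D : Z -> R) N : (rpsum (fun n => D (n + 1)%Z) N =
  rpsum D N + D (Z.of_nat N) - D (- Z.of_nat N)%Z)%R.
Proof.
  induction N; [simpl; ring|]. cbn [rpsum]. rewrite IHN.
  replace (- Z.of_nat (S N) + 1)%Z with (- Z.of_nat N)%Z by lia.
  replace (Z.of_nat N + 1)%Z with (Z.of_nat (S N)) by lia. ring.
Qed.

Lemma psum_S1 (f : Z -> C) N : psum (fun n => f (n + 1)%Z) N =
  psum f N + (f (Z.of_nat N) + (-1) * f (- Z.of_nat N)%Z).
Proof.
  induction N; [simpl; ring|]. cbn [psum]. rewrite IHN.
  replace (- Z.of_nat (S N) + 1)%Z with (- Z.of_nat N)%Z by lia.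
  replace (Z.of_nat N + 1)%Z with (Z.of_nat (S N)) by lia. ring.
Qed.

Lemma summable_S1 (D : Z -> R) : summable D -> summable (fun n => D (n + 1)%Z).
Proof.
  intros H. split; [intros n; apply H|].
  exists (rsum D + rsum D)%R. intros N. rewrite rpsum_S1.
  assert (K1 := rpsum_le_rsum D N H). assert (K2 := summable_term D (Z.of_nat N) H).
  assert (K3 := proj1 H (- Z.of_nat N)%Z). lra.
Qed.

(** The shifted window gains f(N) and loses f(-N), and both tend to 0. *)
Lemma sumZ_S1 (f : Z -> C) : abs_summable f -> sumZ (fun n => f (n + 1)%Z) = sumZ f.
Proof.
  intros H. apply sumZ_unique; [now apply (summable_S1 (fun n => Cmod (f n)))|].
  apply (limC_ext (fun N => psum f N + (f (Z.of_nat N) + (-1) * f (- Z.of_nat N)%Z))).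
  { intros N; now rewrite psum_S1. }
  replace (sumZ f) with (sumZ f + (0 + (-1) * 0)) by ring.
  apply limC_plus; [now apply sumZ_correct|].
  apply limC_plus; [| apply limC_scal]; now apply abs_summable_lim0.
Qed.

Lemma rpsum_opp (D : Z -> R) N : (rpsum (fun n => D (- n)%Z) N =
  rpsum D N + D (Z.of_nat N) - D (- Z.of_nat N)%Z)%R.
Proof.
  induction N; [simpl; ring|]. cbn [rpsum]. rewrite IHN.
  replace (- - Z.of_nat (S N))%Z with (Z.of_nat (S N))%Z by lia. ring.
Qed.

(** Reflection carries the window -N, ..., N-1 to -N+1, ..., N, which is also its translate by one;
    hence the same boundary terms as in [psum_S1]. *)
Lemma psum_opp (f : Z -> C) N : psum (fun n => f (- n)%Z) N =
  psum f N + (f (Z.of_nat N) + (-1) * f (- Z.of_nat N)%Z).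
Proof.
  induction N; [simpl; ring|]. cbn [psum]. rewrite IHN.
  replace (- - Z.of_nat (S N))%Z with (Z.of_nat (S N))%Z by lia. ring.
Qed.

Lemma summable_opp (D : Z -> R) : summable D -> summable (fun n => D (- n)%Z).
Proof.
  intros H. split; [intros n; apply H|].
  exists (rsum D + rsum D)%R. intros N. rewrite rpsum_opp.
  assert (K1 := rpsum_le_rsum D N H). assert (K2 := summable_term D (Z.of_nat N) H).
  assert (K3 := proj1 H (- Z.of_nat N)%Z). lra.
Qed.

Lemma abs_summable_opp (f : Z -> C) : abs_summable f -> abs_summable (fun n => f (- n)%Z).
Proof. apply (summable_opp (fun n => Cmod (f n))). Qed.

Lemma sumZ_opp (f : Z -> C) : abs_summable f -> sumZ (fun n => f (- n)%Z) = sumZ f.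
Proof.
  intros H. apply sumZ_unique; [now apply abs_summable_opp|].
  apply (limC_ext (fun N => psum f N + (f (Z.of_nat N) + (-1) * f (- Z.of_nat N)%Z))).
  { intros N; now rewrite psum_opp. }
  replace (sumZ f) with (sumZ f + (0 + (-1) * 0)) by ring.
  apply limC_plus; [now apply sumZ_correct|].
  apply limC_plus; [| apply limC_scal]; now apply abs_summable_lim0.
Qed.

Lemma summable_ext (D F : Z -> R) : (forall n, D n = F n) -> summable D -> summable F.
Proof.
  intros H HD. eapply summable_le; [| exact HD].
  intros n; rewrite <- H. split; [apply HD | lra].
Qed.

Lemma summable_shift (D : Z -> R) k : summable D -> summable (fun n => D (n + k)%Z).
Proof.
  intros H. destruct (Z_le_gt_dec 0 k) as [h|h].
  - pattern k; apply natlike_ind; auto; clear k h.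
    + eapply summable_ext; [| exact H]. intros n; simpl; now rewrite Z.add_0_r.
    + intros k _ IH. eapply summable_ext; [| apply summable_S1, IH].
      intros n; simpl; f_equal; lia.
  - replace k with (- - k)%Z by lia. assert (h' : (0 <= - k)%Z) by lia.
    pattern (- k)%Z; apply natlike_ind; auto; clear k h h'.
    + eapply summable_ext; [| exact H]. intros n; simpl; now rewrite Z.add_0_r.
    + intros k _ IH.
      (* A shift downwards is a shift upwards conjugated by reflection. *)
      eapply summable_ext;
        [| apply (summable_opp _ (summable_S1 _ (summable_opp _ IH)))].
      intros n; simpl; f_equal; lia.
Qed.

Lemma abs_summable_shift (f : Z -> C) k :
  abs_summable f -> abs_summable (fun n => f (n + k)%Z).
Proof. apply (summable_shift (fun n => Cmod (f n))). Qed.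

Lemma sumZ_shift (f : Z -> C) k : abs_summable f -> sumZ (fun n => f (n + k)%Z) = sumZ f.
Proof.
  intros H.
  assert (K : forall k, (0 <= k)%Z -> forall f, abs_summable f ->
    sumZ (fun n => f (n + k)%Z) = sumZ f).
  { clear. intros k h. pattern k; apply natlike_ind; auto; clear k h.
    - intros f H. apply sumZ_ext. intros n; now rewrite Z.add_0_r.
    - intros k _ IH f H. rewrite <- (IH f H), <- (sumZ_S1 _ (abs_summable_shift f k H)).
      apply sumZ_ext. intros n; f_equal; lia. }
  destruct (Z_le_gt_dec 0 k) as [h|h]; auto.
  rewrite <- (K (- k)%Z ltac:(lia) (fun n => f (n + k)%Z)).
  - apply sumZ_ext. intros n; f_equal; lia.
  - now apply abs_summable_shift.
Qed.

Lemma abs_summable_refl (f : Z -> C) k :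
  abs_summable f -> abs_summable (fun n => f (k - n)%Z).
Proof.
  intros H. eapply abs_summable_ext; [| apply abs_summable_opp, (abs_summable_shift f k H)].
  intros n; simpl; f_equal; lia.
Qed.

Lemma sumZ_refl (f : Z -> C) k : abs_summable f -> sumZ (fun n => f (k - n)%Z) = sumZ f.
Proof.
  intros H. rewrite <- (sumZ_shift f k H).
  rewrite <- (sumZ_opp _ (abs_summable_shift f k H)).
  apply sumZ_ext. intros n; f_equal; lia.
Qed.

(** The half-open window of length 4N splits exactly into the windows of length 2N for the even and
    for the odd integers. *)
Lemma summable_double (D : Z -> R) : summable D ->
  summable (fun n => D (2 * n)%Z) /\ summable (fun n => D (2 * n + 1)%Z).
Proof.
  intros H.
  assert (K : forall N, (rpsum D (2 * N) = rpsum (fun n => D (2 * n)%Z) N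
      + rpsum (fun n => D (2 * n + 1)%Z) N)%R).
  { induction N; [simpl; ring|].
    replace (2 * S N)%nat with (S (S (2 * N))) by lia. cbn [rpsum]. rewrite IHN.
    replace (2 * Z.of_nat N)%Z with (Z.of_nat (2 * N)) by lia.
    replace (2 * - Z.of_nat (S N))%Z with (- Z.of_nat (S (S (2 * N))))%Z by lia.
    replace (Z.of_nat (2 * N) + 1)%Z with (Z.of_nat (S (2 * N))) by lia.
    replace (- Z.of_nat (S (S (2 * N))) + 1)%Z with (- Z.of_nat (S (2 * N)))%Z by lia.
    ring. }
  assert (P : forall F : Z -> R, (forall n, 0 <= F n)%R -> forall N, (0 <= rpsum F N)%R).
  { intros F HF; induction N; simpl; [lra|].
    assert (H1 := HF (Z.of_nat N)). assert (H2 := HF (- Z.of_nat (S N))%Z).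
    simpl in H2. lra. }
  destruct H as [H [M HM]].
  assert (H1 := P (fun n => D (2 * n)%Z) (fun n => H _)).
  assert (H2 := P (fun n => D (2 * n + 1)%Z) (fun n => H _)).
  split; (split; [intros n; apply H | exists M; intros N]);
    specialize (H1 N); specialize (H2 N); specialize (K N); specialize (HM (2 * N)%nat); lra.
Qed.

Lemma abs_summable_even (f : Z -> C) : abs_summable f -> abs_summable (fun n => f (2 * n)%Z).
Proof. intros H. apply (summable_double _ H). Qed.

Lemma abs_summable_odd (f : Z -> C) : abs_summable f -> abs_summable (fun n => f (2 * n + 1)%Z).
Proof. intros H. apply (summable_double _ H). Qed.

Lemma sumZ_even_odd (f : Z -> C) : abs_summable f ->
  sumZ f = sumZ (fun n => f (2 * n)%Z) + sumZ (fun n => f (2 * n + 1)%Z).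
Proof.
  intros H. eapply limC_unique.
  - apply (limC_subseq (psum f) (sumZ f) (fun n => 2 * n)%nat); [intros; lia|].
    now apply sumZ_correct.
  - apply (limC_ext (fun N => psum (fun n => f (2 * n)%Z) N
      + psum (fun n => f (2 * n + 1)%Z) N)).
    2:{ apply limC_plus; apply sumZ_correct; [apply abs_summable_even | apply abs_summable_odd]; exact H. }
    intros N. induction N; [simpl; ring|].
    replace (2 * S N)%nat with (S (S (2 * N))) by lia.
    cbn [psum]. rewrite <- IHN.
    replace (2 * Z.of_nat N)%Z with (Z.of_nat (2 * N)) by lia.
    replace (2 * - Z.of_nat (S N))%Z with (- Z.of_nat (S (S (2 * N))))%Z by lia.
    replace (Z.of_nat (2 * N) + 1)%Z with (Z.of_nat (S (2 * N))) by lia.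
    replace (- Z.of_nat (S (S (2 * N))) + 1)%Z with (- Z.of_nat (S (2 * N)))%Z by lia.
    ring.
Qed.

Ltac bool_to_Z :=
  rewrite ?Z.leb_le, ?Z.ltb_lt, ?Z.eqb_eq, ?Z.leb_gt, ?Z.ltb_ge, ?Z.eqb_neq in *.

Lemma psum_delta (k : Z) (c : C) N :
  psum (fun n => if Z.eqb n k then c else 0) N =
  if ((- Z.of_nat N <=? k) && (k <? Z.of_nat N))%Z%bool then c else 0.
Proof.
  induction N.
  - simpl. destruct (0 <=? k)%Z eqn:h1, (k <? 0)%Z eqn:h2; simpl; auto; lia.
  - cbn [psum]. rewrite IHN.
    destruct (- Z.of_nat N <=? k)%Z eqn:h1; destruct (k <? Z.of_nat N)%Z eqn:h2;
    destruct (- Z.of_nat (S N) <=? k)%Z eqn:h3; destruct (k <? Z.of_nat (S N))%Z eqn:h4;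
    destruct (Z.of_nat N =? k)%Z eqn:h5; destruct (- Z.of_nat (S N) =? k)%Z eqn:h6;
    clear IHN; bool_to_Z; simpl; try ring; exfalso; lia.
Qed.

(** Serves to split off a single term of a bilateral series and to evaluate series in which only one
    term survives. *)
Lemma sumZ_delta (k : Z) (c : C) :
  abs_summable (fun n => if Z.eqb n k then c else 0) /\
  sumZ (fun n => if Z.eqb n k then c else 0) = c.
Proof.
  assert (H : abs_summable (fun n => if Z.eqb n k then c else 0)).
  { split; [intros; apply Cmod_ge_0|]. exists (Cmod c). intros N.
    assert (K : (rpsum (fun n => Cmod (if Z.eqb n k then c else 0)) N <=
      if ((- Z.of_nat N <=? k) && (k <? Z.of_nat N))%Z%bool then Cmod c else 0)%R).
    { induction N.
      - simpl. destruct (0 <=? k)%Z, (k <? 0)%Z; simpl; try lra; apply Cmod_ge_0.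
      - cbn [rpsum].
    destruct (- Z.of_nat N <=? k)%Z eqn:h1; destruct (k <? Z.of_nat N)%Z eqn:h2;
    destruct (- Z.of_nat (S N) <=? k)%Z eqn:h3; destruct (k <? Z.of_nat (S N))%Z eqn:h4;
    destruct (Z.of_nat N =? k)%Z eqn:h5; destruct (- Z.of_nat (S N) =? k)%Z eqn:h6;
    simpl in IHN |- *; rewrite ?Cmod_0; try lra; clear IHN; bool_to_Z;
    exfalso; lia. }
    eapply Rle_trans; [exact K|].
    destruct (_ && _)%bool; [lra | apply Cmod_ge_0]. }
  split; auto. apply sumZ_unique; auto.
  assert (K : is_lim_seq (fun n : nat => 0%R) 0) by apply is_lim_seq_const.
  eapply is_lim_seq_ext_loc; [| exact K].
  exists (S (Z.to_nat (Z.abs k))). intros n Hn. rewrite psum_delta.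
  replace (- Z.of_nat n <=? k)%Z with true by lia.
  replace (k <? Z.of_nat n)%Z with true by lia. simpl.
  replace (c - c) with (RtoC 0) by ring. now rewrite Cmod_0.
Qed.

(** Compares real and imaginary parts, where numerals and coerced integers become ordinary real
    arithmetic; over C, [ring] sees a numeral such as 2 as an atom. *)
Ltac ceq :=
  repeat rewrite ?plus_IZR, ?mult_IZR, ?minus_IZR, ?opp_IZR, ?S_INR;
  apply injective_projections; unfold Re, Im in *; simpl;
  try solve [ring]; try (field; try lra).

(** * The exponential e2pi *)

Lemma exp_le (x y : R) : (x <= y)%R -> (exp x <= exp y)%R.
Proof. intros [H| ->]; [now apply Rlt_le, exp_increasing | apply Rle_refl]. Qed.

Lemma Cexp_plus (a b : C) : Cexp (a + b) = Cexp a * Cexp b.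
Proof.
  destruct a as [a1 a2], b as [b1 b2]. unfold Cexp, Re, Im.
  apply injective_projections; simpl; rewrite exp_plus, ?cos_plus, ?sin_plus; ring.
Qed.

Lemma e2pi_plus (a b : C) : e2pi (a + b) = e2pi a * e2pi b.
Proof. unfold e2pi. rewrite <- Cexp_plus. f_equal. ring. Qed.

Lemma Cexp_0 : Cexp 0 = 1.
Proof. unfold Cexp; simpl. rewrite exp_0, cos_0, sin_0. ceq. Qed.

Lemma e2pi_0 : e2pi 0 = 1.
Proof. unfold e2pi. rewrite Cmult_0_r. apply Cexp_0. Qed.

Lemma e2pi_opp_r (a : C) : e2pi a * e2pi (- a) = 1.
Proof. rewrite <- e2pi_plus. replace (a + - a) with (RtoC 0) by ring. apply e2pi_0. Qed.

Lemma e2pi_neq_0 (a : C) : e2pi a <> 0.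
Proof.
  intros H. assert (K := e2pi_opp_r a). rewrite H, Cmult_0_l in K.
  injection K as K. lra.
Qed.

Lemma e2pi_opp (a : C) : e2pi (- a) = / e2pi a.
Proof.
  assert (K := e2pi_opp_r a). assert (H := e2pi_neq_0 a).
  rewrite <- (Cmult_1_l (/ e2pi a)), <- K. field. exact H.
Qed.

Lemma Cmod_e2pi (a : C) : Cmod (e2pi a) = exp (- (2 * PI * Im a)).
Proof.
  destruct a as [x y]. unfold e2pi, Cexp, Cmod; simpl.
  set (s := (_ * x - _ * y)%R). set (t := (_ * y + _ * x)%R).
  replace (exp s * cos t * (exp s * cos t * 1) + exp s * sin t * (exp s * sin t * 1))%R
    with (exp s * exp s * ((sin t)² + (cos t)²))%R by (unfold Rsqr; ring).
  rewrite sin2_cos2, Rmult_1_r, sqrt_square by (apply Rlt_le, exp_pos).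
  f_equal. unfold s. unfold Im; simpl. ring.
Qed.

Lemma e2pi_half : e2pi (1 / 2) = - (1).
Proof.
  replace (e2pi (1 / 2)) with (Cexp (PI * Ci)).
  - unfold Cexp; apply injective_projections; simpl;
    replace (PI * 0 - 0 * 1)%R with 0%R by ring; replace (PI * 1 + 0 * 0)%R with PI by ring;
    rewrite exp_0, ?cos_PI, ?sin_PI; ring.
  - unfold e2pi. f_equal. ceq.
Qed.

Lemma e2pi_1 : e2pi 1 = 1.
Proof.
  replace (RtoC 1) with (1 / 2 + 1 / 2) at 1 by ceq.
  rewrite e2pi_plus, e2pi_half. ring.
Qed.

Lemma e2pi_quarter : e2pi (1 / 4) = Ci.
Proof.
  replace (e2pi (1 / 4)) with (Cexp (PI / 2 * Ci)).
  - unfold Cexp; apply injective_projections; simpl.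
    + match goal with |- (exp ?a * cos ?b = _)%R => replace a with 0%R by (field; lra);
        replace b with (PI / 2)%R by (field; lra) end.
      rewrite cos_PI2; ring.
    + match goal with |- (exp ?a * sin ?b = _)%R => replace a with 0%R by (field; lra);
        replace b with (PI / 2)%R by (field; lra) end.
      rewrite exp_0, sin_PI2; ring.
  - unfold e2pi. f_equal. ceq.
Qed.

Lemma e2pi_int (k : Z) : e2pi (IZR k) = 1.
Proof.
  assert (K : forall n : nat, e2pi (INR n) = 1).
  { induction n; [apply e2pi_0|].
    rewrite S_INR, RtoC_plus, e2pi_plus, IHn, e2pi_1. ring. }
  destruct (Z_le_gt_dec 0 k).
  - rewrite <- (Z2Nat.id k), <- INR_IZR_INZ by lia. apply K.
  - replace (RtoC (IZR k)) with (- RtoC (INR (Z.to_nat (- k)))).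
    + rewrite e2pi_opp, K. field.
    + rewrite INR_IZR_INZ, Z2Nat.id by lia. rewrite opp_IZR. ceq.
Qed.

(** Signs are encoded as half-integers in the exponent, so identities between terms reduce to
    exponents modulo 1. *)
Lemma e2pi_eq (a b : C) (k : Z) : a = b + IZR k -> e2pi a = e2pi b.
Proof. intros ->. rewrite e2pi_plus, e2pi_int. ring. Qed.

(** Makes n(n-1)/2 an integer, which is what the replacement of tau by tau + 1 requires. *)
Lemma half_square_int (n : Z) : exists k : Z, (IZR n * IZR n = IZR n + 2 * IZR k)%R.
Proof.
  exists (n * (n - 1) / 2)%Z. rewrite <- !mult_IZR, <- plus_IZR. f_equal.
  assert (H : (n * (n - 1) mod 2 = 0)%Z).
  { rewrite Zmult_mod, Zminus_mod. assert (H := Z.mod_pos_bound n 2 ltac:(lia)).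
    assert (n mod 2 = 0 \/ n mod 2 = 1)%Z as [-> | ->] by lia; reflexivity. }
  apply Z.div_exact in H; lia.
Qed.

(** * Exponential and Gaussian majorants *)

Lemma summable_exp (a c : R) : (0 < a)%R ->
  summable (fun n => exp (c - a * Rabs (IZR n)))%R.
Proof.
  intros Ha. apply (summable_ext (fun n => exp c * exp (- (a * Rabs (IZR n))))%R).
  { intros n. rewrite <- exp_plus. f_equal; ring. }
  apply summable_scal; [apply Rlt_le, exp_pos|].
  split; [intros; apply Rlt_le, exp_pos|].
  assert (Hr : (exp (- a) < 1)%R) by (rewrite <- exp_0; apply exp_increasing; lra).
  exists (2 / (1 - exp (- a)))%R.
  (* Twice the geometric partial sum in closed form: a bound that the induction can carry along. *)
  assert (K : forall N, (rpsum (fun n => exp (- (a * Rabs (IZR n)))) N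
     <= 2 / (1 - exp (- a)) * (1 - exp (- (a * INR N))))%R).
  { induction N.
    - cbn [rpsum]. simpl INR. rewrite Rmult_0_r, Ropp_0, exp_0.
      replace (2 / (1 - exp (- a)) * (1 - 1))%R with 0%R by (field; lra). lra.
    - cbn [rpsum].
      rewrite opp_IZR, Rabs_Ropp, <- !INR_IZR_INZ, !Rabs_pos_eq by apply pos_INR.
      assert (E : exp (- (a * INR (S N))) = (exp (- (a * INR N)) * exp (- a))%R).
      { rewrite <- exp_plus. f_equal. rewrite S_INR; ring. }
      rewrite E.
      assert (P := exp_pos (- (a * INR N))).
      set (x := exp (- (a * INR N))) in *. set (r := exp (- a)) in *.
      replace (2 / (1 - r) * (1 - x * r))%R with (2 / (1 - r) * (1 - x) + 2 * x)%R
        by (field; lra).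
      assert (x * r <= x)%R by nra. lra. }
  intros N. eapply Rle_trans; [apply K|].
  assert (P := exp_pos (- (a * INR N))).
  rewrite <- (Rmult_1_r (2 / (1 - exp (- a)))) at 2.
  apply Rmult_le_compat_l; [| lra].
  apply Rlt_le, Rdiv_lt_0_compat; lra.
Qed.

Lemma summable_gauss (a b c : R) : (0 < a)%R ->
  summable (fun n => exp (- (a * IZR n ^ 2) + b * Rabs (IZR n) + c))%R.
Proof.
  intros Ha.
  (* Completing the square in -a x^2 + (b + 1) x gives the constant; the extra 1 leaves the decay
     exp(-x). *)
  apply (summable_le _ (fun n => exp ((b + 1) ^ 2 / (4 * a) + c - 1 * Rabs (IZR n)))%R).
  2:{ apply summable_exp; lra. }
  intros n; split; [apply Rlt_le, exp_pos|].
  apply exp_le. set (x := Rabs (IZR n)).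
  replace (IZR n ^ 2)%R with (x ^ 2)%R by (unfold x; apply pow2_abs).
  assert (K : (0 <= a * (x - (b + 1) / (2 * a)) ^ 2)%R).
  { apply Rmult_le_pos; [lra | apply pow2_ge_0]. }
  replace (a * (x - (b + 1) / (2 * a)) ^ 2)%R with (a * x ^ 2 - (b + 1) * x + (b + 1) ^ 2 / (4 * a))%R in K
    by (field; lra).
  lra.
Qed.

Lemma abs_summable_quad (a b c : C) (f : Z -> C) : (0 < Im a)%R ->
  (forall n, f n = e2pi (a * IZR n ^ 2 + b * IZR n + c)) -> abs_summable f.
Proof.
  intros Ha Hf.
  apply (abs_summable_le _ (fun n => exp (- (2 * PI * Im a * IZR n ^ 2)
    + 2 * PI * Rabs (Im b) * Rabs (IZR n) + - (2 * PI * Im c)))%R).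
  2:{ apply summable_gauss. assert (P := PI_RGT_0). nra. }
  intros n. rewrite Hf, Cmod_e2pi. apply exp_le.
  replace (Im (a * IZR n ^ 2 + b * IZR n + c)) with (Im a * IZR n ^ 2 + Im b * IZR n + Im c)%R.
  2:{ destruct a, b, c; unfold Im; simpl; ring. }
  assert (K : (- (Im b * IZR n) <= Rabs (Im b) * Rabs (IZR n))%R).
  { rewrite <- Rabs_mult. rewrite <- Rabs_Ropp. apply Rle_abs. }
  assert (P := PI_RGT_0). nra.
Qed.

(** * Infinite products *)

Lemma prodC_ext (a b : nat -> C) N :
  (forall n, a n = b n) -> prodC a N = prodC b N.
Proof. intros H; induction N; simpl; [reflexivity | now rewrite IHN, H]. Qed.

Lemma prodC_mult (a b : nat -> C) N :
  prodC (fun n => a n * b n) N = prodC a N * prodC b N.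
Proof. induction N; simpl; [ring | rewrite IHN; ring]. Qed.

Lemma prodC_shift (a : nat -> C) N :
  prodC a (S N) = a 1%nat * prodC (fun n => a (S n)) N.
Proof.
  induction N; [simpl; ring|]. 
  change (prodC a (S (S N))) with (prodC a (S N) * a (S (S N))). rewrite IHN. simpl. ring.
Qed.

Lemma prodC_double (a : nat -> C) N :
  prodC a (2 * N) = prodC (fun n => a (2 * n)%nat) N * prodC (fun n => a (2 * n - 1)%nat) N.
Proof.
  induction N; [simpl; ring|].
  replace (2 * S N)%nat with (S (S (2 * N))) by lia.
  cbn [prodC]. rewrite IHN.
  replace (2 * S N)%nat with (S (S (2 * N))) by lia.
  replace (S (S (2 * N)) - 1)%nat with (S (2 * N)) by lia. ring.
Qed.

Definition geom_bound (k l : R) (a : nat -> C) : Prop :=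
  forall n, (Cmod (a n) <= exp (k - l * INR n))%R.

Lemma exp_geom_sum (k l : R) N : (0 < l)%R ->
  (exp k * (1 - exp (- (l * INR N))) + exp (k - l * INR (S N)) * (exp l - 1)
   = exp k * (1 - exp (- (l * INR (S N)))))%R.
Proof.
  intros _. rewrite S_INR.
  replace (k - l * (INR N + 1))%R with (k + (- (l * INR N)) + - l)%R by ring.
  replace (- (l * (INR N + 1)))%R with (- (l * INR N) + - l)%R by ring.
  rewrite !exp_plus, (exp_Ropp l). field. apply Rgt_not_eq, exp_pos.
Qed.

(** The exponent of the bound is the sum of the geometric series exp(k - l n) over n >= 1. Stating
    it for an abstract sequence [p] lets it serve both for products and for their inverses. *)
Lemma prod_bound (p : nat -> R) (k l : R) : (0 < l)%R ->
  p 0%nat = 1%R ->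
  (forall n, p (S n) <= p n * exp (exp (k - l * INR (S n))))%R ->
  forall N, (p N <= exp (exp k / (exp l - 1)))%R.
Proof.
  intros Hl H0 HS N.
  assert (Hl1 : (1 < exp l)%R) by (rewrite <- exp_0; apply exp_increasing; lra).
  apply Rle_trans with (exp (exp k / (exp l - 1) * (1 - exp (- (l * INR N)))))%R.
  (* The induction needs the partial geometric sum in the exponent, not its limit. *)
  - induction N.
    + rewrite H0. simpl INR. rewrite Rmult_0_r, Ropp_0, exp_0, Rminus_diag, Rmult_0_r, exp_0. lra.
    + eapply Rle_trans; [apply HS|].
      eapply Rle_trans; [apply Rmult_le_compat_r; [apply Rlt_le, exp_pos | exact IHN]|].
      rewrite <- exp_plus. apply exp_le. apply Req_le.
      apply (Rmult_eq_reg_r (exp l - 1)); [| lra].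
      assert (G := exp_geom_sum k l N Hl).
      replace ((exp k / (exp l - 1) * (1 - exp (- (l * INR N))) + exp (k - l * INR (S N))) * (exp l - 1))%R
        with (exp k * (1 - exp (- (l * INR N))) + exp (k - l * INR (S N)) * (exp l - 1))%R
        by (field; lra).
      rewrite G. field; lra.
  - apply exp_le.
    assert (P := exp_pos (- (l * INR N))).
    assert (0 < exp k / (exp l - 1))%R by (apply Rdiv_lt_0_compat; [apply exp_pos | lra]).
    nra.
Qed.

Lemma prodC_bound (a : nat -> C) (k l : R) N : (0 < l)%R -> geom_bound k l a ->
  (Cmod (prodC (fun n => (1 - a n)%C) N) <= exp (exp k / (exp l - 1)))%R.
Proof.
  intros Hl Ha. apply (prod_bound (fun N => Cmod (prodC (fun n => (1 - a n)%C) N)) k l Hl).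
  - simpl. apply Cmod_1.
  - intros n. cbn [prodC]. rewrite Cmod_mult. apply Rmult_le_compat_l; [apply Cmod_ge_0|].
    eapply Rle_trans; [apply Cmod_triangle|]. rewrite Cmod_1, Cmod_opp.
    eapply Rle_trans; [| apply exp_ineq1_le]. specialize (Ha (S n)). lra.
Qed.

(* The increments of the partial products, as a family over Z supported on
   the nonnegative integers; its sum is the infinite product minus 1. *)
Definition prod_incr (a : nat -> C) (z : Z) : C :=
  if (0 <=? z)%Z then - (prodC (fun n => 1 - a n) (Z.to_nat z) * a (S (Z.to_nat z))) else 0.

Lemma psum_prod_incr (a : nat -> C) N :
  psum (prod_incr a) N = prodC (fun n => 1 - a n) N - 1.
Proof.
  induction N; [simpl; ring|]. cbn [psum prodC]. rewrite IHN. unfold prod_incr.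
  replace (0 <=? Z.of_nat N)%Z with true by (symmetry; apply Z.leb_le; lia).
  replace (0 <=? - Z.of_nat (S N))%Z with false by (symmetry; apply Z.leb_gt; lia).
  rewrite Nat2Z.id. ring.
Qed.

Lemma prod_incr_bound (a : nat -> C) (k l : R) : (0 < l)%R -> geom_bound k l a ->
  forall z, (Cmod (prod_incr a z) <= exp (exp k / (exp l - 1) + k - l * Rabs (IZR z)))%R.
Proof.
  intros Hl Ha z. unfold prod_incr. destruct (Z.leb_spec 0 z).
  - rewrite Cmod_opp, Cmod_mult.
    replace (exp k / (exp l - 1) + k - l * Rabs (IZR z))%R
      with (exp k / (exp l - 1) + (k - l * Rabs (IZR z)))%R by ring.
    rewrite exp_plus. apply Rmult_le_compat; try apply Cmod_ge_0.
    + now apply prodC_bound.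
    + eapply Rle_trans; [apply Ha|]. apply exp_le.
      rewrite S_INR, INR_IZR_INZ, Z2Nat.id by lia.
      rewrite Rabs_pos_eq by (apply (IZR_le 0); lia). nra.
  - rewrite Cmod_0. apply Rlt_le, exp_pos.
Qed.

Lemma prodC_lim (a : nat -> C) (k l : R) : (0 < l)%R -> geom_bound k l a ->
  limC (prodC (fun n => 1 - a n)) (sumZ (prod_incr a) + 1).
Proof.
  intros Hl Ha.
  apply (limC_ext (fun N => psum (prod_incr a) N + 1)).
  { intros N; rewrite psum_prod_incr; ring. }
  apply limC_plus; [| apply limC_const]. apply sumZ_correct.
  eapply abs_summable_le; [now apply (prod_incr_bound a k l)|]. now apply summable_exp.
Qed.

Lemma limC_opp (u : nat -> C) (l : C) : limC u l -> limC (fun n => - u n) (- l).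
Proof.
  intros H. apply (limC_ext (fun n => (-1) * u n)); [intros; ring|].
  replace (- l) with ((-1) * l) by ring. now apply limC_scal.
Qed.

(** This is the purpose of [prod_incr]: limits of infinite products in a parameter become dominated
    convergence of series. *)
Lemma prodC_cont (F : nat -> nat -> C) (f : nat -> C) (k l : R) : (0 < l)%R ->
  (forall j, geom_bound k l (F j)) -> (forall n, limC (fun j => F j n) (f n)) ->
  limC (fun j => sumZ (prod_incr (F j)) + 1) (sumZ (prod_incr f) + 1).
Proof.
  intros Hl HF Hf. apply limC_plus; [| apply limC_const].
  eapply tannery.
  - intros j n. apply (prod_incr_bound (F j) k l Hl (HF j)).
  - now apply summable_exp.
  - intros z. unfold prod_incr. destruct (0 <=? z)%Z; [| apply limC_const].
    apply limC_opp. apply limC_mult; [| apply Hf].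
    induction (Z.to_nat z); simpl; [apply limC_const|].
    apply limC_mult; auto. apply limC_plus; [apply limC_const|]. now apply limC_opp.
Qed.

(** The q-Pochhammer symbol (y q; q) of infinite length, with y = e2pi u. The product starts at n =
    1, so the factor 1 - y is not included. *)
Definition qpoch (tau u : C) : C :=
  CLim_seq (prodC (fun n => 1 - e2pi (INR n * tau + u))).

Lemma geom_bound_qpoch (tau u : C) :
  geom_bound (2 * PI * Rabs (Im u)) (2 * PI * Im tau) (fun n => e2pi (INR n * tau + u)).
Proof.
  intros n. rewrite Cmod_e2pi. apply exp_le.
  replace (Im (INR n * tau + u)) with (INR n * Im tau + Im u)%R
    by (destruct tau, u; unfold Im; simpl; ring).
  assert (P := PI_RGT_0). assert (K := Rle_abs (- Im u)). rewrite Rabs_Ropp in K.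
  nra.
Qed.

Lemma two_PI_pos (x : R) : (0 < x)%R -> (0 < 2 * PI * x)%R.
Proof. assert (P := PI_RGT_0). nra. Qed.

Lemma qpoch_eq (tau u : C) : (0 < Im tau)%R ->
  qpoch tau u = sumZ (prod_incr (fun n => e2pi (INR n * tau + u))) + 1.
Proof.
  intros Ht. apply CLim_seq_unique.
  apply (prodC_lim _ (2 * PI * Rabs (Im u)) (2 * PI * Im tau)); auto using two_PI_pos.
  apply geom_bound_qpoch.
Qed.

Lemma qpoch_lim (tau u : C) : (0 < Im tau)%R ->
  limC (prodC (fun n => 1 - e2pi (INR n * tau + u))) (qpoch tau u).
Proof.
  intros Ht. rewrite qpoch_eq by auto.
  apply (prodC_lim _ (2 * PI * Rabs (Im u)) (2 * PI * Im tau)); auto using two_PI_pos.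
  apply geom_bound_qpoch.
Qed.

(** For real arguments |y| = 1, so one geometric bound (with k = 0) serves the whole sequence. *)
Lemma qpoch_cont_real (tau : C) (u : nat -> R) : (0 < Im tau)%R ->
  limC (fun j => e2pi (u j)) 1 ->
  limC (fun j => qpoch tau (u j)) (qpoch tau 0) /\
  limC (fun j => qpoch tau (- u j)) (qpoch tau 0).
Proof.
  intros Ht Hu.
  assert (Hv : limC (fun j => e2pi (- u j)) 1).
  { eapply is_lim_seq_ext; [| exact Hu]. intros j; simpl.
    replace (e2pi (- u j) - 1) with (- (e2pi (- u j) * (e2pi (u j) - 1))).
    - rewrite Cmod_opp, Cmod_mult, Cmod_e2pi.
      replace (- (2 * PI * Im (- u j)))%R with 0%R by (unfold Im; simpl; ring).
      rewrite exp_0; ring.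
    - assert (K := e2pi_opp_r (u j)).
      replace (- (e2pi (- u j) * (e2pi (u j) - 1))) with (e2pi (- u j) - e2pi (u j) * e2pi (- u j)) by ring.
      now rewrite K. }
  assert (W : forall w : nat -> C, (forall j, Im (w j) = 0%R) -> limC (fun j => e2pi (w j)) 1 ->
    limC (fun j => qpoch tau (w j)) (qpoch tau 0)).
  { intros w Hw Hl.
    apply (limC_ext (fun j => sumZ (prod_incr (fun n => e2pi (INR n * tau + w j))) + 1)).
    { intros j; now rewrite qpoch_eq. }
    rewrite qpoch_eq by auto.
    apply (prodC_cont _ _ 0 (2 * PI * Im tau)); auto using two_PI_pos.
    - intros j. assert (K := geom_bound_qpoch tau (w j)).
      rewrite Hw, Rabs_R0, Rmult_0_r in K. exact K.
    - intros n. apply (limC_ext (fun j => e2pi (INR n * tau) * e2pi (w j))).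
      + intros j; now rewrite e2pi_plus.
      + replace (e2pi (INR n * tau + 0)) with (e2pi (INR n * tau) * 1).
        * now apply limC_scal.
        * rewrite Cplus_0_r; ring. }
  split; apply W; auto; intros j; unfold Im; simpl; ring.
Qed.

Lemma qpoch_ext (tau sigma u v : C) :
  (forall n : nat, e2pi (INR n * tau + u) = e2pi (INR n * sigma + v)) ->
  qpoch tau u = qpoch sigma v.
Proof.
  intros H. unfold qpoch, CLim_seq.
  f_equal; f_equal; apply Lim_seq_ext; intros N; f_equal; apply prodC_ext;
    intros n; now rewrite H.
Qed.

Lemma qpoch_shift (tau u : C) : (0 < Im tau)%R ->
  qpoch tau (u - tau) = (1 - e2pi u) * qpoch tau u.
Proof.
  intros Ht. eapply limC_unique; [apply limC_incr_1, qpoch_lim, Ht|].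
  eapply limC_ext; [| apply (limC_scal (1 - e2pi u)), qpoch_lim, Ht].
  intros N. rewrite prodC_shift. f_equal.
  - f_equal. f_equal. f_equal. simpl. ring.
  - apply prodC_ext. intros n.
    replace (INR (S n) * tau + (u - tau)) with (INR n * tau + u); [reflexivity|].
    rewrite S_INR, RtoC_plus. ring.
Qed.

Lemma Im_scal_pos (r : R) (tau : C) : (0 < r)%R -> (0 < Im tau)%R -> (0 < Im (r * tau))%R.
Proof.
  intros Hr Ht. replace (Im (r * tau)) with (r * Im tau)%R
    by (destruct tau; unfold Im; simpl; ring). nra.
Qed.

(** Factor by factor this is (1 - x)(1 + x) = 1 - x^2 with x = y q^n. *)
Lemma qpoch_dup (tau u : C) : (0 < Im tau)%R ->
  qpoch tau u * qpoch tau (u + 1 / 2) = qpoch (2 * tau) (2 * u).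
Proof.
  intros Ht. eapply limC_unique.
  - apply limC_mult; apply qpoch_lim, Ht.
  - eapply limC_ext; [| apply qpoch_lim, Im_scal_pos; [lra | exact Ht]].
    intros N. rewrite <- prodC_mult. apply prodC_ext. intros n.
    replace (INR n * tau + (u + 1 / 2)) with ((INR n * tau + u) + 1 / 2) by ring.
    rewrite (e2pi_plus _ (1 / 2)), e2pi_half.
    replace (INR n * (2 * tau) + 2 * u) with ((INR n * tau + u) + (INR n * tau + u)) by ring.
    rewrite (e2pi_plus (INR n * tau + u) (INR n * tau + u)). ring.
Qed.

(** The first factor collects the even n, the second the odd n. *)
Lemma qpoch_split (tau u : C) : (0 < Im tau)%R ->
  qpoch tau u = qpoch (2 * tau) u * qpoch (2 * tau) (u - tau).
Proof.
  intros Ht. eapply limC_unique.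
  - apply (limC_subseq (prodC (fun n => 1 - e2pi (INR n * tau + u))) _ (fun n => 2 * n)%nat);
      [intros; lia | apply qpoch_lim, Ht].
  - eapply limC_ext.
    2:{ apply limC_mult; apply qpoch_lim, Im_scal_pos; auto; lra. }
    intros N. rewrite prodC_double. f_equal.
    + apply prodC_ext. intros n. 
      replace (INR (2 * n) * tau + u) with (INR n * (2 * tau) + u); [reflexivity|].
      rewrite mult_INR, RtoC_mult. simpl (INR 2). ceq.
    + induction N; [reflexivity|]. cbn [prodC]. rewrite IHN.
      replace (INR (2 * S N - 1) * tau + u) with (INR (S N) * (2 * tau) + (u - tau));
        [reflexivity|].
      replace (2 * S N - 1)%nat with (N + N + 1)%nat by lia.
      rewrite S_INR, !plus_INR. simpl (INR 1). ceq.
Qed.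

Lemma one_minus_e2pi_lower (tau : C) (n : nat) : (0 < Im tau)%R ->
  (exp (- (2 * PI * Im tau * INR (S n))) < 1)%R /\
  (1 - exp (- (2 * PI * Im tau * INR (S n))) <= Cmod (1 - e2pi (INR (S n) * tau)))%R.
Proof.
  intros Ht. assert (P := PI_RGT_0). assert (Q := pos_INR n).
  split.
  - rewrite <- exp_0. apply exp_increasing. rewrite S_INR.
    assert (0 < 2 * PI * Im tau)%R by now apply two_PI_pos. nra.
  - assert (K := Cmod_triangle (1 - e2pi (INR (S n) * tau)) (e2pi (INR (S n) * tau))).
    replace (1 - e2pi (INR (S n) * tau) + e2pi (INR (S n) * tau)) with (RtoC 1) in K by ring.
    rewrite Cmod_1, Cmod_e2pi in K.
    replace (2 * PI * Im (INR (S n) * tau))%R with (2 * PI * Im tau * INR (S n))%R in K.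
    + lra.
    + replace (Im (INR (S n) * tau)) with (INR (S n) * Im tau)%R
        by (destruct tau; unfold Im; cbn -[INR]; ring). ring.
Qed.

Definition qfac (tau : C) (N : nat) : C := prodC (fun n => 1 - e2pi (INR n * tau)) N.

Lemma qfac_lim (tau : C) : (0 < Im tau)%R -> limC (qfac tau) (qpoch tau 0).
Proof.
  intros Ht. eapply limC_ext; [| apply qpoch_lim, Ht].
  intros N; apply prodC_ext. intros n; now rewrite Cplus_0_r.
Qed.

Lemma qfac_neq_0 (tau : C) N : (0 < Im tau)%R -> qfac tau N <> 0.
Proof.
  intros Ht. induction N; unfold qfac in *; cbn [prodC].
  - intros H; injection H; lra.
  - apply Cmult_neq_0; auto. intros H. destruct (one_minus_e2pi_lower tau N Ht) as [K1 K2].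
    rewrite H, Cmod_0 in K2. lra.
Qed.

(** Used twice: it keeps the infinite product away from 0, and it dominates the Gaussian binomials
    uniformly in N. *)
Lemma qfac_inv_bound (tau : C) : (0 < Im tau)%R ->
  exists M : R, (0 < M)%R /\ forall N, (Cmod (/ qfac tau N) <= M)%R.
Proof.
  intros Ht. set (l := (2 * PI * Im tau)%R).
  assert (Hl : (0 < l)%R) by now apply two_PI_pos.
  assert (Hr : (exp (- l) < 1)%R) by (rewrite <- exp_0; apply exp_increasing; lra).
  (* Chosen so that exp k = 1 / (1 - r) with r = exp(-l); then 1 / (1 - r^n) = 1 + r^n / (1 - r^n)
     is at most 1 + exp(k - l n). *)
  set (k := (- ln (1 - exp (- l)))%R).
  assert (Ek : exp k = (/ (1 - exp (- l)))%R).
  { unfold k. rewrite exp_Ropp, exp_ln by lra. reflexivity. }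
  exists (exp (exp k / (exp l - 1))). split; [apply exp_pos|].
  apply (prod_bound (fun N => Cmod (/ qfac tau N)) k l Hl).
  - unfold qfac; simpl. rewrite Cmod_inv, Cmod_1; [lra | intros H; injection H; lra].
  - intros n. destruct (one_minus_e2pi_lower tau n Ht) as [K1 K2].
    assert (HS := qfac_neq_0 tau (S n) Ht). assert (Hn := qfac_neq_0 tau n Ht).
    rewrite !Cmod_inv by auto.
    change (qfac tau (S n)) with (qfac tau n * (1 - e2pi (INR (S n) * tau))).
    rewrite Cmod_mult. fold l in K1, K2.
    assert (P : (0 < Cmod (qfac tau n))%R) by now apply Cmod_gt_0.
    rewrite Rinv_mult. apply Rmult_le_compat_l; [apply Rlt_le, Rinv_0_lt_compat, P|].
    set (x := exp (- (l * INR (S n)))) in *.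
    apply Rle_trans with (/ (1 - x))%R; [apply Rinv_le_contravar; lra|].
    assert (Hx : (x <= exp (- l))%R).
    { apply exp_le. rewrite S_INR. assert (Q := pos_INR n). nra. }
    assert (Hx0 : (0 < x)%R) by apply exp_pos.
    replace (exp (k - l * INR (S n)))%R with (x / (1 - exp (- l)))%R.
    2:{ unfold Rminus at 2. rewrite exp_plus, Ek. fold x. field. lra. }
    eapply Rle_trans; [| apply exp_ineq1_le].
    replace (/ (1 - x))%R with (1 + x / (1 - x))%R by (field; lra).
    apply Rplus_le_compat_l. apply Rmult_le_compat_l; [lra|].
    apply Rinv_le_contravar; lra.
Qed.

(** If the limit were 0, then 1 = |1 / u n| |u n| would tend to 0. *)
Lemma limC_inv (u : nat -> C) (l : C) (M : R) : (0 < M)%R -> (forall n, u n <> 0) ->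
  (forall n, Cmod (/ u n) <= M)%R -> limC u l -> l <> 0 /\ limC (fun n => / u n) (/ l).
Proof.
  intros HM Hu0 HMu Hu.
  assert (Hl : l <> 0).
  { intros ->. 
    assert (K : is_lim_seq (fun n => Cmod (/ u n) * Cmod (u n - 0))%R 0).
    { apply (is_lim_seq_le_le (fun _ => 0%R) _ (fun n => M * Cmod (u n - 0))%R).
      - intros n; split; [apply Rmult_le_pos; apply Cmod_ge_0|].
        apply Rmult_le_compat_r; [apply Cmod_ge_0 | apply HMu].
      - apply is_lim_seq_const.
      - replace (Finite 0) with (Finite (M * 0)%R) by (f_equal; ring).
        apply is_lim_seq_mult'; auto; apply is_lim_seq_const. }
    assert (K1 : is_lim_seq (fun _ : nat => 1%R) 0).
    { eapply is_lim_seq_ext; [| exact K]. intros n; simpl.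
      rewrite <- Cmod_mult. replace (/ u n * (u n - 0)) with (RtoC 1); [apply Cmod_1|].
      field. apply Hu0. }
    apply is_lim_seq_unique in K1. rewrite Lim_seq_const in K1. injection K1; lra. }
  split; auto.
  apply (limC_squeeze _ _ (fun n => M * Cmod (/ l) * Cmod (u n - l))%R).
  - intros n. replace (/ u n - / l) with (- (/ u n * / l * (u n - l))).
    + rewrite Cmod_opp, !Cmod_mult. apply Rmult_le_compat_r; [apply Cmod_ge_0|].
      apply Rmult_le_compat_r; [apply Cmod_ge_0 | apply HMu].
    + field. split; auto.
  - replace (Finite 0) with (Finite (M * Cmod (/ l) * 0)%R) by (f_equal; ring).
    apply is_lim_seq_mult'; auto; apply is_lim_seq_const.
Qed.

Lemma qpoch_0_neq_0 (tau : C) : (0 < Im tau)%R -> qpoch tau 0 <> 0.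
Proof.
  intros Ht. destruct (qfac_inv_bound tau Ht) as [M [HM K]].
  apply (limC_inv (qfac tau) _ M HM); auto using qfac_lim, qfac_neq_0.
Qed.

(** * Jacobi's triple product *)

(* [th tau u] is the sum of (-1)^n q^(n(n-1)/2) y^n with q = e2pi tau, y = e2pi u. *)
Definition th_exp (tau : C) (n : Z) : C :=
  IZR n / 2 + tau * (IZR n * (IZR n - 1) / 2).

Definition th (tau u : C) : C := sumZ (fun n => e2pi (th_exp tau n + IZR n * u)).

Lemma Im_div2 (tau : C) : Im (tau / 2) = (Im tau / 2)%R.
Proof. destruct tau; unfold Im; simpl; field; lra. Qed.

Lemma th_summable (tau u : C) : (0 < Im tau)%R ->
  abs_summable (fun n => e2pi (th_exp tau n + IZR n * u)).
Proof.
  intros Ht. apply (abs_summable_quad (tau / 2) (1 / 2 - tau / 2 + u) 0).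
  - rewrite Im_div2. lra.
  - intros n. f_equal. unfold th_exp. ceq.
Qed.

(** The value 0 at negative k lets the recurrence [qfac_inv_pred] hold for every integer: at k = 0
    its factor 1 - q^0 vanishes. *)
Definition qfac_inv (tau : C) (k : Z) : C :=
  if (0 <=? k)%Z then / qfac tau (Z.to_nat k) else 0.

Lemma qfac_inv_pred (tau : C) (k : Z) : (0 < Im tau)%R ->
  qfac_inv tau (k - 1) = (1 - e2pi (IZR k * tau)) * qfac_inv tau k.
Proof.
  intros Ht. unfold qfac_inv.
  destruct (Z.leb_spec 0 (k - 1)); destruct (Z.leb_spec 0 k); try lia.
  - replace (Z.to_nat k) with (S (Z.to_nat (k - 1))) by lia.
    assert (H1 := qfac_neq_0 tau (Z.to_nat (k - 1)) Ht).
    assert (H2 := qfac_neq_0 tau (S (Z.to_nat (k - 1))) Ht).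
    change (qfac tau (S (Z.to_nat (k - 1)))) with
      (qfac tau (Z.to_nat (k - 1)) * (1 - e2pi (INR (S (Z.to_nat (k - 1))) * tau))) in *.
    replace (RtoC (INR (S (Z.to_nat (k - 1))))) with (RtoC (IZR k)) in *.
    + assert (H3 : 1 - e2pi (IZR k * tau) <> 0).
      { intros H3; apply H2; rewrite H3; ring. }
      field. auto.
    + f_equal. rewrite INR_IZR_INZ. f_equal. lia.
  - replace k with 0%Z by lia. rewrite Cmult_0_l, e2pi_0. ring.
  - ring.
Qed.

(* (-1)^j q^(j(j-1)/2) times the Gaussian binomial coefficient [2N, N+j]. *)
Definition fin_coef (tau : C) (N : nat) (j : Z) : C :=
  e2pi (th_exp tau j) * qfac tau (2 * N) *
  (qfac_inv tau (Z.of_nat N + j) * qfac_inv tau (Z.of_nat N - j)).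

(** The effect on coefficients of multiplying by (1 - y q^N)(1 - q^(N+1) / y). All shifted inverses
    are multiples of [X] and [Y], which leaves a rational identity in Q = q^N, q and J = q^j. *)
Lemma fin_coef_S (tau : C) (N : nat) (j : Z) : (0 < Im tau)%R ->
  fin_coef tau (S N) j =
    (1 + e2pi ((2 * INR N + 1) * tau)) * fin_coef tau N j
    + (- (e2pi (INR N * tau) * fin_coef tau N (j - 1))
       + - (e2pi ((INR N + 1) * tau) * fin_coef tau N (j + 1))).
Proof.
  intros Ht. unfold fin_coef.
  set (X := qfac_inv tau (Z.of_nat N + 1 + j)).
  set (Y := qfac_inv tau (Z.of_nat N + 1 - j)).
  set (Q := e2pi (INR N * tau)). set (q := e2pi tau).
  set (J := e2pi (IZR j * tau)).
  assert (HJ : J <> 0) by apply e2pi_neq_0.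
  assert (Hq : q <> 0) by apply e2pi_neq_0.
  assert (E1 : forall a b c : Z, e2pi ((INR N * IZR a + IZR b + IZR j * IZR c) * tau) =
    e2pi (INR N * tau * IZR a) * e2pi (tau * IZR b) * e2pi (IZR j * tau * IZR c)).
  { intros a b c. rewrite <- !e2pi_plus. f_equal. ring. }
  replace (Z.of_nat (S N) + j)%Z with (Z.of_nat N + 1 + j)%Z by lia.
  replace (Z.of_nat (S N) - j)%Z with (Z.of_nat N + 1 - j)%Z by lia.
  fold X Y.
  assert (A1 : qfac_inv tau (Z.of_nat N + j) = (1 - Q * q * J) * X).
  { replace (Z.of_nat N + j)%Z with (Z.of_nat N + 1 + j - 1)%Z by lia.
    rewrite qfac_inv_pred by auto. fold X. f_equal. f_equal. f_equal.
    unfold Q, q, J. rewrite <- !e2pi_plus. f_equal.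
    rewrite !plus_IZR, <- INR_IZR_INZ, !RtoC_plus. ring. }
  assert (A2 : qfac_inv tau (Z.of_nat N - j) = (1 - Q * q / J) * Y).
  { replace (Z.of_nat N - j)%Z with (Z.of_nat N + 1 - j - 1)%Z by lia.
    rewrite qfac_inv_pred by auto. fold Y. f_equal. f_equal. f_equal.
    unfold Q, q, J, Cdiv. rewrite <- e2pi_opp, <- !e2pi_plus. f_equal.
    rewrite minus_IZR, !plus_IZR, <- INR_IZR_INZ, RtoC_minus, !RtoC_plus. ring. }
  assert (A3 : qfac_inv tau (Z.of_nat N + (j - 1)) = (1 - Q * J) * ((1 - Q * q * J) * X)).
  { rewrite <- A1. replace (Z.of_nat N + (j - 1))%Z with (Z.of_nat N + j - 1)%Z by lia.
    rewrite qfac_inv_pred by auto. f_equal. f_equal. f_equal.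
    unfold Q, J. rewrite <- !e2pi_plus. f_equal.
    rewrite !plus_IZR, <- INR_IZR_INZ, !RtoC_plus. ring. }
  assert (A4 : qfac_inv tau (Z.of_nat N - (j + 1)) = (1 - Q / J) * ((1 - Q * q / J) * Y)).
  { rewrite <- A2. replace (Z.of_nat N - (j + 1))%Z with (Z.of_nat N - j - 1)%Z by lia.
    rewrite qfac_inv_pred by auto. f_equal. f_equal. f_equal.
    unfold Q, J, Cdiv. rewrite <- e2pi_opp, <- !e2pi_plus. f_equal.
    rewrite minus_IZR, <- INR_IZR_INZ, RtoC_minus. ring. }
  rewrite A1, A2, A3, A4.
  replace (Z.of_nat N - (j - 1))%Z with (Z.of_nat N + 1 - j)%Z by lia.
  replace (Z.of_nat N + (j + 1))%Z with (Z.of_nat N + 1 + j)%Z by lia.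
  fold X Y.
  assert (B1 : e2pi (th_exp tau (j - 1)) = - (e2pi (th_exp tau j) * q / J)).
  { replace (th_exp tau (j - 1)) with (th_exp tau j + - (1 / 2) + tau + - (IZR j * tau))
      by (unfold th_exp; ceq).
    rewrite !e2pi_plus. fold q. rewrite (e2pi_opp (IZR j * tau)). fold J.
    rewrite (e2pi_opp (1 / 2)), e2pi_half.
    replace (/ - (1)) with (- RtoC 1) by field. field. exact HJ. }
  assert (B2 : e2pi (th_exp tau (j + 1)) = - (e2pi (th_exp tau j) * J)).
  { replace (th_exp tau (j + 1)) with (th_exp tau j + 1 / 2 + (IZR j * tau))
      by (unfold th_exp; ceq).
    rewrite !e2pi_plus. fold J. rewrite e2pi_half. ring. }
  rewrite B1, B2.
  assert (C1 : qfac tau (2 * S N) = qfac tau (2 * N) * (1 - Q * Q * q) * (1 - Q * Q * q * q)).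
  { replace (2 * S N)%nat with (S (S (2 * N))) by lia. unfold qfac; cbn [prodC].
    f_equal; [f_equal|]; f_equal; f_equal;
    unfold Q, q; rewrite <- !e2pi_plus; f_equal; rewrite !S_INR, mult_INR; simpl (INR 2);
    rewrite ?RtoC_plus, ?RtoC_mult, ?RtoC_plus; ring. }
  rewrite C1.
  replace (e2pi ((2 * INR N + 1) * tau)) with (Q * Q * q).
  2:{ unfold Q, q; rewrite <- !e2pi_plus; f_equal. ceq. }
  replace (e2pi ((INR N + 1) * tau)) with (Q * q).
  2:{ unfold Q, q; rewrite <- !e2pi_plus; f_equal. ring. }
  field. exact HJ.
Qed.

Lemma fin_coef_bound (tau : C) : (0 < Im tau)%R ->
  exists M : R, (0 <= M)%R /\ forall N j,
    (Cmod (fin_coef tau N j) <= M * Cmod (e2pi (th_exp tau j)))%R.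
Proof.
  intros Ht. destruct (qfac_inv_bound tau Ht) as [M [HM K]].
  set (L := exp (exp (2 * PI * Rabs (Im 0)) / (exp (2 * PI * Im tau) - 1))).
  assert (HL : forall N, (Cmod (qfac tau N) <= L)%R).
  { intros N. unfold L, qfac.
    rewrite <- (prodC_ext (fun n => 1 - e2pi (INR n * tau + 0)) _ N)
      by (intros n; now rewrite Cplus_0_r).
    apply (prodC_bound (fun n => e2pi (INR n * tau + 0)));
      [now apply two_PI_pos | apply geom_bound_qpoch]. }
  assert (HU : forall k, (Cmod (qfac_inv tau k) <= M)%R).
  { intros k; unfold qfac_inv; destruct (0 <=? k)%Z; [apply K | rewrite Cmod_0; lra]. }
  assert (HL0 : (0 <= L)%R) by (apply Rlt_le, exp_pos).
  exists (L * (M * M))%R; split; [apply Rmult_le_pos; [exact HL0 | nra]|].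
  intros N j; unfold fin_coef; rewrite !Cmod_mult.
  replace (L * (M * M) * Cmod (e2pi (th_exp tau j)))%R
    with (Cmod (e2pi (th_exp tau j)) * L * (M * M))%R by ring.
  apply Rmult_le_compat.
  - apply Rmult_le_pos; apply Cmod_ge_0.
  - apply Rmult_le_pos; apply Cmod_ge_0.
  - apply Rmult_le_compat_l; [apply Cmod_ge_0 | apply HL].
  - apply Rmult_le_compat; try apply Cmod_ge_0; apply HU.
Qed.

Lemma fin_coef_summable (tau u : C) N : (0 < Im tau)%R ->
  abs_summable (fun j => fin_coef tau N j * e2pi (IZR j * u)).
Proof.
  intros Ht. destruct (fin_coef_bound tau Ht) as [M [HM K]].
  apply (abs_summable_le _ (fun j => M * Cmod (e2pi (th_exp tau j + IZR j * u)))%R).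
  - intros j. rewrite e2pi_plus, !Cmod_mult, <- Rmult_assoc.
    apply Rmult_le_compat_r; [apply Cmod_ge_0 | apply K].
  - apply summable_scal; auto. apply (th_summable tau u Ht).
Qed.

(** A form of the q-binomial theorem. The right side is a Laurent polynomial written as a bilateral
    series, its coefficients being 0 for |j| > N. *)
Lemma finite_triple_product (tau u : C) N : (0 < Im tau)%R ->
  prodC (fun n => 1 - e2pi (INR n * tau + (u - tau))) N
  * prodC (fun n => 1 - e2pi (INR n * tau + - u)) N
  = sumZ (fun j => fin_coef tau N j * e2pi (IZR j * u)).
Proof.
  intros Ht. induction N as [|N IH].
  - cbn [prodC]. destruct (sumZ_delta 0 1) as [_ D].
    rewrite <- (sumZ_ext (fun n => if (n =? 0)%Z then RtoC 1 else 0)); [rewrite D; ring|].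
    intros j. unfold fin_coef, qfac_inv. simpl (Z.of_nat 0).
    destruct (Z.eqb_spec j 0) as [->|Hj].
    + replace (th_exp tau 0) with (RtoC 0) by (unfold th_exp; ceq).
      replace (IZR 0 * u) with (RtoC 0) by ring.
      rewrite e2pi_0. unfold qfac; simpl. field.
    + destruct (Z.leb_spec 0 (0 + j)); destruct (Z.leb_spec 0 (0 - j)); try lia; ring.
  - cbn [prodC].
    set (f := fun j => fin_coef tau N j * e2pi (IZR j * u)) in IH.
    assert (Hf : abs_summable f) by exact (fin_coef_summable tau u N Ht).
    set (c1 := 1 + e2pi ((2 * INR N + 1) * tau)).
    set (c2 := - e2pi (INR N * tau + u)). set (c3 := - e2pi ((INR N + 1) * tau + - u)).
    rewrite (sumZ_ext _ (fun j => c1 * f j + (c2 * f (j + -1)%Z + c3 * f (j + 1)%Z))).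
    + assert (Hs : forall k, abs_summable (fun j => f (j + k)%Z))
        by (intros k; now apply abs_summable_shift).
      rewrite (sumZ_plus (fun j => c1 * f j)); try (apply abs_summable_scal; auto).
      2:{ apply abs_summable_plus; apply (abs_summable_scal _ (fun j => f (j + _)%Z)); auto. }
      rewrite (sumZ_plus (fun j => c2 * f (j + -1)%Z)).
      2,3: apply (abs_summable_scal _ (fun j => f (j + _)%Z)); auto.
      rewrite (sumZ_scal c1 f Hf), (sumZ_scal c2 (fun j => f (j + -1)%Z)),
        (sumZ_scal c3 (fun j => f (j + 1)%Z)), !sumZ_shift by auto.
      rewrite <- IH.
      replace (INR (S N) * tau + (u - tau)) with (INR N * tau + u)
        by (rewrite S_INR, RtoC_plus; ring).
      replace (INR (S N) * tau + - u) with ((INR N + 1) * tau + - u)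
        by (rewrite S_INR, RtoC_plus; ring).
      unfold c1, c2, c3.
      replace ((2 * INR N + 1) * tau) with (INR N * tau + u + ((INR N + 1) * tau + - u)) by ceq.
      rewrite (e2pi_plus (INR N * tau + u)). ring.
    + intros j. rewrite fin_coef_S by auto. unfold f, c1, c2, c3.
      replace (j + -1)%Z with (j - 1)%Z by lia.
      rewrite (e2pi_plus (INR N * tau) u), (e2pi_plus _ (- u)).
      rewrite minus_IZR, plus_IZR, RtoC_minus, RtoC_plus.
      replace (IZR j * u) with (u + (IZR j - 1) * u) at 2 by ring.
      replace ((IZR j - 1) * u) with (IZR j * u + - u) by ring.
      replace ((IZR j + 1) * u) with (IZR j * u + u) by ring.
      rewrite !e2pi_plus, !e2pi_opp. field. apply e2pi_neq_0.
Qed.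

Lemma limC_ext_loc (u v : nat -> C) (l : C) N0 :
  (forall n, (N0 <= n)%nat -> u n = v n) -> limC u l -> limC v l.
Proof.
  intros H. apply is_lim_seq_ext_loc. exists N0. intros n Hn. now rewrite H.
Qed.

Lemma qfac_inv_lim (tau : C) (k : Z) : (0 < Im tau)%R ->
  limC (fun N => qfac_inv tau (Z.of_nat N + k)) (/ qpoch tau 0).
Proof.
  intros Ht.
  assert (L : limC (fun N => / qfac tau N) (/ qpoch tau 0)).
  { destruct (qfac_inv_bound tau Ht) as [M [HM K]].
    apply (limC_inv (qfac tau) _ M HM); auto using qfac_lim, qfac_neq_0. }
  apply (limC_ext_loc (fun N => / qfac tau (Z.to_nat (Z.of_nat N + k))) _ _ (Z.to_nat (Z.abs k))).
  - intros N HN. unfold qfac_inv. replace (0 <=? Z.of_nat N + k)%Z with true; auto.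
    symmetry; apply Z.leb_le; lia.
  - apply (is_lim_seq_subseq (fun n => Cmod (/ qfac tau n - / qpoch tau 0)) _
      (fun N => Z.to_nat (Z.of_nat N + k))); auto.
    intros P [N0 HN]. exists (N0 + Z.to_nat (Z.abs k))%nat. intros n Hn. apply HN. lia.
Qed.

(** As N grows, each Gaussian binomial [2N, N+j] tends to 1 / L, where L is [qpoch tau 0]; [tannery]
    moves the limit inside the sum. *)
Lemma triple_product (tau u : C) : (0 < Im tau)%R ->
  th tau u = qpoch tau 0 * qpoch tau (u - tau) * qpoch tau (- u).
Proof.
  intros Ht. set (L := qpoch tau 0).
  assert (HL : L <> 0) by now apply qpoch_0_neq_0.
  assert (E : qpoch tau (u - tau) * qpoch tau (- u) = / L * th tau u).
  { eapply limC_unique.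
    - apply limC_mult; apply qpoch_lim; exact Ht.
    - apply (limC_ext (fun N => sumZ (fun j => fin_coef tau N j * e2pi (IZR j * u)))).
      { intros N. now rewrite finite_triple_product. }
      unfold th. rewrite <- sumZ_scal by now apply th_summable.
      destruct (fin_coef_bound tau Ht) as [M [HM K]].
      apply (tannery _ _ (fun j => M * Cmod (e2pi (th_exp tau j + IZR j * u)))%R).
      + intros N j. rewrite e2pi_plus, !Cmod_mult, <- Rmult_assoc.
        apply Rmult_le_compat_r; [apply Cmod_ge_0 | apply K].
      + apply summable_scal; auto. apply (th_summable tau u Ht).
      + intros j. rewrite e2pi_plus.
        replace (/ L * (e2pi (th_exp tau j) * e2pi (IZR j * u))) with
          (e2pi (th_exp tau j) * L * (/ L * / L) * e2pi (IZR j * u)) by (field; auto).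
        apply limC_mult; [| apply limC_const].
        unfold fin_coef. apply limC_mult.
        * apply limC_scal. apply (limC_subseq (qfac tau) _ (fun N => 2 * N)%nat);
            [intros; lia | now apply qfac_lim].
        * apply limC_mult; now apply (qfac_inv_lim tau). }
  replace (L * qpoch tau (u - tau) * qpoch tau (- u)) with
    (L * (qpoch tau (u - tau) * qpoch tau (- u))) by ring.
  rewrite E. field. exact HL.
Qed.

Lemma triple_product' (tau u : C) : (0 < Im tau)%R ->
  th tau u = (1 - e2pi u) * (qpoch tau 0 * qpoch tau u * qpoch tau (- u)).
Proof. intros Ht. rewrite triple_product, qpoch_shift by auto. ring. Qed.

(** * Laurent expansion of bilateral sums *)

(* With q = e2pi tau, [ptheta tau k] is the partial theta sum of
   (-1)^i q^(i(i+1)/2) over i >= |k|: the k-th Laurent coefficient of th / (1 - y). *)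
Definition tri_exp (tau : C) (i : Z) : C :=
  IZR i / 2 + tau * (IZR i * (IZR i + 1) / 2).

Definition ptheta_term (tau : C) (k i : Z) : C :=
  if (Z.abs k <=? i)%Z then e2pi (tri_exp tau i) else 0.

Definition ptheta (tau : C) (k : Z) : C := sumZ (ptheta_term tau k).

Lemma ptheta_opp (tau : C) (k : Z) : ptheta tau (- k) = ptheta tau k.
Proof. unfold ptheta, ptheta_term. now rewrite Z.abs_opp. Qed.

Lemma tri_summable (tau : C) : (0 < Im tau)%R -> abs_summable (fun i => e2pi (tri_exp tau i)).
Proof.
  intros Ht. apply (abs_summable_quad (tau / 2) (1 / 2 + tau / 2) 0).
  - rewrite Im_div2. lra.
  - intros n. f_equal. unfold tri_exp. ceq.
Qed.

Lemma ptheta_term_summable (tau : C) (k : Z) : (0 < Im tau)%R ->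
  abs_summable (ptheta_term tau k).
Proof.
  intros Ht. eapply abs_summable_le; [| exact (tri_summable tau Ht)].
  intros i. unfold ptheta_term. simpl. destruct (_ <=? _)%Z; [apply Rle_refl|].
  rewrite Cmod_0. apply Cmod_ge_0.
Qed.

Lemma Cmod_tri (tau : C) (i : Z) :
  Cmod (e2pi (tri_exp tau i)) = exp (- (PI * Im tau * (IZR i * (IZR i + 1)))).
Proof.
  rewrite Cmod_e2pi. f_equal. unfold tri_exp. destruct tau as [a b].
  unfold Im; simpl. field.
Qed.

(** The bound is |q|^((k^2 - |k|)/2). It is weak enough to hold also for the sum of two neighbouring
    coefficients, see [ptheta_pair_decay]. *)
Definition theta_decay (tau : C) (G : Z -> C) : Prop :=
  exists M : R, (0 <= M)%R /\ forall k,
    (Cmod (G k) <= M * exp (- (PI * Im tau * (IZR k ^ 2 - Rabs (IZR k)))))%R.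

Lemma ptheta_bound (tau : C) : (0 < Im tau)%R ->
  exists M : R, (0 <= M)%R /\ forall k,
    (Cmod (ptheta tau k) <= M * exp (- (PI * Im tau * (IZR k ^ 2 + Rabs (IZR k)))))%R.
Proof.
  intros Ht. assert (P := PI_RGT_0).
  assert (HS : summable (fun j => exp (- (PI * Im tau * IZR j ^ 2) + 0 * Rabs (IZR j) + 0))%R).
  { apply summable_gauss. nra. }
  eexists; split; [exact (rsum_nonneg _ HS)|].
  intros k. unfold ptheta.
  (* With i = j + |k| and j >= 0, i(i + 1) is at least k^2 + |k| + j^2, so the k-dependence factors
     out. *)
  rewrite <- (sumZ_shift _ (Z.abs k) (ptheta_term_summable tau k Ht)).
  rewrite Rmult_comm, <- rsum_scal by exact HS.
  apply sumZ_norm_le; [| apply summable_scal; [apply Rlt_le, exp_pos | exact HS]].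
  intros j. unfold ptheta_term. destruct (Z.leb_spec (Z.abs k) (j + Z.abs k)).
  - rewrite Cmod_tri, <- exp_plus. apply exp_le.
    rewrite plus_IZR, abs_IZR. set (a := Rabs (IZR k)).
    replace (IZR k ^ 2)%R with (a ^ 2)%R by apply pow2_abs.
    assert (H1 : (0 <= IZR j)%R) by (apply (IZR_le 0); lia).
    assert (H2 : (0 <= a)%R) by apply Rabs_pos.
    assert (H3 : (0 <= PI * Im tau * (2 * a * IZR j + IZR j))%R).
    { apply Rmult_le_pos; nra. }
    nra.
  - rewrite Cmod_0. apply Rmult_le_pos; apply Rlt_le, exp_pos.
Qed.

(** The coefficientwise form of (1 - y) G = th. For k <= 0 it follows from the case of nonnegative
    index by evenness, since n(n-1)/2 at n = k equals i(i+1)/2 at i = -k. *)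
Lemma ptheta_step (tau : C) (k : Z) : (0 < Im tau)%R ->
  ptheta tau k + - ptheta tau (k - 1) = e2pi (th_exp tau k).
Proof.
  intros Ht.
  assert (K : forall j, (0 <= j)%Z -> ptheta tau j = ptheta tau (j + 1) + e2pi (tri_exp tau j)).
  { intros j Hj. unfold ptheta.
    destruct (sumZ_delta j (e2pi (tri_exp tau j))) as [D1 D2].
    rewrite <- D2, <- sumZ_plus; auto using ptheta_term_summable.
    apply sumZ_ext. intros i. unfold ptheta_term.
    rewrite (Z.abs_eq j), (Z.abs_eq (j + 1)) by lia.
    destruct (Z.leb_spec j i); destruct (Z.leb_spec (j + 1) i);
      destruct (Z.eqb_spec i j); try lia; subst; ring. }
  destruct (Z_le_gt_dec 1 k).
  - rewrite (K (k - 1)%Z) by lia. replace (k - 1 + 1)%Z with k by lia.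
    replace (th_exp tau k) with (tri_exp tau (k - 1) + 1 / 2)
      by (unfold th_exp, tri_exp; ceq).
    rewrite e2pi_plus, e2pi_half. ring.
  - rewrite <- (ptheta_opp tau k), <- (ptheta_opp tau (k - 1)), (K (- k)%Z) by lia.
    replace (- k + 1)%Z with (- (k - 1))%Z by lia.
    rewrite (e2pi_eq (th_exp tau k) (tri_exp tau (- k)) k).
    + ring.
    + unfold th_exp, tri_exp. ceq.
Qed.

Lemma ptheta_decay (tau : C) : (0 < Im tau)%R -> theta_decay tau (ptheta tau).
Proof.
  intros Ht. destruct (ptheta_bound tau Ht) as [M [HM K]]. exists M; split; auto.
  intros k. eapply Rle_trans; [apply K|]. apply Rmult_le_compat_l; auto.
  apply exp_le. assert (P := PI_RGT_0). assert (Q := Rabs_pos (IZR k)).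
  assert (0 <= PI * Im tau * Rabs (IZR k))%R by (apply Rmult_le_pos; nra).
  nra.
Qed.

Lemma ptheta_pair_decay (tau : C) : (0 < Im tau)%R ->
  theta_decay tau (fun k => ptheta tau k + ptheta tau (k - 1)).
Proof.
  intros Ht. destruct (ptheta_bound tau Ht) as [M [HM K]]. exists (M + M)%R; split; [lra|].
  intros k. eapply Rle_trans; [apply Cmod_triangle|].
  rewrite Rmult_plus_distr_r. assert (P := PI_RGT_0).
  assert (Pt : (0 < PI * Im tau)%R) by nra.
  apply Rplus_le_compat; eapply Rle_trans; try apply K; apply Rmult_le_compat_l; auto;
    apply exp_le; apply Ropp_le_contravar; apply Rmult_le_compat_l; try lra.
  - assert (Q := Rabs_pos (IZR k)). lra.
  - rewrite minus_IZR. destruct (Z_le_gt_dec 1 k) as [h|h].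
    + assert (H : (1 <= IZR k)%R) by (apply (IZR_le 1); lia).
      rewrite !Rabs_pos_eq by lra. nra.
    + assert (H : (IZR k <= 0)%R) by (apply (IZR_le _ 0); lia).
      rewrite !Rabs_left1 by lra. nra.
Qed.

Definition laurent (G : Z -> C) (u : C) : C := sumZ (fun k => G k * e2pi (IZR k * u)).

Lemma Cmod_e2pi_int_le (k : Z) (u : C) :
  (Cmod (e2pi (IZR k * u)) <= exp (2 * PI * Rabs (Im u) * Rabs (IZR k)))%R.
Proof.
  rewrite Cmod_e2pi. apply exp_le.
  replace (Im (IZR k * u)) with (IZR k * Im u)%R by (destruct u; unfold Im; simpl; ring).
  replace (2 * PI * Rabs (Im u) * Rabs (IZR k))%R with (2 * PI * Rabs (- (IZR k * Im u)))%R
    by (rewrite Rabs_Ropp, Rabs_mult; ring).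
  assert (K := Rle_abs (- (IZR k * Im u))). assert (P := PI_RGT_0). nra.
Qed.

(** One majorant for a whole strip |Im u| <= b, so that limits in u may be taken termwise. *)
Lemma laurent_bound (tau : C) (G : Z -> C) (b : R) : (0 < Im tau)%R -> theta_decay tau G ->
  exists D : Z -> R, summable D /\
  forall u : C, (Rabs (Im u) <= b)%R -> forall k, (Cmod (G k * e2pi (IZR k * u)) <= D k)%R.
Proof.
  intros Ht [M [HM K]]. assert (P := PI_RGT_0).
  exists (fun k => M * exp (- (PI * Im tau * IZR k ^ 2)
     + (PI * Im tau + 2 * PI * b) * Rabs (IZR k) + 0))%R. split.
  - apply summable_scal; auto. apply summable_gauss. nra.
  - intros u Hu k. rewrite Cmod_mult.
    replace (- (PI * Im tau * IZR k ^ 2) + (PI * Im tau + 2 * PI * b) * Rabs (IZR k) + 0)%R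
     with (- (PI * Im tau * (IZR k ^ 2 - Rabs (IZR k))) + 2 * PI * b * Rabs (IZR k))%R by ring.
    rewrite exp_plus, <- Rmult_assoc.
    apply Rmult_le_compat; try apply Cmod_ge_0; auto.
    eapply Rle_trans; [apply Cmod_e2pi_int_le|]. apply exp_le.
    apply Rmult_le_compat_r; [apply Rabs_pos|]. nra.
Qed.

Lemma laurent_summable (tau : C) (G : Z -> C) (u : C) : (0 < Im tau)%R -> theta_decay tau G ->
  abs_summable (fun k => G k * e2pi (IZR k * u)).
Proof.
  intros Ht HG. destruct (laurent_bound tau G (Rabs (Im u)) Ht HG) as [D [HD K]].
  eapply abs_summable_le; [apply (K u (Rle_refl _)) | exact HD].
Qed.

(** Multiplication by 1 + c y on coefficients: with c = -1 it recovers th from [ptheta], with c = 1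
    it produces the second choice of G. *)
Lemma laurent_pair (tau : C) (G : Z -> C) (u : C) (c : C) : (0 < Im tau)%R ->
  theta_decay tau G ->
  sumZ (fun k => (G k + c * G (k - 1)%Z) * e2pi (IZR k * u)) = (1 + c * e2pi u) * laurent G u.
Proof.
  intros Ht HG. assert (HS := laurent_summable tau G u Ht HG).
  unfold laurent.
  rewrite (sumZ_ext _ (fun k => G k * e2pi (IZR k * u) +
     (c * e2pi u) * (G (k + -1)%Z * e2pi (IZR (k + -1) * u)))).
  2:{ intros k. replace (k + -1)%Z with (k - 1)%Z by lia.
      assert (E : e2pi (IZR k * u) = e2pi u * e2pi (IZR (k - 1) * u)).
      { rewrite <- e2pi_plus. f_equal. rewrite minus_IZR, RtoC_minus. ring. }
      rewrite Cmult_plus_distr_r. f_equal. rewrite E. ring. }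
  assert (HS1 := abs_summable_shift _ (-1) HS). cbv beta in HS1.
  rewrite (sumZ_plus (fun k => G k * e2pi (IZR k * u))
    (fun k => c * e2pi u * (G (k + -1)%Z * e2pi (IZR (k + -1) * u)))); auto.
  2:{ apply (abs_summable_scal _ _ HS1). }
  rewrite (sumZ_scal _ (fun k => G (k + -1)%Z * e2pi (IZR (k + -1) * u)) HS1).
  rewrite (sumZ_shift (fun k => G k * e2pi (IZR k * u)) (-1) HS). ring.
Qed.

Lemma th_laurent (tau u : C) : (0 < Im tau)%R ->
  th tau u = (1 - e2pi u) * laurent (ptheta tau) u.
Proof.
  intros Ht.
  replace (1 - e2pi u) with (1 + (-1) * e2pi u) by ring.
  rewrite <- (laurent_pair tau _ _ _ Ht (ptheta_decay tau Ht)).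
  apply sumZ_ext. intros n. rewrite e2pi_plus, <- ptheta_step by auto. ring.
Qed.

Lemma laurent_ptheta_pair (tau u : C) : (0 < Im tau)%R ->
  laurent (fun k => ptheta tau k + ptheta tau (k - 1)) u
  = (1 + e2pi u) * laurent (ptheta tau) u.
Proof.
  intros Ht. replace (1 + e2pi u) with (1 + 1 * e2pi u) by ring.
  rewrite <- (laurent_pair tau _ _ _ Ht (ptheta_decay tau Ht)).
  apply sumZ_ext. intros n. ring.
Qed.

(* The triple product gives the value for |y| = 1, y <> 1; then let y tend to 1. *)
Lemma laurent_ptheta_0 (tau : C) : (0 < Im tau)%R ->
  laurent (ptheta tau) 0 = qpoch tau 0 ^ 3.
Proof.
  intros Ht.
  (* The offset 3 keeps the points inside (0, 1/2), where sin(2 pi v) > 0 and hence y <> 1. *)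
  set (v := fun j : nat => (/ (INR j + 3))%R).
  assert (Hv : forall j, (0 < v j < 1 / 2)%R).
  { intros j. unfold v. assert (Q := pos_INR j). split; [apply Rinv_0_lt_compat; lra|].
    replace (1 / 2)%R with (/ 2)%R by field. apply Rinv_lt_contravar; lra. }
  assert (Lv : is_lim_seq v 0).
  { unfold v. replace (Finite 0) with (Rbar_inv p_infty) by reflexivity.
    apply is_lim_seq_inv; [| discriminate].
    apply (is_lim_seq_ext (fun j => INR (j + 3))).
    - intros j. rewrite plus_INR. simpl. ring.
    - apply (is_lim_seq_incr_n INR 3). apply is_lim_seq_INR. }
  assert (Ev : forall x : R, e2pi x = (cos (2 * PI * x), sin (2 * PI * x))).
  { intros x. unfold e2pi, Cexp. replace (Re (2 * PI * Ci * x)) with 0%R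
      by (unfold Re; simpl; ring).
    replace (Im (2 * PI * Ci * x)) with (2 * PI * x)%R by (unfold Im; simpl; ring).
    rewrite exp_0. f_equal; ring. }
  assert (Hlim : forall w : nat -> R, is_lim_seq w 0 -> limC (fun j => e2pi (w j)) 1).
  { intros w Hw. 
    assert (Hw2 : is_lim_seq (fun j => 2 * PI * w j)%R 0).
    { replace (Finite 0) with (Finite (2 * PI * 0)) by (f_equal; ring).
      apply is_lim_seq_mult'; auto. apply is_lim_seq_const. }
    apply limC_pair.
    - apply (is_lim_seq_ext (fun j => cos (2 * PI * w j))); [intros; now rewrite Ev|].
      rewrite <- cos_0. apply (is_lim_seq_continuous cos); auto. apply continuity_cos.
    - apply (is_lim_seq_ext (fun j => sin (2 * PI * w j))); [intros; now rewrite Ev|].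
      rewrite <- sin_0 at 1. apply (is_lim_seq_continuous sin); auto. apply continuity_sin. }
  assert (Hne : forall j, 1 - e2pi (v j) <> 0).
  { intros j H. rewrite Ev in H. apply (f_equal snd) in H. simpl in H.
    assert (S : (0 < sin (2 * PI * v j))%R).
    { specialize (Hv j). assert (P := PI_RGT_0). apply sin_gt_0; nra. }
    lra. }
  destruct (qpoch_cont_real tau v Ht (Hlim v Lv)) as [Q1 Q2].
  eapply limC_unique with (u := fun j => laurent (ptheta tau) (v j)).
  - destruct (laurent_bound tau (ptheta tau) 0 Ht (ptheta_decay tau Ht)) as [D [HD K]].
    apply (tannery _ _ D); auto.
    + intros j k. apply K. replace (Im (v j)) with 0%R by reflexivity. rewrite Rabs_R0; lra.
    + intros k. apply limC_scal. replace (IZR k * 0) with (RtoC 0) by ring. rewrite e2pi_0.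
      apply (limC_ext (fun j => e2pi ((IZR k * v j)%R))).
      * intros j; now rewrite RtoC_mult.
      * apply Hlim. replace (Finite 0) with (Finite (IZR k * 0)) by (f_equal; ring).
        apply is_lim_seq_mult'; auto. apply is_lim_seq_const.
  - apply (limC_ext (fun j => qpoch tau 0 * (qpoch tau (v j) * qpoch tau (- v j)))).
    + intros j. assert (E := triple_product' tau (v j) Ht). rewrite th_laurent in E by auto.
      assert (N := Hne j).
      replace (laurent (ptheta tau) (v j)) with
        ((1 - e2pi (v j)) * laurent (ptheta tau) (v j) / (1 - e2pi (v j))) by (field; auto).
      rewrite E. field; auto.
    + replace (qpoch tau 0 ^ 3) with (qpoch tau 0 * (qpoch tau 0 * qpoch tau 0)) by (simpl; ring).
      apply limC_scal. now apply limC_mult.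
Qed.

Lemma th_0 (tau : C) : (0 < Im tau)%R -> th tau 0 = 0.
Proof. intros Ht. rewrite th_laurent, e2pi_0 by auto. ring. Qed.

Lemma th_quasi (tau u : C) (n : Z) : (0 < Im tau)%R ->
  e2pi (th_exp tau n + IZR n * u) * th tau (u + IZR n * tau) = th tau u.
Proof.
  intros Ht. unfold th at 2. rewrite <- (sumZ_shift _ n (th_summable tau u Ht)).
  unfold th. rewrite <- sumZ_scal by now apply th_summable.
  apply sumZ_ext. intros k. rewrite <- e2pi_plus. f_equal.
  unfold th_exp. ceq.
Qed.

Lemma one_minus_q_neq_0 (tau : C) (n : Z) : (0 < Im tau)%R -> n <> 0%Z ->
  1 - e2pi (IZR n * tau) <> 0.
Proof.
  intros Ht Hn H.
  assert (H1 : Cmod (e2pi (IZR n * tau)) = 1%R).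
  { replace (e2pi (IZR n * tau)) with (RtoC 1); [apply Cmod_1|].
    replace (RtoC 1) with (1 - e2pi (IZR n * tau) + e2pi (IZR n * tau)) by ring.
    rewrite H. ring. }
  rewrite Cmod_e2pi in H1. rewrite <- exp_0 in H1. apply exp_inv in H1.
  replace (Im (IZR n * tau)) with (IZR n * Im tau)%R in H1
    by (destruct tau; unfold Im; simpl; ring).
  assert (P := PI_RGT_0).
  assert (Z0 : (IZR n * (PI * Im tau) = 0)%R) by lra.
  apply Rmult_integral in Z0 as [Z0|Z0]; [apply eq_IZR in Z0; lia | nra].
Qed.

(** At y = q^n theta vanishes while 1 - y does not. This is why only the term n = 0 of a lattice sum
    survives at u = 0. *)
Lemma laurent_ptheta_period (tau : C) (n : Z) : (0 < Im tau)%R -> n <> 0%Z ->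
  laurent (ptheta tau) (IZR n * tau) = 0.
Proof.
  intros Ht Hn. assert (N := one_minus_q_neq_0 tau n Ht Hn).
  assert (K := th_quasi tau 0 n Ht). rewrite th_0, Cplus_0_l in K by auto.
  rewrite th_laurent in K by auto.
  destruct (Ceq_dec (laurent (ptheta tau) (IZR n * tau)) 0) as [h|h]; auto.
  exfalso. revert K. apply Cmult_neq_0; [apply e2pi_neq_0 | now apply Cmult_neq_0].
Qed.

(* Substituting k = m - 2n in the Laurent series of G(y q^n) turns a lattice sum
   [sum over n of e2pi (n d) y^(2n) q^(n^2 - n/2) G(y q^n)] into a Laurent series in y
   with coefficients [lcoef]. *)
Definition lcoef_term (tau d : C) (G : Z -> C) (m n : Z) : C :=
  e2pi (IZR n * d + tau * (IZR m * IZR n - IZR n ^ 2 - IZR n / 2)) * G (m - 2 * n)%Z.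

Definition lcoef (tau d : C) (G : Z -> C) (m : Z) : C := sumZ (lcoef_term tau d G m).

(** The negative sign of n^2 in [lcoef_term] is harmless: with the decay of G at m - 2n, the total
    exponent of |q|^(1/2) has the positive definite quadratic part m^2 - 2mn + 2n^2, which yields a
    product majorant. *)
Lemma lcoef_term_bound (tau d u : C) (G : Z -> C) : (0 < Im tau)%R -> theta_decay tau G ->
  exists D H : Z -> R, summable D /\ summable H /\
  forall n m, (Cmod (e2pi (IZR m * u) * lcoef_term tau d G m n) <= D n * H m)%R.
Proof.
  intros Ht [M [HM K]]. assert (P := PI_RGT_0). set (l := (PI * Im tau)%R) in *.
  assert (Hl : (0 < l)%R) by (unfold l; nra).
  exists (fun n => M * exp (- (l / 2 * IZR n ^ 2)
    + (3 * l + 2 * PI * Rabs (Im d)) * Rabs (IZR n) + 0))%R.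
  exists (fun m => exp (- (l / 4 * IZR m ^ 2) + (l + 2 * PI * Rabs (Im u)) * Rabs (IZR m) + 0))%R.
  split; [apply summable_scal; auto; apply summable_gauss; lra|].
  split; [apply summable_gauss; lra|].
  intros n m. unfold lcoef_term. rewrite e2pi_plus, !Cmod_mult.
  set (x := IZR n). set (y := IZR m).
  assert (B0 := Cmod_e2pi_int_le m u). assert (B1 := Cmod_e2pi_int_le n d).
  assert (B2 := K (m - 2 * n)%Z). rewrite minus_IZR, mult_IZR in B2. fold x y in B0, B1, B2.
  assert (B3 : (Cmod (e2pi (tau * (y * x - x ^ 2 - x / 2))) =
     exp (- (2 * l * (y * x - x ^ 2 - x / 2))))%R).
  { rewrite Cmod_e2pi. f_equal. unfold l. destruct tau as [a b]. unfold Im; simpl. field. }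
  rewrite B3.
  assert (A1 := Rabs_pos x). assert (A2 := Rabs_pos y).
  apply Rle_trans with (exp (2 * PI * Rabs (Im u) * Rabs y) *
    (exp (2 * PI * Rabs (Im d) * Rabs x) * exp (- (2 * l * (y * x - x ^ 2 - x / 2))) *
     (M * exp (- (l * ((y - 2 * x) ^ 2 - Rabs (y - 2 * x)))))))%R.
  { apply Rmult_le_compat; [apply Cmod_ge_0 | | exact B0 |].
    - apply Rmult_le_pos; [| apply Cmod_ge_0].
      apply Rmult_le_pos; [apply Cmod_ge_0 | apply Rlt_le, exp_pos].
    - apply Rmult_le_compat; [| apply Cmod_ge_0 | | exact B2].
      + apply Rmult_le_pos; [apply Cmod_ge_0 | apply Rlt_le, exp_pos].
      + apply Rmult_le_compat_r; [apply Rlt_le, exp_pos | exact B1]. }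
  match goal with |- (exp ?a * (exp ?b * exp ?c * (M * exp ?d)) <= M * exp ?e * exp ?f)%R =>
    replace (exp a * (exp b * exp c * (M * exp d)))%R with (M * exp (a + b + c + d))%R
      by (rewrite !exp_plus; ring);
    replace (M * exp e * exp f)%R with (M * exp (e + f))%R by (rewrite exp_plus; ring)
  end.
  apply Rmult_le_compat_l; auto. apply exp_le.
  assert (T1 : (Rabs (y - 2 * x) <= Rabs y + 2 * Rabs x)%R).
  { unfold Rminus. eapply Rle_trans; [apply Rabs_triang|].
    rewrite Rabs_Ropp, Rabs_mult, (Rabs_pos_eq 2) by lra. lra. }
  assert (T2 : (x <= Rabs x)%R) by apply Rle_abs.
  (* Separates the variables: the quadratic form dominates a diagonal one. *)
  assert (T3 : (0 <= (y ^ 2 - 2 * y * x + 2 * x ^ 2) - (y ^ 2 / 4 + x ^ 2 / 2))%R).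
  { replace ((y ^ 2 - 2 * y * x + 2 * x ^ 2) - (y ^ 2 / 4 + x ^ 2 / 2))%R
      with (3 / 4 * (y - 4 / 3 * x) ^ 2 + 1 / 6 * x ^ 2)%R by field.
    assert (H1 := pow2_ge_0 (y - 4 / 3 * x)). assert (H2 := pow2_ge_0 x). lra. }
  assert (T4 : (0 <= l * (((y ^ 2 - 2 * y * x + 2 * x ^ 2) - (y ^ 2 / 4 + x ^ 2 / 2))
     + (Rabs x - x) + (Rabs y + 2 * Rabs x - Rabs (y - 2 * x))))%R).
  { apply Rmult_le_pos; lra. }
  nra.
Qed.

Lemma lcoef_summable (tau d : C) (G : Z -> C) (m : Z) : (0 < Im tau)%R -> theta_decay tau G ->
  abs_summable (lcoef_term tau d G m).
Proof.
  intros Ht HG. destruct (lcoef_term_bound tau d 0 G Ht HG) as [D [H [HD [HH K]]]].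
  apply (abs_summable_le _ (fun n => H m * D n)%R).
  - intros n. specialize (K n m). rewrite Cmult_0_r, e2pi_0, Cmult_1_l in K. lra.
  - apply summable_scal; [apply HH | exact HD].
Qed.

Lemma lattice_sum_laurent (tau d u : C) (G : Z -> C) : (0 < Im tau)%R -> theta_decay tau G ->
  abs_summable (fun n => e2pi (IZR n * d + 2 * IZR n * u + tau * (IZR n ^ 2 - IZR n / 2))
                         * laurent G (u + IZR n * tau)) /\
  sumZ (fun n => e2pi (IZR n * d + 2 * IZR n * u + tau * (IZR n ^ 2 - IZR n / 2))
                 * laurent G (u + IZR n * tau))
  = sumZ (fun m => e2pi (IZR m * u) * lcoef tau d G m).
Proof.
  intros Ht HG. destruct (lcoef_term_bound tau d u G Ht HG) as [D [H [HD [HH K]]]].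
  assert (E : forall n, e2pi (IZR n * d + 2 * IZR n * u + tau * (IZR n ^ 2 - IZR n / 2))
                         * laurent G (u + IZR n * tau) =
     sumZ (fun m => e2pi (IZR m * u) * lcoef_term tau d G m n)).
  { intros n. unfold laurent.
    assert (HS := laurent_summable tau G (u + IZR n * tau) Ht HG).
    rewrite <- (sumZ_shift _ (- (2 * n)) HS).
    assert (HS2 := abs_summable_shift _ (- (2 * n)) HS). cbv beta in HS2 |- *.
    rewrite <- (sumZ_scal _ (fun k => G (k + - (2 * n))%Z *
       e2pi (IZR (k + - (2 * n)) * (u + IZR n * tau))) HS2).
    apply sumZ_ext. intros m. unfold lcoef_term.
    replace (m + - (2 * n))%Z with (m - 2 * n)%Z by lia.
    rewrite (Cmult_comm (G _)), !Cmult_assoc, <- !e2pi_plus. f_equal. f_equal. ceq. }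
  split.
  - eapply abs_summable_ext; [intros n; symmetry; apply E|].
    apply (abs_summable_sumZ _ D H); auto.
  - rewrite (sumZ_ext _ _ E).
    rewrite (fubini _ D H); auto.
    apply sumZ_ext. intros m. apply sumZ_scal. now apply lcoef_summable.
Qed.

(** Replacing m by m + 2 and n by n + 1 leaves m - 2n fixed, so only the exponential changes. All
    coefficients are thus determined by those at 0 and 1. *)
Lemma lcoef_step (tau d : C) (G : Z -> C) (m : Z) : (0 < Im tau)%R -> theta_decay tau G ->
  lcoef tau d G (m + 2) = e2pi (d + tau * (IZR m + 1 / 2)) * lcoef tau d G m.
Proof.
  intros Ht HG. unfold lcoef.
  rewrite <- (sumZ_shift _ 1 (lcoef_summable tau d G (m + 2) Ht HG)).
  rewrite <- (sumZ_scal _ _ (lcoef_summable tau d G m Ht HG)).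
  apply sumZ_ext. intros n. unfold lcoef_term.
  replace (m + 2 - 2 * (n + 1))%Z with (m - 2 * n)%Z by lia.
  rewrite Cmult_assoc, <- e2pi_plus. f_equal. f_equal. ceq.
Qed.

(** * Appell-Lerch sums as lattice sums *)

(** The general term of a level-one Appell-Lerch sum. The parameter [al] is left free because the
    values u, u + tau, u + tau/2 and u + 1/2 all occur. *)
Definition appell_term (tau al u : C) (n : Z) : C :=
  e2pi (IZR n * al + tau * IZR n ^ 2 / 2) / (1 - e2pi (u + IZR n * tau)).

Lemma th_nonzero_pole_free (tau u : C) (n : Z) : (0 < Im tau)%R -> th tau u <> 0 ->
  1 - e2pi (u + IZR n * tau) <> 0.
Proof.
  intros Ht Hu H. apply Hu. rewrite <- (th_quasi tau u n Ht), th_laurent, H by auto. ring.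
Qed.

Lemma th_appell_term (tau al u : C) (n : Z) : (0 < Im tau)%R -> th tau u <> 0 ->
  th tau u * appell_term tau al u n =
  e2pi (IZR n * (al + 1 / 2 - u) + 2 * IZR n * u + tau * (IZR n ^ 2 - IZR n / 2))
  * laurent (ptheta tau) (u + IZR n * tau).
Proof.
  intros Ht Hu. unfold appell_term. rewrite <- (th_quasi tau u n Ht) at 1.
  rewrite th_laurent by auto. assert (N := th_nonzero_pole_free tau u n Ht Hu).
  replace (IZR n * (al + 1 / 2 - u) + 2 * IZR n * u + tau * (IZR n ^ 2 - IZR n / 2))
    with ((th_exp tau n + IZR n * u) + (IZR n * al + tau * IZR n ^ 2 / 2))
    by (unfold th_exp; ceq).
  rewrite (e2pi_plus (th_exp tau n + IZR n * u)). field. exact N.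
Qed.

(** Read off from the lattice sum by dividing by th, which replaces lower bounds for the
    denominators. *)
Lemma appell_summable (tau al u : C) : (0 < Im tau)%R -> th tau u <> 0 ->
  abs_summable (appell_term tau al u).
Proof.
  intros Ht Hu.
  destruct (lattice_sum_laurent tau (al + 1 / 2 - u) u _ Ht (ptheta_decay tau Ht)) as [HS _].
  apply (abs_summable_ext (fun n => / th tau u * (th tau u * appell_term tau al u n))).
  - intros n. field. exact Hu.
  - apply (abs_summable_scal (/ th tau u) (fun n => th tau u * appell_term tau al u n)).
    eapply abs_summable_ext; [| exact HS]. intros n. symmetry. now apply th_appell_term.
Qed.

Lemma Z_step_ind (P : Z -> Prop) : P 0%Z ->
  (forall j, P j -> P (j + 1)%Z) -> (forall j, P j -> P (j - 1)%Z) -> forall j, P j.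
Proof.
  intros H0 HS HP j. apply Z.peano_ind; auto.
Qed.

(** Here [f] carries the numerator: the constant 1, or x -> 1 + x for the paired sums. *)
Lemma lattice_sum_at_0 (tau d : C) (f : C -> C) : (0 < Im tau)%R ->
  sumZ (fun n => e2pi (IZR n * d + 2 * IZR n * 0 + tau * (IZR n ^ 2 - IZR n / 2))
                 * (f (e2pi (0 + IZR n * tau)) * laurent (ptheta tau) (0 + IZR n * tau)))
  = f 1 * qpoch tau 0 ^ 3.
Proof.
  intros Ht. destruct (sumZ_delta 0 (f 1 * qpoch tau 0 ^ 3)) as [_ D]. rewrite <- D.
  apply sumZ_ext. intros n. rewrite Cplus_0_l. destruct (Z.eqb_spec n 0) as [->|Hn].
  - replace (IZR 0 * d + 2 * IZR 0 * 0 + tau * (IZR 0 ^ 2 - IZR 0 / 2)) with (RtoC 0) by ceq.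
    replace (IZR 0 * tau) with (RtoC 0) by ring.
    rewrite e2pi_0, laurent_ptheta_0 by auto. ring.
  - rewrite laurent_ptheta_period by auto. ring.
Qed.

Lemma sumZ_scal_r (c : C) (f : Z -> C) : abs_summable f ->
  sumZ (fun n => f n * c) = c * sumZ f.
Proof.
  intros H. rewrite <- (sumZ_scal c f H). apply sumZ_ext. intros n; ring.
Qed.

Lemma e2pi_neg_half : e2pi (- (1 / 2)) = - (1).
Proof. rewrite e2pi_opp, e2pi_half. field. Qed.

(* The odd Laurent coefficients vanish by the symmetry n -> 1 - n. *)
Lemma lattice_sum_even (tau : C) : (0 < Im tau)%R -> exists c : C, forall u,
  sumZ (fun n => e2pi (IZR n * (1 / 2 + tau / 2) + 2 * IZR n * u + tau * (IZR n ^ 2 - IZR n / 2))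
                 * laurent (ptheta tau) (u + IZR n * tau))
  = c * th (2 * tau) (2 * u + tau).
Proof.
  intros Ht. assert (HG := ptheta_decay tau Ht).
  set (d := 1 / 2 + tau / 2). set (L := lcoef tau d (ptheta tau)).
  exists (L 0%Z). intros u.
  assert (L1 : L 1%Z = 0).
  { assert (E : L 1%Z = - L 1%Z).
    { unfold L, lcoef.
      rewrite <- (sumZ_refl _ 1 (lcoef_summable tau d _ 1 Ht HG)) at 1.
      replace (- sumZ (lcoef_term tau d (ptheta tau) 1)) with
        ((-1) * sumZ (lcoef_term tau d (ptheta tau) 1)) by ring.
      rewrite <- sumZ_scal by now apply lcoef_summable.
      apply sumZ_ext. intros n. unfold lcoef_term.
      replace (1 - 2 * (1 - n))%Z with (- (1 - 2 * n))%Z by lia. rewrite ptheta_opp.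
      rewrite Cmult_assoc. f_equal.
      replace (RtoC (-1)) with (- RtoC 1) by ceq. rewrite <- e2pi_half, <- e2pi_plus.
      apply (e2pi_eq _ _ (- n)). unfold d. ceq. }
    replace (L 1%Z) with ((L 1%Z - - L 1%Z) / 2).
    - rewrite <- E. unfold Cdiv. ring.
    - field. }
  assert (Lodd : forall j, L (2 * j + 1)%Z = 0).
  { apply Z_step_ind; [exact L1| |]; intros j Hj.
    - replace (2 * (j + 1) + 1)%Z with (2 * j + 1 + 2)%Z by lia.
      unfold L. rewrite lcoef_step by auto. fold L. rewrite Hj. ring.
    - assert (S := lcoef_step tau d _ (2 * (j - 1) + 1) Ht HG). fold L in S.
      replace (2 * (j - 1) + 1 + 2)%Z with (2 * j + 1)%Z in S by lia. rewrite Hj in S.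
      destruct (Ceq_dec (L (2 * (j - 1) + 1)%Z) 0) as [h|h]; auto. exfalso.
      symmetry in S; revert S. apply Cmult_neq_0; auto using e2pi_neq_0. }
  (* The coefficients (-1)^j q^(j^2) of y^(2j) are those of [th (2 * tau) (2 * u + tau)]. *)
  assert (Leven : forall j, L (2 * j)%Z = e2pi (IZR j / 2 + tau * IZR j ^ 2) * L 0%Z).
  { assert (Q : forall j, L (2 * (j + 1))%Z = e2pi (1 / 2 + tau * (2 * IZR j + 1)) * L (2 * j)%Z).
    { intros j. replace (2 * (j + 1))%Z with (2 * j + 2)%Z by lia.
      unfold L. rewrite lcoef_step by auto. f_equal. f_equal. unfold d. ceq. }
    apply Z_step_ind.
    - simpl (2 * 0)%Z. replace (IZR 0 / 2 + tau * IZR 0 ^ 2) with (RtoC 0) by ceq.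
      rewrite e2pi_0. ring.
    - intros j Hj. rewrite Q, Hj, Cmult_assoc, <- e2pi_plus. f_equal. f_equal. ceq.
    - intros j Hj. specialize (Q (j - 1)%Z). replace (j - 1 + 1)%Z with j in Q by lia.
      rewrite Q in Hj. set (y := L (2 * (j - 1))%Z) in *.
      set (b := 1 / 2 + tau * (2 * IZR (j - 1) + 1)) in *.
      replace y with (e2pi (- b) * (e2pi b * y)).
      + rewrite Hj, Cmult_assoc, <- e2pi_plus. f_equal. f_equal. unfold b. ceq.
      + rewrite Cmult_assoc, <- e2pi_plus. replace (- b + b) with (RtoC 0) by ring.
        rewrite e2pi_0. ring. }
  destruct (lattice_sum_laurent tau d u _ Ht HG) as [_ E]. rewrite E. clear E. fold L.
  assert (HS : abs_summable (fun m => e2pi (IZR m * u) * L m)).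
  { destruct (lcoef_term_bound tau d u _ Ht HG) as [D [H [HD [HH K]]]].
    apply (abs_summable_ext (fun m => sumZ (fun n => e2pi (IZR m * u) * lcoef_term tau d (ptheta tau) m n))).
    - intros m. apply sumZ_scal. now apply lcoef_summable.
    - apply (abs_summable_sumZ _ H D); auto. intros m n. rewrite Rmult_comm. apply K. }
  rewrite (sumZ_even_odd _ HS).
  rewrite (sumZ_ext (fun n => e2pi (IZR (2 * n + 1) * u) * L (2 * n + 1)%Z) (fun _ => 0)).
  2:{ intros n. rewrite Lodd. ring. }
  rewrite sumZ_0, Cplus_0_r.
  unfold th. rewrite <- sumZ_scal_r.
  2:{ apply th_summable, Im_scal_pos; auto; lra. }
  apply sumZ_ext. intros j. rewrite Leven, Cmult_assoc, <- e2pi_plus.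
  f_equal. f_equal. unfold th_exp. ceq.
Qed.

(* Here the symmetry n -> - n identifies the Laurent coefficients 0 and 1. *)
Lemma lattice_sum_pair (tau : C) : (0 < Im tau)%R -> exists c : C, forall u,
  sumZ (fun n => e2pi (IZR n * 0 + 2 * IZR n * u + tau * (IZR n ^ 2 - IZR n / 2))
                 * laurent (fun k => ptheta tau k + ptheta tau (k - 1)) (u + IZR n * tau))
  = c * th (tau / 2) (u + 1 / 2).
Proof.
  intros Ht. assert (HG := ptheta_pair_decay tau Ht).
  set (G := fun k => ptheta tau k + ptheta tau (k - 1)) in *.
  set (L := lcoef tau 0 G).
  exists (L 0%Z). intros u.
  assert (L1 : L 1%Z = L 0%Z).
  { unfold L, lcoef. rewrite <- (sumZ_opp _ (lcoef_summable tau 0 _ 0 Ht HG)).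
    apply sumZ_ext. intros n. unfold lcoef_term. f_equal.
    - f_equal. ceq.
    - unfold G. rewrite <- (ptheta_opp tau (1 - 2 * n)), <- (ptheta_opp tau (1 - 2 * n - 1)).
      rewrite Cplus_comm. f_equal; f_equal; lia. }
  (* This solves c(m + 2) - c(m) = tau (m + 1/2) with c(0) = c(1) = 0; the q^(m(m-1)/4) are the
     coefficients of [th (tau / 2) (u + 1 / 2)]. *)
  set (c := fun m : Z => tau * (IZR m * (IZR m - 1) / 4)).
  assert (Lall : forall j, L (2 * j)%Z = e2pi (c (2 * j)%Z) * L 0%Z /\
                           L (2 * j + 1)%Z = e2pi (c (2 * j + 1)%Z) * L 0%Z).
  { assert (Q : forall m, L (m + 2)%Z = e2pi (c (m + 2)%Z - c m) * L m).
    { intros m. unfold L. rewrite lcoef_step by auto. f_equal. f_equal. unfold c. ceq. }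
    assert (Up : forall m, L m = e2pi (c m) * L 0%Z -> L (m + 2)%Z = e2pi (c (m + 2)%Z) * L 0%Z).
    { intros m Hm. rewrite Q, Hm, Cmult_assoc, <- e2pi_plus. f_equal. f_equal. ring. }
    assert (Dn : forall m, L (m + 2)%Z = e2pi (c (m + 2)%Z) * L 0%Z -> L m = e2pi (c m) * L 0%Z).
    { intros m Hm. rewrite Q in Hm. set (b := c (m + 2)%Z - c m) in *.
      replace (L m) with (e2pi (- b) * (e2pi b * L m)).
      + rewrite Hm, Cmult_assoc, <- e2pi_plus. f_equal. f_equal. unfold b. ring.
      + rewrite Cmult_assoc, <- e2pi_plus. replace (- b + b) with (RtoC 0) by ring.
        rewrite e2pi_0. ring. }
    apply Z_step_ind.
    - simpl (2 * 0)%Z. simpl (0 + 1)%Z. rewrite L1. unfold c. split.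
      + replace (tau * (IZR 0 * (IZR 0 - 1) / 4)) with (RtoC 0) by ceq. rewrite e2pi_0. ring.
      + replace (tau * (IZR 1 * (IZR 1 - 1) / 4)) with (RtoC 0) by ceq. rewrite e2pi_0. ring.
    - intros j [H1 H2]. apply Up in H1, H2. split.
      + now replace (2 * (j + 1))%Z with (2 * j + 2)%Z by lia.
      + now replace (2 * (j + 1) + 1)%Z with (2 * j + 1 + 2)%Z by lia.
    - intros j [H1 H2]. split; apply Dn.
      + now replace (2 * (j - 1) + 2)%Z with (2 * j)%Z by lia.
      + now replace (2 * (j - 1) + 1 + 2)%Z with (2 * j + 1)%Z by lia. }
  destruct (lattice_sum_laurent tau 0 u _ Ht HG) as [_ E]. rewrite E. clear E. fold L.
  unfold th. rewrite <- sumZ_scal_r.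
  2:{ apply th_summable. rewrite Im_div2; lra. }
  apply sumZ_ext. intros m.
  assert (Lm : L m = e2pi (c m) * L 0%Z).
  { destruct (Z.Even_or_Odd m) as [[j ->]|[j ->]]; [exact (proj1 (Lall j)) | exact (proj2 (Lall j))]. }
  rewrite Lm, Cmult_assoc, <- e2pi_plus. f_equal.
  symmetry. apply (e2pi_eq _ _ m). unfold th_exp, c. ceq.
Qed.

(** * Theta relations between the moduli tau/2, tau and 2 tau, and the constants *)

Lemma th_dup (tau u : C) : (0 < Im tau)%R ->
  qpoch tau 0 ^ 2 * th (2 * tau) (2 * u) = qpoch (2 * tau) 0 * (th tau u * th tau (u + 1 / 2)).
Proof.
  intros Ht. assert (Ht2 : (0 < Im (2 * tau))%R) by (apply Im_scal_pos; auto; lra).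
  rewrite !triple_product' by auto.
  rewrite <- (qpoch_dup tau u Ht).
  replace (- (2 * u)) with (2 * (- u)) by ring. rewrite <- (qpoch_dup tau (- u) Ht).
  replace (qpoch tau (- (u + 1 / 2))) with (qpoch tau (- u + 1 / 2)).
  2:{ apply qpoch_ext. intros n. apply (e2pi_eq _ _ 1). ceq. }
  replace (2 * u) with (u + u) by ring. rewrite !e2pi_plus, e2pi_half. ring.
Qed.

Lemma half_twice (tau : C) : 2 * (tau / 2) = tau.
Proof. ceq. Qed.

(** In the triple product of modulus tau/2, the factors with even exponent index form th at u and
    those with odd index form th at u + tau/2. *)
Lemma th_split (tau u : C) : (0 < Im tau)%R ->
  qpoch tau 0 ^ 2 * th (tau / 2) u = qpoch (tau / 2) 0 * (th tau u * th tau (u + tau / 2)).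
Proof.
  intros Ht. assert (Ht2 : (0 < Im (tau / 2))%R) by (rewrite Im_div2; lra).
  assert (S : forall v, qpoch (tau / 2) v = qpoch tau v * qpoch tau (v - tau / 2)).
  { intros v. rewrite (qpoch_split (tau / 2) v Ht2). now rewrite half_twice. }
  rewrite (triple_product' (tau / 2)), (triple_product' tau u), (triple_product tau) by auto.
  rewrite (S u), (S (- u)).
  replace (u + tau / 2 - tau) with (u - tau / 2) by ceq.
  replace (- (u + tau / 2)) with (- u - tau / 2) by ring. ring.
Qed.

Lemma Cmult_cancel (a b c : C) : c <> 0 -> c * a = c * b -> a = b.
Proof.
  intros Hc H. replace a with (/ c * (c * a)) by (field; auto). rewrite H. field; auto.
Qed.

Lemma RtoC_neq_0 (x : R) : x <> 0%R -> RtoC x <> 0.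
Proof. intros H E. apply H. now injection E. Qed.

(* qpoch (2 tau) (- tau) is the product of the (1 - q^(2n-1)). *)
Lemma qpoch_0_split (tau : C) : (0 < Im tau)%R ->
  qpoch tau 0 = qpoch (2 * tau) 0 * qpoch (2 * tau) (- tau).
Proof.
  intros Ht. rewrite qpoch_split by auto. f_equal. f_equal. ring.
Qed.

(** The value at u = 0 of the theta function in [lattice_sum_even], against which its constant is
    normalised; [th_half_half] does the same for [lattice_sum_pair]. *)
Lemma th_2tau_tau (tau : C) : (0 < Im tau)%R ->
  qpoch (2 * tau) 0 * th (2 * tau) tau = qpoch tau 0 ^ 2.
Proof.
  intros Ht. assert (Ht2 : (0 < Im (2 * tau))%R) by (apply Im_scal_pos; auto; lra).
  rewrite triple_product, (qpoch_0_split tau) by auto.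
  replace (tau - 2 * tau) with (- tau) by ceq. ring.
Qed.

Lemma th_half_half (tau : C) : (0 < Im tau)%R ->
  qpoch (tau / 2) 0 * th (tau / 2) (1 / 2) = 2 * qpoch tau 0 ^ 2.
Proof.
  intros Ht. assert (Ht2 : (0 < Im (tau / 2))%R) by (rewrite Im_div2; lra).
  rewrite triple_product', e2pi_half by auto.
  replace (qpoch (tau / 2) (- (1 / 2))) with (qpoch (tau / 2) (0 + 1 / 2)).
  2:{ apply qpoch_ext. intros n. apply (e2pi_eq _ _ 1). ceq. }
  replace (qpoch (tau / 2) (1 / 2)) with (qpoch (tau / 2) (0 + 1 / 2)) by (f_equal; ring).
  replace (qpoch tau 0) with (qpoch (tau / 2) 0 * qpoch (tau / 2) (0 + 1 / 2)).
  - replace (1 - - (1)) with (RtoC 2) by ceq. ring.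
  - rewrite qpoch_dup by auto. rewrite half_twice. f_equal. ring.
Qed.

Lemma lattice_sum_even_eval (tau u : C) : (0 < Im tau)%R ->
  sumZ (fun n => e2pi (IZR n * (1 / 2 + tau / 2) + 2 * IZR n * u + tau * (IZR n ^ 2 - IZR n / 2))
                 * laurent (ptheta tau) (u + IZR n * tau))
  = qpoch tau 0 * qpoch (2 * tau) 0 * th (2 * tau) (2 * u + tau).
Proof.
  intros Ht. destruct (lattice_sum_even tau Ht) as [c Hc]. rewrite Hc. f_equal.
  assert (H0 := lattice_sum_at_0 tau (1 / 2 + tau / 2) (fun _ => 1) Ht).
  rewrite (sumZ_ext _ (fun n => e2pi (IZR n * (1 / 2 + tau / 2) + 2 * IZR n * 0
     + tau * (IZR n ^ 2 - IZR n / 2)) * laurent (ptheta tau) (0 + IZR n * tau))), Hc in H0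
    by (intros n; ring).
  replace (2 * 0 + tau) with tau in H0 by ring.
  assert (N := qpoch_0_neq_0 tau Ht).
  apply (Cmult_cancel _ _ (qpoch tau 0 ^ 2)).
  { simpl. repeat apply Cmult_neq_0; auto. apply C1_nz. }
  rewrite <- (th_2tau_tau tau Ht) at 1.
  replace (qpoch (2 * tau) 0 * th (2 * tau) tau * c)
    with (qpoch (2 * tau) 0 * (c * th (2 * tau) tau)) by ring.
  rewrite H0. ring.
Qed.

Lemma lattice_sum_pair_eval (tau u : C) : (0 < Im tau)%R ->
  sumZ (fun n => e2pi (IZR n * 0 + 2 * IZR n * u + tau * (IZR n ^ 2 - IZR n / 2))
                 * ((1 + e2pi (u + IZR n * tau)) * laurent (ptheta tau) (u + IZR n * tau)))
  = qpoch tau 0 * qpoch (tau / 2) 0 * th (tau / 2) (u + 1 / 2).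
Proof.
  intros Ht. destruct (lattice_sum_pair tau Ht) as [c Hc].
  assert (Hc' : forall u, sumZ (fun n => e2pi (IZR n * 0 + 2 * IZR n * u + tau * (IZR n ^ 2 - IZR n / 2))
                 * ((1 + e2pi (u + IZR n * tau)) * laurent (ptheta tau) (u + IZR n * tau)))
     = c * th (tau / 2) (u + 1 / 2)).
  { intros v. rewrite <- Hc. apply sumZ_ext. intros n. now rewrite laurent_ptheta_pair. }
  rewrite Hc'. f_equal.
  assert (H0 := lattice_sum_at_0 tau 0 (fun x => 1 + x) Ht).
  rewrite Hc' in H0. rewrite Cplus_0_l in H0.
  assert (N := qpoch_0_neq_0 tau Ht).
  apply (Cmult_cancel _ _ (2 * qpoch tau 0 ^ 2)).
  { simpl. repeat apply Cmult_neq_0; auto; [apply RtoC_neq_0; lra | apply C1_nz]. }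
  rewrite <- (th_half_half tau Ht) at 1.
  replace (qpoch (tau / 2) 0 * th (tau / 2) (1 / 2) * c)
    with (qpoch (tau / 2) 0 * (c * th (tau / 2) (1 / 2))) by ring.
  rewrite H0. replace (1 + 1) with (RtoC 2) by ceq. ring.
Qed.

Lemma appell_even (tau u : C) : (0 < Im tau)%R -> th tau u <> 0 ->
  th tau u * sumZ (appell_term tau (u + tau / 2) u)
  = qpoch tau 0 * qpoch (2 * tau) 0 * th (2 * tau) (2 * u + tau).
Proof.
  intros Ht Hu. rewrite <- sumZ_scal by now apply appell_summable.
  rewrite <- lattice_sum_even_eval by auto. apply sumZ_ext. intros n.
  rewrite th_appell_term by auto. f_equal. f_equal. ring.
Qed.

Definition appell_pair_term (tau al u : C) (n : Z) : C :=
  appell_term tau al u n * (1 + e2pi (u + IZR n * tau)).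

Lemma appell_pair_term_eq (tau al u : C) (n : Z) :
  appell_pair_term tau al u n = appell_term tau al u n + e2pi u * appell_term tau (al + tau) u n.
Proof.
  unfold appell_pair_term, appell_term.
  replace (IZR n * (al + tau) + tau * IZR n ^ 2 / 2)
    with ((IZR n * al + tau * IZR n ^ 2 / 2) + IZR n * tau) by ring.
  rewrite (e2pi_plus u), (e2pi_plus (IZR n * al + _)). unfold Cdiv. ring.
Qed.

Lemma appell_pair_summable (tau al u : C) : (0 < Im tau)%R -> th tau u <> 0 ->
  abs_summable (appell_pair_term tau al u).
Proof.
  intros Ht Hu. eapply abs_summable_ext.
  - intros n. symmetry. apply appell_pair_term_eq.
  - apply abs_summable_plus; [| apply abs_summable_scal]; now apply appell_summable.
Qed.

Lemma appell_pair (tau u : C) : (0 < Im tau)%R -> th tau u <> 0 ->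
  th tau u * sumZ (appell_pair_term tau (u + 1 / 2) u)
  = qpoch tau 0 * qpoch (tau / 2) 0 * th (tau / 2) (u + 1 / 2).
Proof.
  intros Ht Hu. rewrite <- sumZ_scal by now apply appell_pair_summable.
  rewrite <- lattice_sum_pair_eval by auto. apply sumZ_ext. intros n.
  unfold appell_pair_term. rewrite Cmult_assoc, th_appell_term by auto.
  rewrite (Cmult_comm (1 + _)), Cmult_assoc. f_equal. f_equal.
  (* With al = u + 1/2 the parameter of the lattice sum is 1, which acts like 0 on integral n. *)
  apply (e2pi_eq _ _ n). ceq.
Qed.

(** * The correction term *)

Local Open Scope R_scope.

Ltac R_eq := match goal with |- @eq _ ?a ?b => change (@eq R a b) end.

Definition gauss (t : R) : R := exp (- (PI * t ^ 2)).

Lemma continuous_gauss (t : R) : continuous gauss t.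
Proof. apply (ex_derive_continuous (V := R_NormedModule)). unfold gauss. auto_derive. trivial. Qed.

Lemma ex_RInt_gauss (a b : R) : ex_RInt gauss a b.
Proof. apply (ex_RInt_continuous (V := R_CompleteNormedModule)). intros; apply continuous_gauss. Qed.

Definition gauss_int (x : R) : R := RInt gauss 0 x.

Lemma is_derive_gauss_int (x : R) : is_derive gauss_int x (gauss x).
Proof.
  apply (is_derive_RInt gauss gauss_int 0 x); [| apply continuous_gauss].
  apply filter_forall. intros y. apply (RInt_correct (V := R_CompleteNormedModule)).
  apply ex_RInt_gauss.
Qed.

(* The integral of [aux_f x] over [0,1] has x-derivative minus PI times that of
   [gauss_int x ^ 2]. *)
Definition aux_f (x t : R) : R := exp (- (PI * x ^ 2 * (1 + t ^ 2))) / (1 + t ^ 2).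

Lemma one_plus_sqr_pos (t : R) : 0 < 1 + t ^ 2.
Proof. assert (H := pow2_ge_0 t). lra. Qed.

Lemma is_derive_aux_f (x t : R) :
  is_derive (fun u => aux_f u t) x (- (2 * PI * x) * exp (- (PI * x ^ 2 * (1 + t ^ 2)))).
Proof.
  assert (H := one_plus_sqr_pos t). unfold aux_f. auto_derive; [trivial|].
  change (t * (t * 1)) with (t ^ 2). change (x * (x * 1)) with (x ^ 2). field. lra.
Qed.

Lemma ex_RInt_aux_f (x a b : R) : ex_RInt (aux_f x) a b.
Proof.
  apply (ex_RInt_continuous (V := R_CompleteNormedModule)). intros t _.
  apply (ex_derive_continuous (V := R_NormedModule)).
  assert (H := one_plus_sqr_pos t). unfold aux_f. auto_derive. lra.
Qed.

Definition aux_int (x : R) : R := RInt (aux_f x) 0 1.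

(** Differentiation under the integral sign cancels the denominator 1 + t^2; the substitution of x t
    for the variable then turns the rest into gauss x * gauss_int x. *)
Lemma is_derive_aux_int (x : R) :
  is_derive aux_int x (- (2 * PI) * (gauss x * gauss_int x)).
Proof.
  assert (E : RInt (fun t => Derive (fun u => aux_f u t) x) 0 1
     = - (2 * PI) * (gauss x * gauss_int x)).
  { rewrite (RInt_ext _ (fun t => (- (2 * PI) * gauss x) * (x * gauss (x * t + 0)))).
    2:{ intros t _. etransitivity; [apply is_derive_unique, is_derive_aux_f|].
        unfold gauss.
        replace (- (PI * x ^ 2 * (1 + t ^ 2))) with (- (PI * x ^ 2) + - (PI * (x * t + 0) ^ 2)) by ring.
        rewrite exp_plus. R_eq. ring. }
    assert (E2 := RInt_comp_lin (V := R_CompleteNormedModule) gauss x 0 0 1 (ex_RInt_gauss _ _)).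
    unfold scal in E2; simpl in E2; unfold mult in E2; simpl in E2.
    rewrite Rmult_0_r, Rplus_0_l, Rmult_1_r, Rplus_0_r in E2.
    fold (gauss_int x) in E2. rewrite <- E2.
    rewrite <- Rmult_assoc.
    apply (RInt_scal (V := R_CompleteNormedModule) (fun t => x * gauss (x * t + 0))).
    apply (ex_RInt_continuous (V := R_CompleteNormedModule)). intros t _.
    apply (ex_derive_continuous (V := R_NormedModule)). unfold gauss. auto_derive. trivial. }
  rewrite <- E. apply is_derive_RInt_param.
  - apply filter_forall. intros y t _. eexists. apply is_derive_aux_f.
  - intros t _.
    apply (continuity_2d_pt_ext (fun u v => (- (2 * PI * u)) * exp (- (PI * (u * u) * (1 + v * v))))).
    { intros u v. symmetry. etransitivity; [apply is_derive_unique, is_derive_aux_f|].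
      f_equal. f_equal. ring. }
    apply continuity_2d_pt_mult.
    + apply continuity_2d_pt_opp, continuity_2d_pt_mult;
        [apply continuity_2d_pt_const | apply continuity_2d_pt_id1].
    + apply (continuity_1d_2d_pt_comp exp).
      { apply derivable_continuous_pt, derivable_pt_exp. }
      apply continuity_2d_pt_opp.
      repeat first [apply continuity_2d_pt_mult | apply continuity_2d_pt_plus
        | apply continuity_2d_pt_const | apply continuity_2d_pt_id1 | apply continuity_2d_pt_id2].
  - apply filter_forall. intros y. apply ex_RInt_aux_f.
Qed.

Lemma RInt_inv_one_plus_sqr : RInt (fun t => / (1 + t ^ 2)) 0 1 = PI / 4.
Proof.
  apply is_RInt_unique. replace (PI / 4) with (minus (atan 1) (atan 0)).
  - apply (is_RInt_derive (V := R_CompleteNormedModule) atan).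
    + intros t _. replace (1 + t ^ 2) with (1 + t²) by (unfold Rsqr; ring). apply is_derive_atan.
    + intros t _. apply (ex_derive_continuous (V := R_NormedModule)).
      assert (H := one_plus_sqr_pos t). auto_derive. lra.
  - rewrite atan_1, atan_0. unfold minus, plus, opp; simpl. ring.
Qed.

(** The two derivatives cancel, so the sum keeps its value at x = 0, an arctangent integral. This is
    a one-variable evaluation of the Gaussian integral, with the error term explicit. *)
Lemma gauss_int_sqr (x : R) : 0 <= x -> aux_int x + PI * gauss_int x ^ 2 = PI / 4.
Proof.
  intros Hx.
  assert (H0 : aux_int 0 + PI * gauss_int 0 ^ 2 = PI / 4).
  { unfold gauss_int. rewrite RInt_point. unfold zero; simpl.
    rewrite Rmult_0_l, Rmult_0_r, Rplus_0_r.
    rewrite <- RInt_inv_one_plus_sqr. apply RInt_ext. intros t _. unfold aux_f.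
    replace (- (PI * 0 ^ 2 * (1 + t ^ 2))) with 0 by ring. rewrite exp_0.
    R_eq. unfold Rdiv; ring. }
  destruct Hx as [Hx| <-]; [| exact H0]. rewrite <- H0. symmetry.
  apply (eq_is_derive (V := R_NormedModule) (fun x => aux_int x + PI * gauss_int x ^ 2) 0 x); auto.
  intros t _.
  evar_last.
  - apply (is_derive_plus (V := R_NormedModule)); [apply is_derive_aux_int|].
    apply (is_derive_scal (fun x => gauss_int x ^ 2)).
    apply (is_derive_pow gauss_int 2). apply is_derive_gauss_int.
  - unfold plus, zero, mult; simpl. ring.
Qed.

Lemma aux_int_bound (x : R) : 0 <= aux_int x <= gauss x * (PI / 4).
Proof.
  assert (P : forall t, 0 < / (1 + t ^ 2)) by (intros; apply Rinv_0_lt_compat, one_plus_sqr_pos).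
  split.
  - apply RInt_ge_0; [lra | apply ex_RInt_aux_f |]. intros t _. unfold aux_f.
    apply Rmult_le_pos; apply Rlt_le; [apply exp_pos | apply P].
  - rewrite <- RInt_inv_one_plus_sqr.
    assert (Hex : ex_RInt (fun t => / (1 + t ^ 2)) 0 1).
    { apply (ex_RInt_continuous (V := R_CompleteNormedModule)). intros t _.
      apply (ex_derive_continuous (V := R_NormedModule)).
      assert (H := one_plus_sqr_pos t). auto_derive. lra. }
    apply Rle_trans with (RInt (fun t => gauss x * / (1 + t ^ 2)) 0 1).
    + apply RInt_le; [lra | apply ex_RInt_aux_f | |].
      * apply (ex_RInt_scal (V := R_NormedModule) (fun t => / (1 + t ^ 2)) 0 1 (gauss x) Hex).
      * intros t _. unfold aux_f.
        apply Rmult_le_compat_r; [apply Rlt_le, P|].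
        apply exp_le. assert (Q := PI_RGT_0). assert (H := pow2_ge_0 t). assert (H2 := pow2_ge_0 x).
        assert (0 <= PI * (x ^ 2 * t ^ 2)) by (apply Rmult_le_pos; [lra | nra]). nra.
    + apply Req_le.
      apply (RInt_scal (V := R_CompleteNormedModule) (fun t => / (1 + t ^ 2)) 0 1 (gauss x) Hex).
Qed.

(** Dividing [gauss_int_sqr] by pi/4 places E^2 between 1 - exp(-pi x^2) and 1; as 0 <= E <= 1, also
    1 - E <= 1 - E^2. The decay is needed to beat the growing exponentials in R. *)
Lemma Efun_bound (x : R) : 0 <= x -> 0 <= 1 - Efun x <= exp (- (PI * x ^ 2)).
Proof.
  intros Hx. change (Efun x) with (2 * gauss_int x). change (exp (- (PI * x ^ 2))) with (gauss x).
  assert (H1 := gauss_int_sqr x Hx). destruct (aux_int_bound x) as [H2 H3].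
  assert (P := PI_RGT_0).
  assert (H0 : 0 <= gauss_int x).
  { apply RInt_ge_0; auto using ex_RInt_gauss. intros t _. apply Rlt_le, exp_pos. }
  assert (H4 : 4 * gauss_int x ^ 2 <= 1) by nra.
  assert (H5 : 1 - gauss x <= 4 * gauss_int x ^ 2) by nra.
  assert (H6 : 2 * gauss_int x <= 1) by nra.
  split; [lra|]. nra.
Qed.

Lemma Efun_opp (x : R) : Efun (- x) = - Efun x.
Proof.
  change (2 * gauss_int (- x) = - (2 * gauss_int x)).
  assert (E2 := RInt_comp_lin (V := R_CompleteNormedModule) gauss (-1) 0 0 x (ex_RInt_gauss _ _)).
  unfold scal in E2; simpl in E2; unfold mult in E2; simpl in E2.
  replace (-1 * 0 + 0) with 0 in E2 by ring. replace (-1 * x + 0) with (- x) in E2 by ring.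
  fold (gauss_int (- x)) in E2. rewrite <- E2.
  rewrite (RInt_ext _ (fun t => opp (gauss t))).
  - rewrite (RInt_opp (V := R_CompleteNormedModule)) by apply ex_RInt_gauss.
    unfold opp; simpl. unfold gauss_int. ring.
  - intros t _. unfold opp; simpl. unfold gauss.
    replace ((-1 * t + 0) ^ 2) with (t ^ 2) by ring. R_eq. ring.
Qed.

Lemma Efun_0 : Efun 0 = 0.
Proof. unfold Efun. rewrite RInt_point. unfold zero; simpl. ring. Qed.

Lemma sign_pos (x : R) : 0 < x -> sign x = 1.
Proof. apply sign_eq_1. Qed.

Lemma sign_neg (x : R) : x < 0 -> sign x = -1.
Proof. apply sign_eq_m1. Qed.

Local Open Scope C_scope.

(** Adding the series to its reflection leaves twice the central term. *)
Lemma sumZ_antisym (f : Z -> C) : abs_summable f ->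
  (forall l, l <> 0%Z -> f (- l)%Z = - f l) -> sumZ f = f 0%Z.
Proof.
  intros Hf Ho.
  destruct (sumZ_delta 0 (2 * f 0%Z)) as [_ D].
  assert (E : sumZ f + sumZ (fun n => f (- n)%Z) = 2 * f 0%Z).
  { rewrite <- sumZ_plus; auto using abs_summable_opp. rewrite <- D.
    apply sumZ_ext. intros n. destruct (Z.eqb_spec n 0) as [->|H].
    - simpl. replace (RtoC 2) with (1 + 1) by ceq. ring.
    - rewrite Ho by exact H. ring. }
  rewrite sumZ_opp in E by auto.
  apply (Cmult_cancel _ _ 2); [apply RtoC_neq_0; lra|].
  rewrite <- E. replace (RtoC 2) with (1 + 1) by ceq. ring.
Qed.

(** The reflection n -> -1 - n exchanges the two series that make up [sumZ], so these are opposite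
    to each other. *)
Lemma sumZ_antisym' (f : Z -> C) :
  (forall n : nat, f (- Z.of_nat (S n))%Z = - f (Z.of_nat n)) -> sumZ f = 0.
Proof.
  intros H. unfold sumZ, CSeries.
  rewrite (Series_ext (fun n => Re (f (- Z.of_nat (S n))%Z)) (fun n => - Re (f (Z.of_nat n)))%R),
    (Series_ext (fun n => Im (f (- Z.of_nat (S n))%Z)) (fun n => - Im (f (Z.of_nat n)))%R).
  2,3: intros n; rewrite H; reflexivity.
  rewrite !Series_opp. apply injective_projections; simpl; ring.
Qed.

(* For w = tau/2 + c with c real, Im w / Im (2 tau) = 1/4, so the arguments of E are odd
   under n -> 1 - n and the nonholomorphic parts of R_{1/2;1} and R_{3/2;1} cancel in pairs. *)
Lemma Rcorr_eq (tau : C) (j c : R) (f : Z -> C) : (0 < Im tau)%R ->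
  (forall l, f l = RtoC (sign (2 * IZR l + 3 / 2)
       - Efun ((j - 1 / 2 + 2 * IZR l) * sqrt (2 * Im tau)))
     * e2pi (tau / 8 - tau * (j - 1 / 2 + 2 * IZR l) ^ 2 / 2 + (j + 2 * IZR l) * c)) ->
  Rcorr j 2 (2 * tau) (tau / 2 + c) = sumZ f.
Proof.
  intros Ht Hf. unfold Rcorr. apply sumZ_ext. intros l. rewrite Hf. f_equal.
  - f_equal.
    replace (j + 2 * (INR 2 / 2) * IZR l - 1 / 2 - j + 2 * (INR 2 / 2))%R
      with (2 * IZR l + 3 / 2)%R by (simpl (INR 2); field).
    replace (Im (tau / 2 + c) / Im (2 * tau))%R with (1 / 4)%R.
    + replace (Im (2 * tau) / (INR 2 / 2))%R with (2 * Im tau)%R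
        by (destruct tau; unfold Im; simpl; field).
      f_equal. f_equal. f_equal. simpl (INR 2). field.
    + destruct tau as [a b]. unfold Im in *; simpl in *. field. lra.
  - unfold e2pi. f_equal. simpl (INR 2). ceq.
Qed.

(** For j = 1/2 the argument of E is proportional to 2l, so the terms l and -l cancel. The central
    term survives, with sign 1 and E(0) = 0. *)
Lemma Rcorr_half (tau : C) (c : R) (k : Z) : (0 < Im tau)%R -> (2 * c = IZR k)%R ->
  Rcorr (1 / 2) 2 (2 * tau) (tau / 2 + c) = e2pi (tau / 8 + c / 2).
Proof.
  intros Ht Hc.
  set (phi := fun l : Z => (sign (2 * IZR l + 3 / 2)
    - Efun (2 * IZR l * sqrt (2 * Im tau)))%R).
  set (f := fun l : Z => RtoC (phi l) * e2pi (tau / 8 + c / 2 + - (2 * tau * IZR l ^ 2))).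
  rewrite (Rcorr_eq tau _ c f Ht).
  2:{ intros l. unfold f, phi. f_equal.
      - f_equal. f_equal. f_equal. ring.
      (* The phase 2 l c = k l is an integer because c is half-integral. *)
      - symmetry. apply (e2pi_eq _ _ (k * l)).
        rewrite mult_IZR, <- Hc. ceq. }
  assert (sq : (0 < sqrt (2 * Im tau))%R) by (apply sqrt_lt_R0; lra).
  assert (sq2 : (sqrt (2 * Im tau) ^ 2 = 2 * Im tau)%R) by (apply pow2_sqrt; lra).
  assert (Hpos : forall l, (0 < l)%Z -> (1 <= IZR l)%R) by (intros l H; apply (IZR_le 1); lia).
  assert (Ho : forall l, (0 < l)%Z -> phi (- l)%Z = (- phi l)%R).
  { intros l Hl. specialize (Hpos l Hl). unfold phi. rewrite opp_IZR.
    rewrite (sign_pos (2 * IZR l + 3 / 2)), (sign_neg (2 * - IZR l + 3 / 2)) by lra.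
    replace (2 * - IZR l * sqrt (2 * Im tau))%R with (- (2 * IZR l * sqrt (2 * Im tau)))%R by ring.
    rewrite Efun_opp. ring. }
  assert (H0 : phi 0%Z = 1%R).
  { unfold phi. rewrite sign_pos by lra. rewrite Rmult_0_r, Rmult_0_l, Efun_0. ring. }
  (* The exponential factor grows like exp(4 pi Im tau l^2), so a Gaussian decay with 4 pi Im tau
     remains. *)
  assert (Hb : forall l, (0 <= l)%Z -> (Rabs (phi l) <= exp (- (8 * PI * Im tau * IZR l ^ 2)))%R).
  { intros l Hl. assert (Hl' : (0 <= IZR l)%R) by (apply (IZR_le 0); lia).
    unfold phi. rewrite sign_pos by lra.
    destruct (Efun_bound (2 * IZR l * sqrt (2 * Im tau))) as [B1 B2].
    { repeat apply Rmult_le_pos; lra. }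
    rewrite Rabs_pos_eq by exact B1. eapply Rle_trans; [exact B2|]. apply Req_le. f_equal.
    rewrite !Rpow_mult_distr, sq2. ring. }
  assert (Hb' : forall l, (Rabs (phi l) <= exp (- (8 * PI * Im tau * IZR l ^ 2)))%R).
  { intros l. destruct (Z_le_gt_dec 0 l); auto.
    replace l with (- - l)%Z by lia. rewrite Ho by lia. rewrite Rabs_Ropp.
    replace (IZR (- - l) ^ 2)%R with (IZR (- l) ^ 2)%R by (rewrite !opp_IZR; ring).
    apply Hb. lia. }
  rewrite sumZ_antisym.
  - unfold f. rewrite H0. replace (tau / 8 + c / 2 + - (2 * tau * IZR 0 ^ 2)) with (tau / 8 + c / 2) by ceq.
    ring.
  - set (K := (- (2 * PI * Im (tau / 8 + c / 2)))%R).
    apply (abs_summable_le _ (fun n => exp (- (4 * PI * Im tau * IZR n ^ 2) + 0 * Rabs (IZR n) + K))%R).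
    2:{ apply summable_gauss. assert (P := PI_RGT_0). nra. }
    intros l. unfold f. rewrite Cmod_mult, Cmod_R, Cmod_e2pi.
    eapply Rle_trans; [apply Rmult_le_compat_r; [apply Rlt_le, exp_pos | apply Hb']|].
    rewrite <- exp_plus. apply exp_le. apply Req_le. unfold K.
    destruct tau as [a b]. unfold Im; simpl. field.
  - intros l Hl. unfold f.
    replace (RtoC (IZR (- l)) ^ 2) with (RtoC (IZR l) ^ 2) by (rewrite opp_IZR; ceq).
    destruct (Z_le_gt_dec l 0).
    + replace (phi l) with (- phi (- l)%Z)%R; [rewrite RtoC_opp; ring|].
      rewrite <- Ho by lia. f_equal. lia.
    + rewrite Ho by lia. rewrite RtoC_opp. ring.
Qed.

(** For j = 3/2 the argument of E is proportional to 2l + 1. The reflection is now l -> -1 - l,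
    which has no fixed point, so nothing survives. *)
Lemma Rcorr_three_halves (tau : C) (c : R) (k : Z) : (0 < Im tau)%R -> (2 * c = IZR k)%R ->
  Rcorr (1 / 2 + 1) 2 (2 * tau) (tau / 2 + c) = 0.
Proof.
  intros Ht Hc.
  set (f := fun l : Z => RtoC (sign (2 * IZR l + 3 / 2)
    - Efun ((2 * IZR l + 1) * sqrt (2 * Im tau)))
    * e2pi (tau / 8 + 3 / 2 * c + - (tau * (2 * IZR l + 1) ^ 2 / 2))).
  rewrite (Rcorr_eq tau _ c f Ht).
  2:{ intros l. unfold f. f_equal.
      - f_equal. f_equal. f_equal. f_equal. field.
      - symmetry. apply (e2pi_eq _ _ (k * l)).
        rewrite mult_IZR, <- Hc. ceq. }
  apply sumZ_antisym'. intros n. unfold f.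
  assert (Hn := pos_INR n). rewrite opp_IZR, <- !INR_IZR_INZ, S_INR.
  rewrite (sign_pos (2 * INR n + 3 / 2)), (sign_neg (2 * - (INR n + 1) + 3 / 2)) by lra.
  replace ((2 * - (INR n + 1) + 1) * sqrt (2 * Im tau))%R
    with (- ((2 * INR n + 1) * sqrt (2 * Im tau)))%R by ring.
  rewrite Efun_opp.
  match goal with |- RtoC ?x * e2pi ?a = - (RtoC ?y * e2pi ?b) =>
    replace x with (- y)%R by ring; replace a with b by ceq end.
  rewrite RtoC_opp. ring.
Qed.

(** * Eta and Mumford's theta functions in terms of qpoch and th *)

Lemma eta_qpoch (tau : C) : eta tau = e2pi (tau / 24) * qpoch tau 0.
Proof.
  unfold eta, qpoch, CLim_seq. f_equal.
  f_equal; f_equal; apply Lim_seq_ext; intros N; f_equal; apply prodC_ext;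
    intros n; now rewrite Cplus_0_r.
Qed.

Lemma th_ext (tau u v : C) (k : Z) : u = v + IZR k -> th tau u = th tau v.
Proof.
  intros ->. apply sumZ_ext. intros n. apply (e2pi_eq _ _ (n * k)). ceq.
Qed.

Lemma th_succ (tau : C) (u : C) : th (tau + 1) u = th tau u.
Proof.
  apply sumZ_ext. intros n. destruct (half_square_int n) as [k Hk].
  apply (e2pi_eq _ _ k). unfold th_exp.
  replace (IZR n * (IZR n - 1) / 2) with (RtoC (IZR k)); [ring|].
  apply injective_projections; simpl; [|field]. 
  replace (IZR k) with ((IZR n * IZR n - IZR n) / 2)%R by (rewrite Hk; field). field.
Qed.

Lemma qpoch_succ (tau u : C) : qpoch (tau + 1) u = qpoch tau u.
Proof.
  apply qpoch_ext. intros n. apply (e2pi_eq _ _ (Z.of_nat n)).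
  rewrite <- INR_IZR_INZ. ring.
Qed.

Lemma th_plus_tau (tau u : C) : (0 < Im tau)%R -> th tau u = - e2pi u * th tau (u + tau).
Proof.
  intros Ht. rewrite <- (th_quasi tau u 1 Ht).
  replace (IZR 1 * tau) with tau by ring.
  replace (th_exp tau 1 + IZR 1 * u) with (1 / 2 + u) by (unfold th_exp; ceq).
  rewrite e2pi_plus, e2pi_half. ring.
Qed.

Lemma vartheta_00 (tau z : C) : vartheta 0 0 tau z = th tau (z + tau / 2 + 1 / 2).
Proof.
  apply sumZ_ext. intros n. symmetry.
  rewrite (e2pi_eq _ (tau * IZR n ^ 2 / 2 + IZR n * z) n) by (unfold th_exp; ceq).
  unfold e2pi. f_equal. simpl (INR 0). ceq.
Qed.

Lemma vartheta_01 (tau z : C) : vartheta 0 1 tau z = th tau (z + tau / 2).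
Proof.
  apply sumZ_ext. intros n. symmetry.
  replace (th_exp tau n + IZR n * (z + tau / 2)) with (tau * IZR n ^ 2 / 2 + IZR n * (z + 1 / 2))
    by (unfold th_exp; ceq).
  unfold e2pi. f_equal. simpl (INR 0). simpl (INR 1). ceq.
Qed.

Lemma vartheta_10 (tau z : C) : (0 < Im tau)%R ->
  vartheta 1 0 tau z = e2pi (tau / 8 - z / 2) * th tau (z + 1 / 2).
Proof.
  intros Ht. unfold th. rewrite <- (sumZ_shift _ 1 (th_summable tau _ Ht)).
  rewrite <- sumZ_scal by apply (abs_summable_shift _ 1 (th_summable tau _ Ht)).
  apply sumZ_ext. intros n. symmetry. rewrite <- e2pi_plus.
  rewrite (e2pi_eq _ (tau * (IZR n + 1 / 2) ^ 2 / 2 + (IZR n + 1 / 2) * z) (n + 1))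
    by (unfold th_exp; ceq).
  unfold e2pi. f_equal. simpl (INR 0). simpl (INR 1). ceq.
Qed.

Lemma vartheta_11 (tau z : C) : (0 < Im tau)%R ->
  vartheta 1 1 tau z = - Ci * (e2pi (tau / 8 - z / 2) * th tau z).
Proof.
  intros Ht.
  replace (- Ci) with (e2pi (1 / 4 + 1 / 2)) by (rewrite e2pi_plus, e2pi_quarter, e2pi_half; ring).
  rewrite Cmult_assoc, <- e2pi_plus.
  unfold th. rewrite <- (sumZ_shift _ 1 (th_summable tau _ Ht)).
  rewrite <- sumZ_scal by apply (abs_summable_shift _ 1 (th_summable tau _ Ht)).
  apply sumZ_ext. intros n. symmetry. rewrite <- e2pi_plus.
  rewrite (e2pi_eq _ (tau * (IZR n + 1 / 2) ^ 2 / 2 + (IZR n + 1 / 2) * (z + 1 / 2)) 1)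
    by (unfold th_exp; ceq).
  unfold e2pi. f_equal. simpl (INR 1). ceq.
Qed.

(** The products over 1 - (-1)^n q^(n/2) and 1 - q^(n/2) agree at even n; at odd n their factors
    multiply to 1 - q^n, giving [qpoch tau 0 / qpoch (2 * tau) 0]. *)
Lemma qpoch_half_shift (tau : C) : (0 < Im tau)%R ->
  qpoch ((tau + 1) / 2) 0 * qpoch (tau / 2) 0 * qpoch (2 * tau) 0 = qpoch tau 0 ^ 3.
Proof.
  intros Ht.
  assert (Ht' : (0 < Im (tau + 1))%R) by (destruct tau; unfold Im in *; simpl in *; lra).
  rewrite (qpoch_split ((tau + 1) / 2)), (qpoch_split (tau / 2)) by (rewrite Im_div2; lra).
  rewrite !half_twice, !qpoch_succ.
  replace (qpoch tau (0 - (tau + 1) / 2)) with (qpoch tau ((0 - tau / 2) + 1 / 2)).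
  2:{ apply qpoch_ext. intros n. apply (e2pi_eq _ _ 1). ceq. }
  assert (D := qpoch_dup tau (0 - tau / 2) Ht).
  replace (2 * (0 - tau / 2)) with (- tau) in D by ceq.
  assert (S := qpoch_0_split tau Ht). rewrite <- D in S.
  replace (qpoch tau 0 ^ 3) with (qpoch tau 0 * qpoch tau 0 * qpoch tau 0) by (simpl; ring).
  rewrite S at 5. ring.
Qed.

(** Factoring the theta function of modulus tau/2 by [th_split] leaves only modulus tau, as in the
    character denominators. *)
Lemma appell_pair_minus (tau u : C) : (0 < Im tau)%R -> th tau u <> 0 ->
  qpoch tau 0 * (th tau u * sumZ (appell_pair_term tau (u + 1 / 2) u))
  = qpoch (tau / 2) 0 ^ 2 * (th tau (u + 1 / 2) * th tau (u + 1 / 2 + tau / 2)).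
Proof.
  intros Ht Hu. rewrite appell_pair by auto.
  assert (S := th_split tau (u + 1 / 2) Ht).
  apply (Cmult_cancel _ _ (qpoch (tau / 2) 0)).
  { apply qpoch_0_neq_0. rewrite Im_div2; lra. }
  replace (qpoch (tau / 2) 0 * (qpoch tau 0 * (qpoch tau 0 * qpoch (tau / 2) 0 * th (tau / 2) (u + 1 / 2))))
    with (qpoch (tau / 2) 0 ^ 2 * (qpoch tau 0 ^ 2 * th (tau / 2) (u + 1 / 2))) by ring.
  rewrite S. ring.
Qed.

(* This is [appell_pair_minus] at tau + 1, that is, with the other square root of q. *)
Lemma appell_pair_plus (tau u : C) : (0 < Im tau)%R -> th tau u <> 0 ->
  qpoch tau 0 * (th tau u * sumZ (appell_pair_term tau u u))
  = qpoch ((tau + 1) / 2) 0 ^ 2 * (th tau (u + 1 / 2) * th tau (u + 1 / 2 + (tau + 1) / 2)).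
Proof.
  intros Ht Hu.
  assert (Ht' : (0 < Im (tau + 1))%R) by (destruct tau; unfold Im in *; simpl in *; lra).
  assert (H := appell_pair_minus (tau + 1) u Ht'). rewrite !th_succ, !qpoch_succ in H.
  rewrite <- H by auto. f_equal. f_equal. apply sumZ_ext. intros n.
  unfold appell_pair_term, appell_term.
  replace (e2pi (u + IZR n * (tau + 1))) with (e2pi (u + IZR n * tau)).
  2:{ symmetry. apply (e2pi_eq _ _ n). ring. }
  (* Passing to tau + 1 multiplies q^(n^2/2) by (-1)^n, which cancels the sign from the shift by
     1/2: (n^2 + n)/2 = n + k is an integer. *)
  f_equal. f_equal. symmetry. destruct (half_square_int n) as [k Hk].
  apply (e2pi_eq _ _ (n + k)).
  replace (RtoC (IZR (n + k))) with ((IZR n ^ 2 + IZR n) / 2); [ceq|].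
  rewrite plus_IZR. replace (IZR k) with ((IZR n * IZR n - IZR n) / 2)%R by (rewrite Hk; field).
  ceq.
Qed.

Lemma appell_odd_even_eval (tau u : C) : (0 < Im tau)%R -> th tau u <> 0 ->
  qpoch tau 0 * (th tau u * sumZ (appell_term tau (u + tau / 2) u))
  = qpoch (2 * tau) 0 ^ 2 * (th tau (u + tau / 2) * th tau (u + tau / 2 + 1 / 2)).
Proof.
  intros Ht Hu. rewrite appell_even by auto.
  assert (D := th_dup tau (u + tau / 2) Ht).
  replace (2 * (u + tau / 2)) with (2 * u + tau) in D by ceq.
  replace (qpoch tau 0 * (qpoch tau 0 * qpoch (2 * tau) 0 * th (2 * tau) (2 * u + tau)))
    with (qpoch (2 * tau) 0 * (qpoch tau 0 ^ 2 * th (2 * tau) (2 * u + tau))) by ring.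
  rewrite D. ring.
Qed.

(** Brings the terms of Phi_2, with poles in 1/y, to the denominators of Phi_1; the sign produced
    turns - Phi_2 into a sum that can be joined to Phi_1. *)
Lemma reflect_pole (a b : C) : 1 - e2pi b <> 0 ->
  e2pi a / (1 - e2pi (- b)) = - (e2pi (a + b) / (1 - e2pi b)).
Proof.
  intros H. rewrite e2pi_plus, e2pi_opp. field.
  split; auto. split; [apply e2pi_neq_0|]. intros E. apply H.
  replace (1 - e2pi b) with (- (e2pi b - 1)) by ring. rewrite E. ring.
Qed.

Lemma mul_div_ext (n d c x y : C) : n = c * x -> d = y -> n / d = c * (x / y).
Proof. intros -> ->. unfold Cdiv. ring. Qed.

Lemma INR2_half : (INR 2 / 2) = 1.
Proof. simpl (INR 2). ceq. Qed.

Lemma sumZ_opp_term (f : Z -> C) : abs_summable f -> sumZ (fun n => - f n) = - sumZ f.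
Proof.
  intros H. replace (- sumZ f) with ((-1) * sumZ f) by ring.
  rewrite <- sumZ_scal by auto. apply sumZ_ext; intros; ring.
Qed.

(** * Phi as a bilateral sum *)

Section SumDecomposition.
Context (tau u : C) (Ht : (0 < Im tau)%R) (Hu : th tau u <> 0).

(* Phi_1 supplies the terms of odd index and - Phi_2 those of even index. *)
Lemma Phi_one (k : Z) (t : C) :
  Phi 2 2 (2 * tau) (u + tau - IZR k) u t = e2pi (- t) * sumZ (appell_term tau (u + tau / 2) u).
Proof.
  set (f := appell_term tau (u + tau / 2) u).
  assert (Hf : abs_summable f) by exact (appell_summable tau _ u Ht Hu).
  assert (N := fun n => th_nonzero_pole_free tau u n Ht Hu).
  unfold Phi, Phi1, Phi2. rewrite INR2_half, Cmult_1_l.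
  rewrite (sumZ_ext _ (fun j => f (2 * j + 1)%Z)).
  2:{ intros j. unfold f, appell_term. rewrite <- !e2pi_plus.
      f_equal; [|f_equal; apply (e2pi_eq _ _ (- k)); ceq].
      apply (e2pi_eq _ _ (- (j + 1) * k)). ceq. }
  rewrite (sumZ_ext (fun n => _ / (1 - e2pi (- u) * _)) (fun j => - f (2 * - j)%Z)).
  2:{ intros j. unfold f, appell_term. rewrite <- !e2pi_plus.
      replace (- u + IZR j * (2 * tau)) with (- (u + IZR (2 * - j) * tau)) by ceq.
      rewrite reflect_pole by apply N. f_equal. f_equal.
      apply (e2pi_eq _ _ (j * k)). ceq. }
  rewrite (sumZ_opp_term (fun j => f (2 * - j)%Z)), (sumZ_opp (fun j => f (2 * j)%Z)).
  - rewrite (sumZ_even_odd f Hf). ring.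
  - now apply abs_summable_even.
  - apply (abs_summable_opp (fun j => f (2 * j)%Z)). now apply abs_summable_even.
Qed.

(** In the numerator 1 + y q^n of the paired sum, [a] belongs to the part 1 and [b] to the part y
    q^n. Apart from [Phi_one], all evaluations here combine the four sums of [a] and [b] over even
    and odd n. *)
Let a (n : Z) : C := appell_term tau u u n.
Let b (n : Z) : C := e2pi u * appell_term tau (u + tau) u n.

Let a_summable : abs_summable a.
Proof. exact (appell_summable tau u u Ht Hu). Qed.

Let b_summable : abs_summable b.
Proof. exact (abs_summable_scal _ _ (appell_summable tau _ u Ht Hu)). Qed.

Let b_eq (n : Z) : b n =
  e2pi (IZR n * u + tau * IZR n ^ 2 / 2 + (u + IZR n * tau)) / (1 - e2pi (u + IZR n * tau)).
Proof.
  unfold b, appell_term, Cdiv. rewrite Cmult_assoc, <- e2pi_plus. f_equal. f_equal. ring.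
Qed.

(** In the difference the denominator cancels, leaving theta terms; this is how the thetas of the
    correction are matched with the Appell terms. *)
Let ab_diff (n : Z) : a n + (-1) * b n = e2pi (IZR n * u + tau * IZR n ^ 2 / 2).
Proof.
  rewrite b_eq. unfold a, appell_term.
  rewrite (e2pi_plus (IZR n * u + tau * IZR n ^ 2 / 2)).
  assert (N := th_nonzero_pole_free tau u n Ht Hu).
  replace (RtoC (-1)) with (- RtoC 1) by ceq. field. exact N.
Qed.

Let sum_ab_plus :
  sumZ (appell_pair_term tau u u)
  = (sumZ (fun n => a (2 * n)%Z) + sumZ (fun n => b (2 * n)%Z))
    + (sumZ (fun n => a (2 * n + 1)%Z) + sumZ (fun n => b (2 * n + 1)%Z)).
Proof.
  assert (Ha := a_summable). assert (Hb := b_summable).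
  rewrite (sumZ_ext _ (fun n => a n + b n)) by (intros; apply appell_pair_term_eq).
  rewrite sumZ_plus, (sumZ_even_odd a Ha), (sumZ_even_odd b Hb) by auto. ring.
Qed.

Let appell_pair_term_half (n : Z) :
  appell_pair_term tau (u + 1 / 2) u n = e2pi (IZR n / 2) * (a n + b n).
Proof.
  assert (E := appell_pair_term_eq tau u u n). fold (a n) (b n) in E. rewrite <- E.
  unfold appell_pair_term, appell_term.
  replace (IZR n * (u + 1 / 2) + tau * IZR n ^ 2 / 2)
    with (IZR n / 2 + (IZR n * u + tau * IZR n ^ 2 / 2)) by ceq.
  rewrite (e2pi_plus (IZR n / 2)). unfold Cdiv. ring.
Qed.

Let sum_ab_minus :
  sumZ (appell_pair_term tau (u + 1 / 2) u)
  = (sumZ (fun n => a (2 * n)%Z) + sumZ (fun n => b (2 * n)%Z))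
    - (sumZ (fun n => a (2 * n + 1)%Z) + sumZ (fun n => b (2 * n + 1)%Z)).
Proof.
  assert (Ha := a_summable). assert (Hb := b_summable).
  rewrite (sumZ_even_odd _ (appell_pair_summable tau (u + 1 / 2) u Ht Hu)).
  assert (Hae := abs_summable_even a Ha). assert (Hbe := abs_summable_even b Hb).
  assert (Hao := abs_summable_odd a Ha). assert (Hbo := abs_summable_odd b Hb).
  rewrite (sumZ_ext (fun n => appell_pair_term _ _ _ (2 * n)%Z)
    (fun n => a (2 * n)%Z + b (2 * n)%Z)).
  2:{ intros n. rewrite appell_pair_term_half.
      rewrite (e2pi_eq _ 0 n) by ceq. rewrite e2pi_0. ring. }
  rewrite (sumZ_ext (fun n => appell_pair_term _ _ _ (2 * n + 1)%Z)
    (fun n => - (a (2 * n + 1)%Z + b (2 * n + 1)%Z))).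
  2:{ intros n. rewrite appell_pair_term_half.
      rewrite (e2pi_eq _ (1 / 2) n) by ceq. rewrite e2pi_half. ring. }
  rewrite (sumZ_opp_term (fun n => a (2 * n + 1)%Z + b (2 * n + 1)%Z)).
  2:{ now apply (abs_summable_plus (fun n => a (2 * n + 1)%Z)). }
  rewrite (sumZ_plus (fun n => a (2 * n)%Z)), (sumZ_plus (fun n => a (2 * n + 1)%Z)) by auto.
  ring.
Qed.

Let Phi_tw_minus :
  Phi 2 2 (2 * tau) (u - 1) u 0
  = sumZ (fun n => a (2 * n)%Z) + sumZ (fun n => b (2 * n)%Z).
Proof.
  assert (Hae := abs_summable_even a a_summable).
  assert (N := fun n => th_nonzero_pole_free tau u n Ht Hu).
  unfold Phi, Phi1, Phi2. rewrite INR2_half, Cmult_1_l.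
  replace (- RtoC 0) with (RtoC 0) by ring. rewrite e2pi_0, !Cmult_1_l.
  rewrite (sumZ_ext _ (fun j => b (2 * j)%Z)).
  2:{ intros j. rewrite b_eq. rewrite <- !e2pi_plus.
      f_equal; [|f_equal; apply (e2pi_eq _ _ (- 1)); ceq].
      apply (e2pi_eq _ _ (- (j + 1))). ceq. }
  rewrite (sumZ_ext (fun n => _ / (1 - e2pi (- u) * _)) (fun j => - a (2 * - j)%Z)).
  2:{ intros j. unfold a, appell_term. rewrite <- !e2pi_plus.
      replace (- u + IZR j * (2 * tau)) with (- (u + IZR (2 * - j) * tau)) by ceq.
      rewrite reflect_pole by apply N. f_equal. f_equal.
      apply (e2pi_eq _ _ j). ceq. }
  rewrite (sumZ_opp_term (fun j => a (2 * - j)%Z)), (sumZ_opp (fun j => a (2 * j)%Z)); auto.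
  - ring.
  - now apply (abs_summable_opp (fun j => a (2 * j)%Z)).
Qed.

Let Phi_tw_plus :
  Phi 2 2 (2 * tau) (u + tau - 1) (u - tau) (tau / 2)
  = sumZ (fun n => a (2 * n + 1)%Z) + sumZ (fun n => b (2 * n + 1)%Z).
Proof.
  assert (Hao := abs_summable_odd a a_summable). assert (Hbo := abs_summable_odd b b_summable).
  assert (N := fun n => th_nonzero_pole_free tau u n Ht Hu).
  unfold Phi, Phi1, Phi2. rewrite INR2_half, Cmult_1_l.
  rewrite (sumZ_ext _ (fun j => e2pi (tau / 2) * a (2 * j + 1)%Z)).
  2:{ intros j. unfold a, appell_term. rewrite <- !e2pi_plus. apply mul_div_ext;
        [rewrite <- e2pi_plus | f_equal; apply (e2pi_eq _ _ (- 1)); ceq].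
      apply (e2pi_eq _ _ (- (j + 1))). ceq. }
  rewrite (sumZ_ext (fun n => _ / (1 - e2pi (- (u - tau)) * _))
    (fun j => - (e2pi (tau / 2) * b (2 * (-1 - j) + 1)%Z))).
  (* Reflecting the pole sends the index 2j + 1 to -(2j + 1) = 2(-1 - j) + 1. *)
  2:{ intros j. rewrite b_eq. rewrite <- !e2pi_plus.
      replace (- (u - tau) + IZR j * (2 * tau)) with (- (u + IZR (2 * (-1 - j) + 1) * tau)) by ceq.
      rewrite reflect_pole by apply N. f_equal.
      apply mul_div_ext; [rewrite <- e2pi_plus | reflexivity].
      apply (e2pi_eq _ _ j). ceq. }
  rewrite (sumZ_opp_term (fun j => e2pi (tau / 2) * b (2 * (-1 - j) + 1)%Z)).
  2:{ apply (abs_summable_scal _ (fun j => b (2 * (-1 - j) + 1)%Z)).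
      now apply (abs_summable_refl (fun j => b (2 * j + 1)%Z)). }
  rewrite (sumZ_scal _ (fun j => b (2 * (-1 - j) + 1)%Z)),
    (sumZ_refl (fun j => b (2 * j + 1)%Z)), (sumZ_scal _ (fun j => a (2 * j + 1)%Z)); auto.
  2:{ now apply (abs_summable_refl (fun j => b (2 * j + 1)%Z)). }
  rewrite e2pi_opp. field. apply e2pi_neq_0.
Qed.

Let theta_half (k : Z) :
  theta (1 / 2) 2 (2 * tau) (2 * u + tau - IZR k)
  = e2pi (- (u / 2) - tau / 8 - IZR k / 4)
    * (sumZ (fun n => a (2 * n + 1)%Z) + (-1) * sumZ (fun n => b (2 * n + 1)%Z)).
Proof.
  assert (Hao := abs_summable_odd a a_summable). assert (Hbo := abs_summable_odd b b_summable).
  rewrite <- (sumZ_scal _ _ Hbo), <- sumZ_plus, <- sumZ_scal; auto.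
  2:{ apply (abs_summable_plus _ _ Hao (abs_summable_scal _ _ Hbo)). }
  2:{ apply (abs_summable_scal _ _ Hbo). }
  unfold theta. apply sumZ_ext. intros n. rewrite ab_diff, <- !e2pi_plus, INR2_half.
  apply (e2pi_eq _ _ (- (n * k))). ceq.
Qed.

Let theta_minus_half (k : Z) :
  theta (- (1 / 2))%R 2 (2 * tau) (2 * u + tau - IZR k)
  = e2pi (- (u / 2) - tau / 8 + IZR k / 4)
    * (sumZ (fun n => a (2 * n)%Z) + (-1) * sumZ (fun n => b (2 * n)%Z)).
Proof.
  assert (Hao := abs_summable_even a a_summable). assert (Hbo := abs_summable_even b b_summable).
  rewrite <- (sumZ_scal _ _ Hbo), <- sumZ_plus, <- sumZ_scal; auto.
  2:{ apply (abs_summable_plus _ _ Hao (abs_summable_scal _ _ Hbo)). }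
  2:{ apply (abs_summable_scal _ _ Hbo). }
  unfold theta. apply sumZ_ext. intros n. rewrite ab_diff, <- !e2pi_plus, INR2_half.
  apply (e2pi_eq _ _ (- (n * k))). ceq.
Qed.

(** The case k = 1 serves ch^(+) and k = 0 serves ch^(-). As s = 1/2, the shift by k leaves the sign
    e2pi(-k/2) on the odd part. *)
Let Phi_half (k : Z) :
  Phi 2 1 (2 * tau) (u + tau - IZR k) u (tau / 8)
  = e2pi (- (tau / 8) - u / 2) *
    (e2pi (- (IZR k / 2)) * sumZ (fun n => a (2 * n + 1)%Z) + sumZ (fun n => b (2 * n)%Z)).
Proof.
  assert (Hao := abs_summable_odd a a_summable). assert (Hbe := abs_summable_even b b_summable).
  assert (N := fun n => th_nonzero_pole_free tau u n Ht Hu).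
  unfold Phi, Phi1, Phi2. rewrite INR2_half, Cmult_1_l.
  rewrite (sumZ_ext _ (fun j => e2pi (- (u / 2) - IZR k / 2) * a (2 * j + 1)%Z)).
  2:{ intros j. unfold a, appell_term. rewrite <- !e2pi_plus. apply mul_div_ext;
        [rewrite <- e2pi_plus | f_equal; apply (e2pi_eq _ _ (- k)); ceq].
      apply (e2pi_eq _ _ (- (j * k))). ceq. }
  rewrite (sumZ_ext (fun n => _ / (1 - e2pi (- u) * _))
    (fun j => - (e2pi (- (u / 2)) * b (2 * - j)%Z))).
  2:{ intros j. rewrite b_eq. rewrite <- !e2pi_plus.
      replace (- u + IZR j * (2 * tau)) with (- (u + IZR (2 * - j) * tau)) by ceq.
      rewrite reflect_pole by apply N. f_equal.
      apply mul_div_ext; [rewrite <- e2pi_plus | reflexivity].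
      apply (e2pi_eq _ _ (j * k)). ceq. }
  assert (Hbm := abs_summable_opp (fun j => b (2 * j)%Z) Hbe). cbv beta in Hbm.
  rewrite (sumZ_opp_term (fun j => e2pi (- (u / 2)) * b (2 * - j)%Z)).
  2:{ exact (abs_summable_scal _ _ Hbm). }
  rewrite (sumZ_scal _ (fun j => b (2 * - j)%Z)), (sumZ_opp (fun j => b (2 * j)%Z)),
    (sumZ_scal _ (fun j => a (2 * j + 1)%Z)); auto.
  replace (- (u / 2) - IZR k / 2) with (- (u / 2) + - (IZR k / 2)) by ring.
  replace (- (tau / 8) - u / 2) with (- (tau / 8) + - (u / 2)) by ring.
  rewrite !e2pi_plus. ring.
Qed.

(** Only R_{1/2;1} contributes and it is a single exponential, so the correction is an elementary
    multiple of two theta functions. *)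
Let Phi_add_half (k : Z) :
  Phi_add 2 1 (2 * tau) (u + tau - IZR k) u (tau / 8)
  = - (1 / 2) * e2pi (- (tau / 8) - u / 2) *
    (e2pi (- (IZR k / 2)) * (sumZ (fun n => a (2 * n + 1)%Z) + (-1) * sumZ (fun n => b (2 * n + 1)%Z))
     - (sumZ (fun n => a (2 * n)%Z) + (-1) * sumZ (fun n => b (2 * n)%Z))).
Proof.
  unfold Phi_add. simpl (pred 2). rewrite sum_n_Sm, sum_n_n by lia.
  rewrite INR2_half, Cmult_1_l. simpl (INR 0). simpl (INR 1). rewrite Rplus_0_r.
  replace ((u + tau - IZR k - u) / 2) with (tau / 2 + (- (IZR k / 2))%R) by ceq.
  rewrite (Rcorr_half tau _ (- k)), (Rcorr_three_halves tau _ (- k))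
    by (auto; rewrite opp_IZR; field).
  rewrite Cmult_0_l.
  match goal with |- context [plus ?x ?y] => change (plus x y) with (x + y) end.
  rewrite Cplus_0_r.
  replace (u + tau - IZR k + u) with (2 * u + tau - IZR k) by ceq.
  rewrite theta_half, theta_minus_half.
  set (Ao := sumZ (fun n => a (2 * n + 1)%Z)). set (Bo := sumZ (fun n => b (2 * n + 1)%Z)).
  set (Ae := sumZ (fun n => a (2 * n)%Z)). set (Be := sumZ (fun n => b (2 * n)%Z)).
  assert (E1 : e2pi (tau / 8 + (- (IZR k / 2))%R / 2) * e2pi (- (u / 2) - tau / 8 - IZR k / 4)
     = e2pi (- (u / 2)) * e2pi (- (IZR k / 2))).
  { rewrite <- !e2pi_plus. f_equal. ceq. }
  assert (E2 : e2pi (tau / 8 + (- (IZR k / 2))%R / 2) * e2pi (- (u / 2) - tau / 8 + IZR k / 4)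
     = e2pi (- (u / 2))).
  { rewrite <- !e2pi_plus. f_equal. ceq. }
  replace (- (tau / 8) - u / 2) with (- (tau / 8) + - (u / 2)) by ring.
  rewrite (e2pi_plus (- (tau / 8))).
  transitivity (- (1 / 2) * e2pi (- (tau / 8)) *
    ((e2pi (tau / 8 + (- (IZR k / 2))%R / 2) * e2pi (- (u / 2) - tau / 8 - IZR k / 4)) * (Ao + -1 * Bo)
    - (e2pi (tau / 8 + (- (IZR k / 2))%R / 2) * e2pi (- (u / 2) - tau / 8 + IZR k / 4)) * (Ae + -1 * Be))).
  { ring. }
  rewrite E1, E2. ring.
Qed.

(** The correction averages: odd [a] becomes half the sum of odd [a] and odd [b], and even [b]
    likewise. *)
Let Phi_mod_half (k : Z) :
  Phi_mod 2 1 (2 * tau) (u + tau - IZR k) u (tau / 8)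
  = 1 / 2 * e2pi (- (tau / 8) - u / 2) *
    ((sumZ (fun n => a (2 * n)%Z) + sumZ (fun n => b (2 * n)%Z))
    + e2pi (- (IZR k / 2)) * (sumZ (fun n => a (2 * n + 1)%Z) + sumZ (fun n => b (2 * n + 1)%Z))).
Proof.
  unfold Phi_mod. rewrite Phi_half, Phi_add_half.
  replace (RtoC (-1)) with (- RtoC 1) by ceq.
  set (c := e2pi (- (tau / 8) - u / 2)).
  replace c with (1 / 2 * (1 + 1) * c) at 1; [ring|].
  replace (1 / 2 * (1 + 1)) with (RtoC 1) by ceq. ring.
Qed.

Lemma Phi_mod_half_minus :
  Phi_mod 2 1 (2 * tau) (u + tau - 1) u (tau / 8)
  = 1 / 2 * e2pi (- (tau / 8) - u / 2) * sumZ (appell_pair_term tau (u + 1 / 2) u).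
Proof.
  rewrite (Phi_mod_half 1), sum_ab_minus, e2pi_neg_half. ring.
Qed.

Lemma Phi_mod_half_plus :
  Phi_mod 2 1 (2 * tau) (u + tau) u (tau / 8)
  = 1 / 2 * e2pi (- (tau / 8) - u / 2) * sumZ (appell_pair_term tau u u).
Proof.
  replace (u + tau) with (u + tau - IZR 0) by ring.
  rewrite (Phi_mod_half 0), sum_ab_plus.
  replace (- (IZR 0 / 2)) with (RtoC 0) by ceq. rewrite e2pi_0. ring.
Qed.

(** The even-index part is half the sum over the two sign choices; the odd-index part in
    [Phi_tw_plus_eval] is half their difference. *)
Lemma Phi_tw_minus_eval :
  Phi 2 2 (2 * tau) (u - 1) u 0
  = 1 / 2 * (sumZ (appell_pair_term tau u u) + sumZ (appell_pair_term tau (u + 1 / 2) u)).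
Proof.
  rewrite Phi_tw_minus, sum_ab_plus, sum_ab_minus.
  set (e := sumZ (fun n => a (2 * n)%Z) + sumZ (fun n => b (2 * n)%Z)).
  set (o := sumZ (fun n => a (2 * n + 1)%Z) + sumZ (fun n => b (2 * n + 1)%Z)).
  replace (1 / 2 * (e + o + (e - o))) with ((1 / 2 * (1 + 1)) * e) by ring.
  replace (1 / 2 * (1 + 1)) with (RtoC 1) by ceq. ring.
Qed.

Lemma Phi_tw_plus_eval :
  Phi 2 2 (2 * tau) (u + tau - 1) (u - tau) (tau / 2)
  = 1 / 2 * (sumZ (appell_pair_term tau u u) - sumZ (appell_pair_term tau (u + 1 / 2) u)).
Proof.
  rewrite Phi_tw_plus, sum_ab_plus, sum_ab_minus.
  set (e := sumZ (fun n => a (2 * n)%Z) + sumZ (fun n => b (2 * n)%Z)).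
  set (o := sumZ (fun n => a (2 * n + 1)%Z) + sumZ (fun n => b (2 * n + 1)%Z)).
  replace (1 / 2 * (e + o - (e - o))) with ((1 / 2 * (1 + 1)) * o) by ring.
  replace (1 / 2 * (1 + 1)) with (RtoC 1) by ceq. ring.
Qed.

End SumDecomposition.

(** For m = 1 the characteristics k/2 and -k/2 differ by the integer k, so shifting the summation
    index identifies the series. *)
Lemma theta_even_symm (k : nat) (tau z : C) : (0 < Im tau)%R ->
  theta (INR k) 2 tau z = theta (- INR k)%R 2 tau z.
Proof.
  intros Ht. unfold theta. rewrite INR2_half.
  set (f := fun n => e2pi (1 * (RtoC (IZR n) + (- INR k)%R / (2 * 1)) * z)
     * e2pi (tau * 1 * (IZR n + (- INR k)%R / (2 * 1)) ^ 2)).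
  change (sumZ (fun n => e2pi (1 * (RtoC (IZR n) + INR k / (2 * 1)) * z)
     * e2pi (tau * 1 * (IZR n + INR k / (2 * 1)) ^ 2)) = sumZ f).
  assert (Hf : abs_summable f).
  { apply (abs_summable_quad tau (z - tau * INR k) (- (INR k * z / 2) + tau * INR k ^ 2 / 4)); auto.
    intros n. unfold f. rewrite <- e2pi_plus. f_equal. ceq. }
  rewrite <- (sumZ_shift f (Z.of_nat k) Hf). apply sumZ_ext. intros n. unfold f.
  rewrite plus_IZR, <- INR_IZR_INZ. f_equal; f_equal; ceq.
Qed.

Lemma Phi_add_one (tau z1 z2 t : C) : (0 < Im tau)%R -> Phi_add 2 2 tau z1 z2 t = 0.
Proof.
  intros Ht. unfold Phi_add. simpl (pred 2). rewrite sum_n_Sm, sum_n_n by lia.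
  replace (IZR 2 / 2 + INR 0)%R with (INR 1) by (simpl; field).
  replace (IZR 2 / 2 + INR 1)%R with (INR 2) by (simpl; field).
  rewrite !theta_even_symm by auto.
  match goal with |- context [plus ?x ?y] => change (plus x y) with (x + y) end.
  ring.
Qed.

Lemma Phi_mod_one (tau z1 z2 t : C) : (0 < Im tau)%R ->
  Phi_mod 2 2 tau z1 z2 t = Phi 2 2 tau z1 z2 t.
Proof. intros Ht. unfold Phi_mod. rewrite Phi_add_one by auto. ring. Qed.

(** * The numerators of the characters *)

(* The bilateral sums are taken at u = z - tau/2 + 1/2 for ch^(+), at u = z - tau/2 for ch^(-)
   and at u = z + 1/2 for the twisted characters. *)
Section Numerators.
Context (tau z : C) (Ht : (0 < Im tau)%R).

Let q1 := qpoch tau 0.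
Let q2 := qpoch (2 * tau) 0.
Let qh := qpoch (tau / 2) 0.
Let r := e2pi (tau / 8).
Let V00 := vartheta 0 0 tau z.
Let V01 := vartheta 0 1 tau z.
Let V10 := vartheta 1 0 tau z.
Let V11 := vartheta 1 1 tau z.
(** The prefactor q^(1/8) y^(-1/2) common to vartheta 1 0 and vartheta 1 1. *)
Let X := e2pi (tau / 8 - z / 2).

Let q1_neq_0 : q1 <> 0.
Proof. now apply qpoch_0_neq_0. Qed.

Let q2_neq_0 : q2 <> 0.
Proof. apply qpoch_0_neq_0, Im_scal_pos; auto; lra. Qed.

Let qh_neq_0 : qh <> 0.
Proof. apply qpoch_0_neq_0. rewrite Im_div2; lra. Qed.

Let X_neq_0 : X <> 0.
Proof. apply e2pi_neq_0. Qed.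

Let r_neq_0 : r <> 0.
Proof. apply e2pi_neq_0. Qed.

Let Ci_sqr : Ci * Ci = - (1).
Proof. ceq. Qed.

Let th_z : th tau z = Ci * V11 / X.
Proof.
  unfold V11. rewrite vartheta_11 by auto. fold X.
  replace (Ci * (- Ci * (X * th tau z))) with (- (Ci * Ci) * (X * th tau z)) by ring.
  rewrite Ci_sqr. field. auto.
Qed.

Let th_z_half : th tau (z + 1 / 2) = V10 / X.
Proof. unfold V10. rewrite vartheta_10 by auto. fold X. field. auto. Qed.

Let e_shift : e2pi (z - tau / 2) = / (X ^ 2 * r ^ 2).
Proof.
  replace (X ^ 2 * r ^ 2) with (e2pi (- (z - tau / 2))).
  - rewrite e2pi_opp. field. apply e2pi_neq_0.
  - replace (X ^ 2 * r ^ 2) with (X * X * (r * r)) by (simpl; ring).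
    unfold X, r. rewrite <- !e2pi_plus. f_equal. ceq.
Qed.

Let th_plus : th tau (z - tau / 2 + 1 / 2) = V00 / (X ^ 2 * r ^ 2).
Proof.
  rewrite th_plus_tau, e2pi_plus, e2pi_half, e_shift by auto.
  replace (z - tau / 2 + 1 / 2 + tau) with (z + tau / 2 + 1 / 2) by ceq.
  rewrite <- vartheta_00. fold V00. field. auto.
Qed.

Let th_minus : th tau (z - tau / 2) = - (V01 / (X ^ 2 * r ^ 2)).
Proof.
  rewrite th_plus_tau, e_shift by auto.
  replace (z - tau / 2 + tau) with (z + tau / 2) by ceq.
  rewrite <- vartheta_01. fold V01. field. auto.
Qed.

Let div_XXrr_neq_0 (v : C) : v <> 0 -> v / (X ^ 2 * r ^ 2) <> 0.
Proof.
  intros Hv. unfold Cdiv. apply Cmult_neq_0; auto. rewrite <- e_shift. apply e2pi_neq_0.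
Qed.

Let th_plus_neq_0 : V00 <> 0 -> th tau (z - tau / 2 + 1 / 2) <> 0.
Proof. intros H. rewrite th_plus. now apply div_XXrr_neq_0. Qed.

Let th_minus_neq_0 : V01 <> 0 -> th tau (z - tau / 2) <> 0.
Proof.
  intros H K. rewrite th_minus in K. apply (div_XXrr_neq_0 V01 H).
  replace (V01 / (X ^ 2 * r ^ 2)) with (- - (V01 / (X ^ 2 * r ^ 2))) by ring.
  rewrite K. ring.
Qed.

Let solve_sum (A T B : C) : T <> 0 -> q1 * (T * A) = B -> A = B / (q1 * T).
Proof. intros HT <-. field. auto. Qed.

Lemma Phi_plus_1 : V00 <> 0 ->
  Phi 2 2 (2 * tau) (z + tau / 2 - 1 / 2) (z - tau / 2 + 1 / 2) (tau / 8)
  = Ci * r * (q2 ^ 2 / q1) * (V11 * V10 / V00).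
Proof.
  intros H. assert (Hu := th_plus_neq_0 H). set (u := z - tau / 2 + 1 / 2) in *.
  replace (z + tau / 2 - 1 / 2) with (u + tau - IZR 1) by (unfold u; ceq).
  rewrite Phi_one by auto.
  assert (E := appell_odd_even_eval tau u Ht Hu). fold q1 q2 in E.
  rewrite (th_ext tau (u + tau / 2) (z + 1 / 2) 0),
    (th_ext tau (u + tau / 2 + 1 / 2) z 1) in E by (unfold u; ceq).
  apply solve_sum in E; auto. rewrite E, th_z, th_z_half, th_plus, e2pi_opp. fold r.
  field. repeat split; auto.
Qed.

Lemma Phi_minus_1 : V01 <> 0 ->
  Phi 2 2 (2 * tau) (z + tau / 2) (z - tau / 2) (tau / 8)
  = - Ci * r * (q2 ^ 2 / q1) * (V11 * V10 / V01).
Proof.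
  intros H. assert (Hu := th_minus_neq_0 H). set (u := z - tau / 2) in *.
  replace (z + tau / 2) with (u + tau - IZR 0) by (unfold u; ceq).
  rewrite Phi_one by auto.
  assert (E := appell_odd_even_eval tau u Ht Hu). fold q1 q2 in E.
  rewrite (th_ext tau (u + tau / 2) z 0),
    (th_ext tau (u + tau / 2 + 1 / 2) (z + 1 / 2) 0) in E by (unfold u; ceq).
  apply solve_sum in E; auto. rewrite E, th_z, th_z_half, th_minus, e2pi_opp. fold r.
  field. repeat split; auto.
Qed.

Let qh' : qpoch ((tau + 1) / 2) 0 = q1 ^ 3 / (qh * q2).
Proof.
  unfold q1. rewrite <- (qpoch_half_shift tau Ht). fold qh q2. field. auto.
Qed.

Let e_half_u : e2pi (- (tau / 8) - (z - tau / 2) / 2) = X.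
Proof. unfold X. f_equal. ceq. Qed.

Lemma Phi_mod_plus_0 : V00 <> 0 ->
  Phi_mod 2 1 (2 * tau) (z + tau / 2 - 1 / 2) (z - tau / 2 + 1 / 2) (tau / 8)
  = - (1 / 2) * (qh ^ 2 / q1) * (V11 * V01 / V00).
Proof.
  intros H. assert (Hu := th_plus_neq_0 H). set (u := z - tau / 2 + 1 / 2) in *.
  replace (z + tau / 2 - 1 / 2) with (u + tau - 1) by (unfold u; ceq).
  rewrite Phi_mod_half_minus by auto.
  assert (E := appell_pair_minus tau u Ht Hu). fold q1 qh in E.
  rewrite (th_ext tau (u + 1 / 2) (z - tau / 2) 1),
    (th_ext tau (u + 1 / 2 + tau / 2) z 1) in E by (unfold u; ceq).
  apply solve_sum in E; auto. rewrite E, th_z, th_plus, th_minus.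
  (* The shift of u by 1/2 contributes e2pi(-1/4) = 1/i, which cancels the i coming from vartheta 1
     1. *)
  replace (- (tau / 8) - u / 2) with ((- (tau / 8) - (z - tau / 2) / 2) + - (1 / 4))
    by (unfold u; ceq).
  rewrite e2pi_plus, e_half_u, e2pi_opp, e2pi_quarter.
  assert (HC : Ci <> 0) by (intros K; rewrite K in Ci_sqr; injection Ci_sqr; lra).
  (* Abstracting the constant keeps the numeral 2 out of the denominators that [field] has to
     clear. *)
  set (half := 1 / 2).
  field. repeat split; auto.
Qed.

Lemma Phi_mod_minus_0 : V01 <> 0 ->
  Phi_mod 2 1 (2 * tau) (z + tau / 2) (z - tau / 2) (tau / 8)
  = - (Ci / 2) * ((q1 ^ 3 / (qh * q2)) ^ 2 / q1) * (V11 * V00 / V01).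
Proof.
  intros H. assert (Hu := th_minus_neq_0 H). set (u := z - tau / 2) in *.
  replace (z + tau / 2) with (u + tau) by (unfold u; ceq).
  rewrite Phi_mod_half_plus by auto.
  assert (E := appell_pair_plus tau u Ht Hu). rewrite qh' in E. fold q1 in E.
  rewrite (th_ext tau (u + 1 / 2 + (tau + 1) / 2) z 1) in E by (unfold u; ceq).
  apply solve_sum in E; auto. unfold u in *. rewrite E, th_z, th_plus, th_minus, e_half_u.
  replace (Ci / 2) with (1 / 2 * Ci) by (unfold Cdiv; ring).
  set (half := 1 / 2).
  field. repeat split; auto.
Qed.

Let tw_sum_minus : V10 <> 0 ->
  sumZ (appell_pair_term tau (z + 1 / 2 + 1 / 2) (z + 1 / 2))
  = Ci * (qh ^ 2 / q1) * (V11 * V01 / V10).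
Proof.
  intros H.
  assert (Hu : th tau (z + 1 / 2) <> 0).
  { intros K. apply H. unfold V10. rewrite vartheta_10, K by auto. ring. }
  assert (E := appell_pair_minus tau (z + 1 / 2) Ht Hu). fold q1 qh in E.
  rewrite (th_ext tau (z + 1 / 2 + 1 / 2) z 1),
    (th_ext tau (z + 1 / 2 + 1 / 2 + tau / 2) (z + tau / 2) 1) in E by ceq.
  rewrite <- vartheta_01 in E. fold V01 in E.
  apply solve_sum in E; auto. rewrite E, th_z, th_z_half. field. repeat split; auto.
Qed.

Let tw_sum_plus : V10 <> 0 ->
  sumZ (appell_pair_term tau (z + 1 / 2) (z + 1 / 2))
  = Ci * ((q1 ^ 3 / (qh * q2)) ^ 2 / q1) * (V11 * V00 / V10).
Proof.
  intros H.
  assert (Hu : th tau (z + 1 / 2) <> 0).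
  { intros K. apply H. unfold V10. rewrite vartheta_10, K by auto. ring. }
  assert (E := appell_pair_plus tau (z + 1 / 2) Ht Hu). rewrite qh' in E. fold q1 in E.
  rewrite (th_ext tau (z + 1 / 2 + 1 / 2) z 1),
    (th_ext tau (z + 1 / 2 + 1 / 2 + (tau + 1) / 2) (z + tau / 2 + 1 / 2) 1) in E by ceq.
  rewrite <- vartheta_00 in E. fold V00 in E.
  apply solve_sum in E; auto. rewrite E, th_z, th_z_half. field. repeat split; auto.
Qed.

Lemma Phi_tw_sm_1 : V10 <> 0 ->
  Phi 2 2 (2 * tau) (z - 1 / 2) (z + 1 / 2) 0
  = 1 / 2 * (Ci * ((q1 ^ 3 / (qh * q2)) ^ 2 / q1) * (V11 * V00 / V10)
             + Ci * (qh ^ 2 / q1) * (V11 * V01 / V10)).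
Proof.
  intros H.
  assert (Hu : th tau (z + 1 / 2) <> 0).
  { intros K. apply H. unfold V10. rewrite vartheta_10, K by auto. ring. }
  replace (z - 1 / 2) with (z + 1 / 2 - 1) by ceq.
  rewrite Phi_tw_minus_eval, tw_sum_plus, tw_sum_minus by auto. reflexivity.
Qed.

Lemma Phi_tw_sp_1 : V10 <> 0 ->
  Phi 2 2 (2 * tau) (z + tau - 1 / 2) (z - tau + 1 / 2) (tau / 2)
  = 1 / 2 * (Ci * ((q1 ^ 3 / (qh * q2)) ^ 2 / q1) * (V11 * V00 / V10)
             - Ci * (qh ^ 2 / q1) * (V11 * V01 / V10)).
Proof.
  intros H.
  assert (Hu : th tau (z + 1 / 2) <> 0).
  { intros K. apply H. unfold V10. rewrite vartheta_10, K by auto. ring. }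
  replace (z + tau - 1 / 2) with (z + 1 / 2 + tau - 1) by ceq.
  replace (z - tau + 1 / 2) with (z + 1 / 2 - tau) by ceq.
  rewrite Phi_tw_plus_eval, tw_sum_plus, tw_sum_minus by auto. reflexivity.
Qed.

End Numerators.

Lemma RtoC_sqrt2 : RtoC (sqrt 2) * RtoC (sqrt 2) = 2.
Proof. rewrite <- RtoC_mult, sqrt_sqrt by lra. reflexivity. Qed.

Theorem theorem5p1 :
  Klevel 2 = (-1)%R /\
  forall tau z : C,
  (0 < Im tau)%R ->
  vartheta 1 1 tau z <> 0 ->
  (vartheta 0 0 tau z <> 0 ->
     mch_p 2 0 tau z
       = - (1 / 2) * (eta (tau / 2) / (eta (2 * tau) * eta tau))
         * vartheta 0 1 tau z
     /\
     (mch_p 2 1 tau z = ch_p 2 1 tau z /\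
      ch_p 2 1 tau z
       = Ci * (eta (2 * tau) / (eta (tau / 2) * eta tau))
         * vartheta 1 0 tau z))
  /\
  (vartheta 0 1 tau z <> 0 ->
     mch_m 2 0 tau z
       = - (Ci / 2) * (eta tau ^ 2 / (eta (tau / 2) * eta (2 * tau) ^ 2))
         * vartheta 0 0 tau z
     /\
     (mch_m 2 1 tau z = ch_m 2 1 tau z /\
      ch_m 2 1 tau z
       = - Ci * (eta (tau / 2) * eta (2 * tau) ^ 2 / eta tau ^ 4)
         * vartheta 1 0 tau z))
  /\
  (vartheta 1 0 tau z <> 0 ->
     (mch_tw_sm 2 1 tau z = ch_tw_sm 2 1 tau z /\
      ch_tw_sm 2 1 tau z
       = Ci / sqrt 2
         * (eta tau ^ 2 / (eta (tau / 2) ^ 2 * eta (2 * tau))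
              * vartheta 0 0 tau z
            + eta (tau / 2) ^ 2 * eta (2 * tau) / eta tau ^ 4
              * vartheta 0 1 tau z))
     /\
     (mch_tw_sp 2 1 tau z = ch_tw_sp 2 1 tau z /\
      ch_tw_sp 2 1 tau z
       = Ci / sqrt 2
         * (eta tau ^ 2 / (eta (tau / 2) ^ 2 * eta (2 * tau))
              * vartheta 0 0 tau z
            - eta (tau / 2) ^ 2 * eta (2 * tau) / eta tau ^ 4
              * vartheta 0 1 tau z))).
Proof.
  split; [unfold Klevel; simpl; field|].
  intros tau z Ht H11.
  assert (Ht2 : (0 < Im (2 * tau))%R) by (apply Im_scal_pos; auto; lra).
  assert (Hth : (0 < Im (tau / 2))%R) by (rewrite Im_div2; lra).
  assert (Q1 := qpoch_0_neq_0 tau Ht). assert (Q2 := qpoch_0_neq_0 _ Ht2).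
  assert (Qh := qpoch_0_neq_0 _ Hth).
  (* h = q^(1/48) is a common root of the fractional powers of q: eta at tau/2, tau and 2 tau
     carries h, h^2 and h^4, and q^(1/8) = h^6. The identities become rational. *)
  set (h := e2pi (tau / 48)). assert (Hh : h <> 0) by apply e2pi_neq_0.
  assert (E1 : eta tau = h ^ 2 * qpoch tau 0).
  { rewrite eta_qpoch. f_equal. simpl. unfold h. rewrite Cmult_1_r, <- e2pi_plus. f_equal. ceq. }
  assert (Eh : eta (tau / 2) = h * qpoch (tau / 2) 0).
  { rewrite eta_qpoch. f_equal. unfold h. f_equal. ceq. }
  assert (E2 : eta (2 * tau) = h ^ 4 * qpoch (2 * tau) 0).
  { rewrite eta_qpoch. f_equal. simpl. unfold h. rewrite Cmult_1_r, <- !e2pi_plus. f_equal. ceq. }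
  assert (Er : e2pi (tau / 8) = h ^ 6).
  { simpl. unfold h. rewrite Cmult_1_r, <- !e2pi_plus. f_equal. ceq. }
  assert (S2 : RtoC (sqrt 2) <> 0).
  { apply RtoC_neq_0, Rgt_not_eq, sqrt_lt_R0. lra. }
  split; [|split]; intros H0.
  - split; [|split].
    + unfold mch_p, char_p, Rden_p. change (Z.of_nat 0 + 1)%Z with 1%Z.
      rewrite Phi_mod_plus_0, E1, E2, Eh by auto.
      set (half := 1 / 2).
      field. repeat split; auto.
    + unfold mch_p, ch_p, char_p. change (Z.of_nat 1 + 1)%Z with 2%Z.
      now rewrite Phi_mod_one.
    + unfold ch_p, char_p, Rden_p. change (Z.of_nat 1 + 1)%Z with 2%Z.
      rewrite Phi_plus_1, E1, E2, Eh, Er by auto. field. repeat split; auto.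
  - split; [|split].
    + unfold mch_m, char_m, Rden_m. change (Z.of_nat 0 + 1)%Z with 1%Z.
      rewrite Phi_mod_minus_0, E1, E2, Eh by auto.
      replace (Ci / 2) with (/ 2 * Ci) by (unfold Cdiv; ring). set (half := / 2).
      field. repeat split; auto.
    + unfold mch_m, ch_m, char_m. change (Z.of_nat 1 + 1)%Z with 2%Z.
      now rewrite Phi_mod_one.
    + unfold ch_m, char_m, Rden_m. change (Z.of_nat 1 + 1)%Z with 2%Z.
      rewrite Phi_minus_1, E1, E2, Eh, Er by auto. field. repeat split; auto.
  - split; split.
    + unfold mch_tw_sm, ch_tw_sm, char_tw_sm. change (Z.of_nat 1 + 1)%Z with 2%Z.
      now rewrite Phi_mod_one.
    + unfold ch_tw_sm, char_tw_sm, Rden_tw. change (Z.of_nat 1 + 1)%Z with 2%Z.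
      rewrite Phi_tw_sm_1, E1, E2, Eh by auto.
      (* Hides the numeral 2 in the moduli, so that the next rewrite acts only on the factor 1/2 and
         expresses it through the square root of 2. *)
      set (q2 := qpoch (2 * tau) 0) in *. set (qh := qpoch (tau / 2) 0) in *.
      rewrite <- RtoC_sqrt2.
      field. repeat split; auto.
    + unfold mch_tw_sp, ch_tw_sp, char_tw_sp. change (Z.of_nat 1 + 1)%Z with 2%Z.
      now rewrite Phi_mod_one.
    + unfold ch_tw_sp, char_tw_sp, Rden_tw. change (Z.of_nat 1 + 1)%Z with 2%Z.
      rewrite Phi_tw_sp_1, E1, E2, Eh by auto.
      set (q2 := qpoch (2 * tau) 0) in *. set (qh := qpoch (tau / 2) 0) in *.
      rewrite <- RtoC_sqrt2.
      field. repeat split; auto.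
Qed.
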